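(* Let $\rho\in L^1(\mathbb{R}^n)$ satisfy $\int_{\mathbb{R}^n}\rho=1$. Let $s>0$. Then the following are equivalent. 1. There exists some $\eta\in\mathcal{S}(\mathbb{R}^n)$ such that $\int\eta\neq0$ and $$\int_0^1\frac 1{\varepsilon^{s+1}}\|\eta-\eta\ast\rho_\varepsilon\|_{L^1}\, d\varepsilon<\infty.$$ 2. For every $1\le p\le\infty$ and every $1\le q<\infty$ we have $$\|f\|_{B^{s}_{p,q}}^q\sim \|f\|_{L^p}^q+\int_0^1\frac 1{\varepsilon^{sq+1}}\|f-f\ast\rho_\varepsilon\|_{L^p}^q\, d\varepsilon,$$ that is, there is a constant $C\in[1,\infty)$ (depending on $\rho,s,p,q,n$ but not on $f$) such that for every $f\in L^p(\mathbb{R}^n)$ each side, as an element of $[0,\infty]$, is at most $C$ times the other.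
   Context: For a function $g$ on $\mathbb{R}^n$ and $\varepsilon>0$, $g_\varepsilon(x)=\varepsilon^{-n}g(x/\varepsilon)$. $\mathcal{S}(\mathbb{R}^n)$ is the Schwartz class. Besov norm. Fix $\zeta,\varphi\in\mathcal{S}(\mathbb{R}^n)$ with $\operatorname{supp}\widehat\zeta\subset B(0,2)$, $\widehat\zeta\equiv1$ in a neighborhood of $\overline{B}(0,1)$, and $\varphi:=\zeta_{1/2}-\zeta$, so that $\widehat\varphi=\widehat\zeta(\cdot/2)-\widehat\zeta$ and $\operatorname{supp}\widehat\varphi\subset B(0,4)\setminus\overline{B}(0,1)$. The (inhomogeneous) Littlewood-Paley decomposition of a temperate distribution $f$ is $f=\sum_{j\ge0}f_j$ with $f_0=f\ast\zeta$ and $f_j=f\ast\varphi_{2^{1-j}}$ for $j\ge1$. For $f\in L^p$ and $1\le q<\infty$, set $|f|_{B^s_{p,q}}^q=\sum_{j\ge0}2^{sjq}\|f_j\|_{L^p}^q$ and $\|f\|_{B^s_{p,q}}^q=\|f\|_{L^p}^q+|f|_{B^s_{p,q}}^q$ (possibly $+\infty$); $B^s_{p,q}$ is the set of $f\in L^p$ for which this is finite. *)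

(* Defs.v *)
From HB Require Import structures.
From mathcomp Require Import all_boot all_order all_algebra.
From mathcomp Require Import complex.
From mathcomp Require Import all_classical all_reals all_analysis.

Set Implicit Arguments.
Unset Strict Implicit.
Unset Printing Implicit Defensive.
Import Order.TTheory GRing.Theory Num.Theory.
Import numFieldNormedType.Exports.

Local Open Scope classical_set_scope.
Local Open Scope ring_scope.

(* The product sigma-algebra, generated by the coordinates; for T = R it is the
   Borel sigma-algebra of R^n. *)
Definition measure_rV_display : measure_display -> measure_display.
Proof. exact. Qed.

Section measurable_rV.
Context {d} {T : measurableType d} (n : nat).

Let coors (i : 'I_n) (x : 'rV[T]_n) : T := x ord0 i.

Let rV_set0 : g_sigma_preimage coors set0.
Proof. exact: sigma_algebra0. Qed.

Let rV_setC A : g_sigma_preimage coors A -> g_sigma_preimage coors (~` A).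
Proof. exact: sigma_algebraC. Qed.

Let rV_bigcup (F : _^nat) : (forall i, g_sigma_preimage coors (F i)) ->
  g_sigma_preimage coors (\bigcup_i (F i)).
Proof. exact: sigma_algebra_bigcup. Qed.

HB.instance Definition _ := @isMeasurable.Build (measure_rV_display d)
  'rV[T]_n (g_sigma_preimage coors) rV_set0 rV_setC rV_bigcup.

Lemma measurable_coord_rV (i : 'I_n) :
  measurable_fun [set: 'rV[T]_n] (fun x : 'rV[T]_n => x ord0 i).
Proof.
move=> _ Y mY; rewrite setTI; apply: sub_sigma_algebra => /=.
rewrite -bigcup_seq/=; exists i => /=; first by rewrite mem_index_enum.
by exists Y => //; rewrite setTI.
Qed.

Lemma measurable_fun_rVP d1 (T1 : measurableType d1) (f : T1 -> 'rV[T]_n) :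
  (forall i, measurable_fun [set: T1] (fun x => f x ord0 i)) ->
  measurable_fun [set: T1] f.
Proof.
move=> mf; suff H : g_sigma_preimage (fun i => coors i \o f) `<=` measurable.
  move=> _ A mA; rewrite setTI; apply: H.
  by rewrite g_sigma_preimage_comp; exists A => //; rewrite setTI.
apply: smallest_sub; first exact: sigma_algebra_measurable.
rewrite -bigcup_seq => A [i _] [B mB <-]; exact: mf.
Qed.

End measurable_rV.

Section lebesgue_rV.
Context {R : realType}.

Section step.
Variables (n : nat) (mu : {sigma_finite_measure set 'rV[R]_n -> \bar R}).

Definition cons_rV (p : measurableTypeR R * 'rV[R]_n) : 'rV[R]_n.+1 :=
  row_mx (p.1)%:M p.2.

Definition uncons_rV (v : 'rV[R]_n.+1) : measurableTypeR R * 'rV[R]_n :=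
  (v ord0 ord0, \row_i v ord0 (lift ord0 i)).

Let cons_rVK : cancel cons_rV uncons_rV.
Proof.
move=> [x v]; rewrite /uncons_rV /cons_rV/=; congr pair.
  transitivity (row_mx (x%:M : 'M[R]_1) v ord0 (lshift n ord0)).
    by congr (_ _ _); exact: val_inj.
  by rewrite row_mxEl mxE.
apply/rowP => i; rewrite mxE.
transitivity (row_mx (x%:M : 'M[R]_1) v ord0 (rshift 1 i)).
  by congr (_ _ _); exact: val_inj.
by rewrite row_mxEr.
Qed.

Lemma measurable_cons_rV : measurable_fun [set: _] cons_rV.
Proof.
apply: measurable_fun_rVP => i; rewrite /cons_rV.
case: (@split_ordP 1 n i) => j ->.
  rewrite (_ : (fun _ => _) = fst); first exact: measurable_fst.
  by apply/funext => p; rewrite [LHS]row_mxEl mxE !ord1.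
rewrite (_ : (fun _ => _) = (fun v : 'rV[R]_n => v ord0 j) \o snd); last first.
  by apply/funext => p; rewrite [LHS]row_mxEr.
by apply: measurableT_comp => //; exact: measurable_coord_rV.
Qed.

Let measurable_uncons_rV : measurable_fun [set: _] uncons_rV.
Proof.
apply/measurable_fun_pairP; split; first exact: measurable_coord_rV.
apply: measurable_fun_rVP => i /=; under eq_fun do rewrite mxE.
exact: measurable_coord_rV.
Qed.

Definition lebesgue_consrV : set 'rV[R]_n.+1 -> \bar R :=
  pushforward (lebesgue_measure \x mu)%E cons_rV.

HB.instance Definition _ := Measure.copy lebesgue_consrV
  (measure_function_pushforward__canonical__measure_function_Measure
    (lebesgue_measure \x mu)%E measurable_cons_rV).

Lemma lebesgue_consrVE (A : set (measurableTypeR R)) (B : set 'rV[R]_n) :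
  measurable A -> measurable B ->
  lebesgue_consrV (uncons_rV @^-1` (A `*` B)) =
  (lebesgue_measure A * mu B)%E.
Proof.
move=> mA mB; rewrite /lebesgue_consrV /pushforward -comp_preimage.
rewrite (_ : _ \o _ = id); first by rewrite preimage_id product_measure1E.
by apply/funext => x; exact: cons_rVK.
Qed.

Let sigma_finite_lebesgue_consrV : sigma_finite [set: _] lebesgue_consrV.
Proof.
have /sigma_finiteP[F [TF ndF Foo]] := sigma_finiteT (@lebesgue_measure R).
have /sigma_finiteP[G [TG ndG Goo]] := sigma_finiteT mu.
exists (fun k => uncons_rV @^-1` (F k `*` G k)).
  rewrite -preimage_bigcup -(preimage_setT uncons_rV); congr (_ @^-1` _).
  rewrite -setXTT TF TG predeqE => -[x y]; split.
    move=> [/= [i _ Fix] [k _ Gky]]; exists (maxn i k) => //; split.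
    - by move: x Fix; exact/subsetPset/ndF/leq_maxl.
    - by move: y Gky; exact/subsetPset/ndG/leq_maxr.
  by move=> [i _ []/= ? ?]; split; exists i.
move=> k; have [? ?] := Foo k; have [? ?] := Goo k; split.
  rewrite -[X in measurable X]setTI; apply: measurable_uncons_rV => //.
  exact: measurableX.
by rewrite lebesgue_consrVE// lte_mul_pinfty// ge0_fin_numE.
Qed.

HB.instance Definition _ := Measure_isSigmaFinite.Build _ _ _ lebesgue_consrV
  sigma_finite_lebesgue_consrV.

End step.

Fixpoint lebesgue_rV n : {sigma_finite_measure set 'rV[R]_n -> \bar R} :=
  match n with
  | 0 => dirac (0 : 'rV[R]_0)
  | n'.+1 => lebesgue_consrV (lebesgue_rV n')
  end.

(* The values on measurable boxes determine Lebesgue measure on R^n. *)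
Lemma lebesgue_rV_box n (A : 'I_n -> set (measurableTypeR R)) :
  (forall i, measurable (A i)) ->
  lebesgue_rV n [set x | forall i, A i (x ord0 i)] =
  (\prod_(i < n) lebesgue_measure (A i))%E.
Proof.
have mbox m (B : 'I_m -> set (measurableTypeR R)) :
    (forall i, measurable (B i)) ->
    measurable [set x : 'rV[R]_m | forall i, B i (x ord0 i)].
  move=> mB.
  rewrite (_ : mkset _ =
      \bigcap_(i in [set: 'I_m]) ((fun x : 'rV[R]_m => x ord0 i) @^-1` B i)).
    apply: fin_bigcap_measurable => [|i _]; first exact: finite_finset.
    have := @measurable_coord_rV _ R m i measurableT (B i) (mB i).
    by rewrite setTI.
  by rewrite eqEsubset; split=> x /= Bx i; [move=> _; exact: Bx|exact: Bx].
elim: n A => [|n IHn] A mA.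
  by rewrite big_ord0 /= diracE mem_set// => -[].
rewrite big_ord_recl -IHn; last by move=> i; exact: mA.
rewrite -lebesgue_consrVE//; last exact: (mbox n (fun i => A (lift ord0 i))).
rewrite [LHS]/=; congr lebesgue_consrV; rewrite eqEsubset; split=> v /=.
  by move=> Av; split=> [|i]; rewrite ?mxE; exact: Av.
move=> [A0 AS] i; case: (unliftP ord0 i) => [j|] ->//.
by have := AS j; rewrite mxE.
Qed.

End lebesgue_rV.

Section function_spaces.
Context {R : realType} {n : nat}.
Implicit Types (f g : 'rV[R]_n -> R[i]) (x xi : 'rV[R]_n).

Local Notation mu := (@lebesgue_rV R n).
Local Notation Re := (@complex.Re R).
Local Notation Im := (@complex.Im R).

(* The norm of ['rV[R]_n] as a [normedModType] is the sup norm; it induces the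
   same topology as this one but has different balls. *)
Definition eucl_norm x : R := Num.sqrt (\sum_(i < n) x ord0 i ^+ 2).

Definition dotprod x xi : R := \sum_(i < n) x ord0 i * xi ord0 i.

(* The real part (resp. the imaginary part) of the result is a junk value unless
   [Re \o f] (resp. [Im \o f]) is integrable. In [convolution] this only
   concerns a negligible set of points when f is in L^p and g in L^1. *)
Definition cintegral f : R[i] :=
  Complex (\int[mu]_x Re (f x)) (\int[mu]_x Im (f x)).

Definition convolution f g : 'rV[R]_n -> R[i] :=
  fun x => cintegral (fun y => f (x - y) * g y).

Definition dilate (e : R) g : 'rV[R]_n -> R[i] :=
  fun x => ((e ^- n)%:C)%C * g (e^-1 *: x).

Definition Lp_norm (p : \bar R) f : \bar R :=
  Lnorm mu p (fun x => (Normc.normc (f x))%:E).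

Definition in_Lp (p : \bar R) f : Prop :=
  [/\ measurable_fun [set: _] (Re \o f), measurable_fun [set: _] (Im \o f) &
      (Lp_norm p f < +oo)%E].

(* [iter_partial [:: i_1; ...; i_k] h] is the partial derivative of [h] along
   the coordinates i_k, ..., i_1; the multi-index of the derivative is the
   vector of multiplicities in the sequence. *)
Definition iter_partial (s : seq 'I_n) (h : 'rV[R]_n -> R) : 'rV[R]_n -> R :=
  foldr (fun i k => 'D_(delta_mx ord0 i) k) h s.

Definition smooth (h : 'rV[R]_n -> R) : Prop :=
  forall s : seq 'I_n,
    continuous (iter_partial s h) /\
    forall i x, derivable (iter_partial s h) x (delta_mx ord0 i).

Definition rapidly_decreasing (h : 'rV[R]_n -> R) : Prop :=
  forall (a : 'I_n -> nat) (s : seq 'I_n), exists M : R, forall x,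
    `| (\prod_(i < n) x ord0 i ^+ a i) * iter_partial s h x | <= M.

(* Real and imaginary parts are treated separately because [R[i]] is not a
   [normedModType R], so that 'D_v does not apply to [R[i]]-valued functions. *)
Definition schwartz f : Prop :=
  [/\ smooth (Re \o f), smooth (Im \o f),
      rapidly_decreasing (Re \o f) & rapidly_decreasing (Im \o f)].

(* Normalization: the integral of f(x) exp(-2 i pi <x, xi>) dx. *)
Definition fourier f : 'rV[R]_n -> R[i] :=
  fun xi => cintegral (fun x =>
    f x * Complex (cos (2 * pi * dotprod x xi)) (- sin (2 * pi * dotprod x xi))).

Definition fsupport f : set 'rV[R]_n := closure [set x | f x != 0].

Definition LP_cutoff (zeta : 'rV[R]_n -> R[i]) : Prop :=
  [/\ schwartz zeta,
      fsupport (fourier zeta) `<=` [set xi | eucl_norm xi < 2] &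
      exists U : set 'rV[R]_n,
        [/\ open U, [set xi | eucl_norm xi <= 1] `<=` U &
            forall xi, U xi -> fourier zeta xi = 1]].

Definition LP_phi (zeta : 'rV[R]_n -> R[i]) : 'rV[R]_n -> R[i] :=
  dilate 2^-1 zeta \- zeta.

(* For j = j'.+1 the dilation factor is 2^(1-j) = 2^(-j'). *)
Definition LP_block (zeta : 'rV[R]_n -> R[i]) f (j : nat) : 'rV[R]_n -> R[i] :=
  if j is j'.+1 then convolution f (dilate (2 ^- j') (LP_phi zeta))
  else convolution f zeta.

Local Open Scope ereal_scope.

(* The q-th powers of the Besov seminorm and norm. *)
Definition besov_seminormXq zeta (s : R) (p : \bar R) (q : R) f : \bar R :=
  \sum_(0 <= j <oo)
    (2 `^ (s * j%:R * q))%R%:E * Lp_norm p (LP_block zeta f j) `^ q.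

Definition besov_normXq zeta (s : R) (p : \bar R) (q : R) f : \bar R :=
  Lp_norm p f `^ q + besov_seminormXq zeta s p q f.

Definition mollif_integral (rho : 'rV[R]_n -> R[i]) (s : R) (p : \bar R) (q : R)
    f : \bar R :=
  \int[lebesgue_measure]_(e in `]0%R, 1%R[)
    ((e `^ (s * q + 1))^-1%R%:E * Lp_norm p (f \- convolution f (dilate e rho))%R `^ q).

End function_spaces.

(* Main.v *)
(* The proof only uses L^1 bounds on convolution kernels and Young's inequality.
   Write g_e for the dilate of g and K_j for the kernel of the j-th block
   f_j = f * K_j. Uniqueness of the Fourier transform on L^1 gives
   zeta_a * zeta_b = zeta_a for b <= a/2, so that K_j is reproduced by zeta_r with
   r = 2^(-j-1) and, for j >= 1, by a dilate theta_r, r = 2^(1-j), of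
   theta = zeta_(1/4) - zeta_2, whose integral is 0.

   (1) => (2). As int theta = 0, the L^1 norm of theta_r * rho_e is at most 1/2 when
   r/e is small, and then f_j = f_j * theta_r yields |f_j| <= 2 |f_j - f_j * rho_e|.
   Conversely g = f_j - f_j * rho_e equals g * zeta_r, and zeta_r is L^1-close to
   zeta_r * eta_(d r) for small d, whence |g| <= C |f_j| w(e/(d r)) with
   w(t) = |eta - eta * rho_t|_1. Summing over j and splitting ]0, 1[ into dyadic
   intervals, (2) follows from Schur's test, since 2^(s k) w(t_k) is summable for
   suitable points t_k of the dyadic intervals.

   (2) => (1). Take f = eta = zeta and p = q = 1: zeta * K_j = 0 for j >= 2. *)
From HB Require Import structures.
Require Import Defs.
From mathcomp Require Import all_boot all_order all_algebra.
From mathcomp Require Import complex ring lra zify.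
From mathcomp Require Import all_classical all_reals all_analysis.
From mathcomp Require Import measurable_realfun ess_sup_inf.

Set Implicit Arguments.
Unset Strict Implicit.
Unset Printing Implicit Defensive.
Import Order.TTheory GRing.Theory Num.Theory.
Import numFieldNormedType.Exports.
Local Open Scope classical_set_scope.
Local Open Scope ring_scope.

(** Three obstacles shape the proof. The measurability of e |-> |f - f * rho_e|_p is not at hand,
    and the integral of w controls no prescribed value of w. Integrals over ]0, 1[ are therefore
    compared with dyadic step functions only, and t_k is a near-minimizer of w on the k-th interval.
    Such a choice is possible because the bound on g by w(t) holds for every t above a threshold
    proportional to e/r, so that one t_k serves a whole dyadic interval of values of e. Passing from
    blocks back to a function must also work for p = +oo, where mollifications need not converge in
    norm. The bound of |h|_p by the sum of the |h * K_j|_p comes from telescoping h * zeta_(2^-J),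
    from convergence almost everywhere along a subsequence, and from Fatou's lemma or the essential
    supremum. Convolutions are total functions with default values, so associativity and linearity
    hold almost everywhere only, whereas identities that rest on a substitution alone hold at every
    point. In Schur's test w helps only when 2^-j is large compared with e. For finer blocks the
    trivial bound (1 + |rho|_1) |f_j|_p is used, and s > 0 makes the resulting kernel summable. *)

Lemma eq_leW d (T : porderType d) (x y : T) : x = y -> (x <= y)%O.
Proof. by move=> ->. Qed.

Lemma near_half_pow_le (R : realType) (e : R) : 0 < e -> \forall k \near \oo, 2 ^- k <= e.
Proof.
move=> e0; have : (2 ^- k : R) @[k --> \oo] --> (0 : R).
  under eq_cvg do rewrite -exprVn.
  by apply: cvg_expr; rewrite ger0_norm// invf_lt1 ?ltr1n.
move=> /cvgr0Pnorm_le /(_ e e0); apply: filterS => k; exact/le_trans/ler_norm.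
Qed.

Lemma ex_half_pow_le (R : realType) (e : R) : 0 < e -> exists k : nat, 2 ^- k <= e.
Proof. by move=> /near_half_pow_le[k _ /(_ k (leqnn k))]; exists k. Qed.

Lemma powR2D (R : realType) (x y : R) : 2 `^ (x + y) = 2 `^ x * 2 `^ y.
Proof. by rewrite powRD//; apply/implyP. Qed.

(** * Change of variables in R^n *)

Section affine1.
Context {R : realType}.
Local Notation leb := (@lebesgue_measure R).
Variables (a b : R) (a0 : a != 0).

Definition affine1 (x : measurableTypeR R) : measurableTypeR R := a * x + b.

Lemma measurable_affine1 : measurable_fun [set: measurableTypeR R] affine1.
Proof. by apply: measurable_funD => //; apply: measurable_funM. Qed.

Let pf : {measure set (measurableTypeR R) -> \bar R} :=
  measure_function_pushforward__canonical__measure_function_Measure leb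
    measurable_affine1.

(** Lebesgue measure is determined by the intervals ]c, d], so it suffices to compute their
    preimages; a negative slope moves the closed end to the left, which does not affect the
    length. *)
Lemma lebesgue_affine1 A : measurable A ->
  leb A = mscale (NngNum (normr_ge0 a)) pf A.
Proof.
move: A; apply: lebesgue_measure_unique => _ [[c d] _ <-].
rewrite /= /mscale/= /pushforward/=.
have aE : a * (a^-1) = 1 by rewrite divff.
have [ap|an] : 0 < a \/ a < 0 by case: (ltgtP a 0) a0 => //; [right|left].
- have -> : affine1 @^-1` `]c, d] = `](c - b) / a, (d - b) / a]%classic.
    rewrite eqEsubset; split=> x /=; rewrite /affine1 !in_itv/=;
    by rewrite ltr_pdivrMr// ler_pdivlMr// ltrBlDr lerBrDr (mulrC x).
  rewrite !lebesgue_measure_itv/= !lte_fin ltr_pM2r ?invr_gt0// ltrBlDr subrK.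
  case: ifPn => _; last by rewrite mule0.
  rewrite -!EFinD -EFinM gtr0_norm// mulrBr !(mulrC a) !divfK//.
  by congr EFin; ring.
- have -> : affine1 @^-1` `]c, d] = `[(d - b) / a, (c - b) / a[%classic.
    rewrite eqEsubset; split=> x /=; rewrite /affine1 !in_itv/= andbC;
    by rewrite ltr_ndivlMr// ler_ndivrMr// ltrBlDr lerBrDr (mulrC x).
  rewrite !lebesgue_measure_itv/= !lte_fin ltr_nM2r ?invr_lt0// ltrBlDr subrK.
  case: ifPn => _; last by rewrite mule0.
  rewrite -!EFinD -EFinM ltr0_norm// mulrBr !(mulrC (- a)) !mulrN !divfK//.
  by congr EFin; ring.
Qed.

Lemma ge0_integral_affine1 (f : measurableTypeR R -> \bar R) :
  measurable_fun [set: measurableTypeR R] f -> (forall x, 0 <= f x)%E ->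
  (\int[leb]_x f x = `|a|%:E * \int[leb]_x f (affine1 x))%E.
Proof.
move=> mf f0.
rewrite (@eq_measure_integral _ _ _ setT
  (mscale (NngNum (normr_ge0 a)) pf) leb); last first.
  by move=> A mA _; exact: lebesgue_affine1.
by rewrite ge0_integral_mscale//= (ge0_integral_pushforward measurable_affine1).
Qed.

End affine1.

Section rVn.
Context {R : realType}.
Local Notation leb := (@lebesgue_measure R).

Lemma ge0_integral_consrV n (f : 'rV[R]_n.+1 -> \bar R) :
  measurable_fun [set: 'rV[R]_n.+1] f -> (forall x, 0 <= f x)%E ->
  (\int[lebesgue_rV n.+1]_x f x =
   \int[leb]_x \int[lebesgue_rV n]_v f (cons_rV (x, v)))%E.
Proof.
move=> mf f0.
transitivity (\int[pushforward (leb \x lebesgue_rV n)%E (@cons_rV R n)]_x f x)%E.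
  by [].
rewrite (ge0_integral_pushforward (measurable_cons_rV (n:=n)))// (fubini_tonelli1 (f \o @cons_rV R n))//.
  by apply: measurableT_comp => //; exact: measurable_cons_rV.
by move=> x; exact: f0.
Qed.

Section arith.
Context {d} {T : measurableType d}.

Lemma measurable_rVD n (f g : T -> 'rV[R]_n) : measurable_fun [set: T] f ->
  measurable_fun [set: T] g -> measurable_fun [set: T] (fun x => f x + g x).
Proof.
move=> mf mg; apply: measurable_fun_rVP => i; under eq_fun do rewrite mxE.
by apply: measurable_funD; apply: (measurableT_comp (measurable_coord_rV i)).
Qed.

Lemma measurable_rVZ n (h : T -> R) (f : T -> 'rV[R]_n) :
  measurable_fun [set: T] h -> measurable_fun [set: T] f ->
  measurable_fun [set: T] (fun x => h x *: f x).
Proof.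
move=> mh mf; apply: measurable_fun_rVP => i; under eq_fun do rewrite mxE.
by apply: measurable_funM => //; apply: (measurableT_comp (measurable_coord_rV i)).
Qed.

Lemma measurable_rVN n (f : T -> 'rV[R]_n) : measurable_fun [set: T] f ->
  measurable_fun [set: T] (fun x => - f x).
Proof.
move=> mf; apply: measurable_fun_rVP => i; under eq_fun do rewrite mxE.
by apply: measurableT_comp => //; apply: (measurableT_comp (measurable_coord_rV i)).
Qed.

Lemma measurable_rVB n (f g : T -> 'rV[R]_n) : measurable_fun [set: T] f ->
  measurable_fun [set: T] g -> measurable_fun [set: T] (fun x => f x - g x).
Proof. by move=> mf mg; apply: measurable_rVD => //; exact: measurable_rVN. Qed.

End arith.

Lemma cons_rV_affine n (a : R) (b : 'rV[R]_n.+1) x v :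
  a *: cons_rV (x, v) + b =
  cons_rV (a * x + (uncons_rV b).1, a *: v + (uncons_rV b).2).
Proof.
apply/rowP => i; rewrite /cons_rV /uncons_rV !mxE /=.
case: (@split_ordP 1 n i) => j ->.
  rewrite !mxE !ord1 /= !mulr1n; congr (_ + b _ _).
  exact: val_inj.
rewrite !mxE; congr (_ + b _ _).
exact: val_inj.
Qed.

Lemma measurable_fun_consrV n (f : 'rV[R]_n.+1 -> \bar R) :
  measurable_fun [set: 'rV[R]_n.+1] f ->
  measurable_fun [set: measurableTypeR R * 'rV[R]_n]
    (fun z => f (cons_rV z)).
Proof. by move=> mf; apply: measurableT_comp => //; exact: measurable_cons_rV. Qed.

(** Induction on the dimension: the map acts separately on the first coordinate and on the remaining
    ones, and each coordinate contributes one factor |a|. *)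
Lemma ge0_integral_affine n (a : R) (b : 'rV[R]_n) (f : 'rV[R]_n -> \bar R) :
  a != 0 -> measurable_fun [set: 'rV[R]_n] f -> (forall x, 0 <= f x)%E ->
  (\int[lebesgue_rV n]_x f x =
   (`|a| ^+ n)%:E * \int[lebesgue_rV n]_x f (a *: x + b)%R)%E.
Proof.
move=> a0; elim: n b f => [|n IH] b f mf f0.
  rewrite expr0 mul1e; apply: eq_integral => x _; congr (f _).
  by apply/rowP => -[].
rewrite !ge0_integral_consrV//; last first.
  by apply: measurableT_comp => //; apply: measurable_rVD => //; exact: measurable_rVZ.
rewrite (ge0_integral_affine1 (uncons_rV b).1 a0); last 2 first.
  exact: (measurable_fun_fubini_tonelli_F (fun z => f (cons_rV z)))
    (measurable_fun_consrV mf) (fun z => f0 _).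
  by move=> x; apply: integral_ge0.
rewrite exprS EFinM -muleA; congr (_ * _)%E.
rewrite -ge0_integralZl_EFin//; last 2 first.
  by move=> x _; apply: integral_ge0.
  apply: (measurable_fun_fubini_tonelli_F (fun z => f (a *: cons_rV z + b)))=> //.
  apply: (@measurable_fun_consrV _ (fun z => f (a *: z + b))).
  by apply: measurableT_comp => //; apply: measurable_rVD => //; exact: measurable_rVZ.
apply: eq_integral => x _.
rewrite (IH (uncons_rV b).2)//; last first.
  apply: measurableT_comp => //.
  apply: (@measurableT_comp _ _ _ _ _ _ (@cons_rV R n)).
    exact: measurable_cons_rV.
  exact: measurable_fun_pair.
by congr (_ * _)%E; apply: eq_integral => v _; rewrite cons_rV_affine.
Qed.

Lemma measurable_affine n (a : R) (b : 'rV[R]_n) :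
  measurable_fun [set: 'rV[R]_n] (fun x => a *: x + b).
Proof. by apply: measurable_rVD => //; exact: measurable_rVZ. Qed.

Lemma gt0_muleBr (k : R) (x y : \bar R) : (0 < k)%R ->
  (k%:E * (x - y) = k%:E * x - k%:E * y)%E.
Proof.
move=> k0; have ky : (k%:E * +oo = +oo)%E by rewrite gt0_muley ?lte_fin.
have kNy : (k%:E * -oo = -oo)%E by rewrite gt0_muleNy ?lte_fin.
case: x y => [x||] [y||] /=; rewrite ?ky ?kNy//.
by rewrite -EFinB -!EFinM -EFinB mulrBr.
Qed.

(** The positive and negative parts are treated separately and recombined by [gt0_muleBr], so no
    integrability is required. The convolution identities that come from a substitution thereby hold
    even where the integral takes a default value. *)
Lemma integral_affine n (a : R) (b : 'rV[R]_n) (f : 'rV[R]_n -> \bar R) :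
  a != 0 -> measurable_fun [set: 'rV[R]_n] f ->
  (\int[lebesgue_rV n]_x f x =
   (`|a| ^+ n)%:E * \int[lebesgue_rV n]_x f (a *: x + b)%R)%E.
Proof.
move=> a0 mf; rewrite integralE [X in (_ * X)%E]integralE.
rewrite (ge0_integral_affine b a0 (measurable_funepos mf))//.
rewrite (ge0_integral_affine b a0 (measurable_funeneg mf))//.
have an : (0 < `|a| ^+ n)%R by rewrite exprn_gt0// normr_gt0.
rewrite [RHS]gt0_muleBr//; congr (_ * _ - _ * _)%E.
  by apply: eq_integral => x _; rewrite !funeposE.
by apply: eq_integral => x _; rewrite !funenegE.
Qed.

Lemma Rintegral_affine n (a : R) (b : 'rV[R]_n) (f : 'rV[R]_n -> R) :
  a != 0 -> measurable_fun [set: 'rV[R]_n] f ->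
  (\int[lebesgue_rV n]_x f x =
   (`|a| ^+ n) * \int[lebesgue_rV n]_x f (a *: x + b))%R.
Proof.
move=> a0 mf; rewrite /Rintegral (integral_affine b a0); last exact/measurable_EFinP.
have an : (0 < `|a| ^+ n)%R by rewrite exprn_gt0// normr_gt0.
case: (integral _ _ _) => [r||]; first by [].
  by rewrite gt0_muley ?lte_fin// mulr0.
by rewrite gt0_muleNy ?lte_fin// mulr0.
Qed.

End rVn.

Local Notation Re := (@complex.Re _).
Local Notation Im := (@complex.Im _).
Local Notation normc := (@Normc.normc _).

(** * Complex-valued integrals *)

Section complex_arith.
Context {R : rcfType}.
Implicit Types x y z : R[i].

Lemma ReD x y : Re (x + y) = Re x + Re y. Proof. by case: x y => ? ? []. Qed.
Lemma ImD x y : Im (x + y) = Im x + Im y. Proof. by case: x y => ? ? []. Qed.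
Lemma ReN x : Re (- x) = - Re x. Proof. by case: x. Qed.
Lemma ImN x : Im (- x) = - Im x. Proof. by case: x. Qed.
Lemma ReB x y : Re (x - y) = Re x - Re y. Proof. by case: x y => ? ? []. Qed.
Lemma ImB x y : Im (x - y) = Im x - Im y. Proof. by case: x y => ? ? []. Qed.
Lemma ReM x y : Re (x * y) = Re x * Re y - Im x * Im y.
Proof. by case: x y => ? ? []. Qed.
Lemma ImM x y : Im (x * y) = Re x * Im y + Im x * Re y.
Proof. by case: x y => ? ? []. Qed.
Lemma complex_ext x y : Re x = Re y -> Im x = Im y -> x = y.
Proof. by case: x y => ? ? [? ?] /= -> ->. Qed.

Lemma normcRI x : normc x = Num.sqrt (Re x ^+ 2 + Im x ^+ 2).
Proof. by case: x. Qed.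

Lemma normc_ge0 x : 0 <= normc x. Proof. by rewrite normcRI sqrtr_ge0. Qed.

Lemma normc_sqr x : normc x ^+ 2 = Re x ^+ 2 + Im x ^+ 2.
Proof. by rewrite normcRI sqr_sqrtr// addr_ge0 ?sqr_ge0. Qed.

Lemma normc_Re x : `|Re x| <= normc x.
Proof. by rewrite normcRI -sqrtr_sqr ler_wsqrtr// lerDl sqr_ge0. Qed.

Lemma normc_Im x : `|Im x| <= normc x.
Proof. by rewrite normcRI -sqrtr_sqr ler_wsqrtr// lerDr sqr_ge0. Qed.

Lemma normc_leD x : normc x <= `|Re x| + `|Im x|.
Proof.
rewrite -(@ler_pXn2r _ 2) ?nnegrE ?normc_ge0 ?addr_ge0// normc_sqr.
rewrite sqrrD !real_normK ?num_real// lerD2r lerDl.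
by rewrite mulrn_wge0// mulr_ge0.
Qed.

Lemma normcB x y : normc (x - y) <= normc x + normc y.
Proof. by rewrite -(normcN y); exact: le_normcD. Qed.

Lemma normc_eq0 x : (normc x == 0) = (x == 0).
Proof.
apply/eqP/eqP => [|->]; first exact: Normc.eq0_normc.
exact: Normc.normc0.
Qed.

Lemma normc_realM (r : R) x : normc ((r%:C)%C * x) = `|r| * normc x.
Proof. by rewrite Normc.normcM /= expr0n /= addr0 sqrtr_sqr. Qed.

Lemma Re_Im_le_normc (X Y : R) x : X * Re x + Y * Im x <= normc (Complex X Y) * normc x.
Proof.
apply: (le_trans (ler_norm _)).
rewrite -(@ler_pXn2r _ 2) ?nnegrE ?mulr_ge0 ?normc_ge0// exprMn !normc_sqr /=.
rewrite real_normK ?num_real// -subr_ge0.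
rewrite (_ : _ - _ = (X * Im x - Y * Re x) ^+ 2) ?sqr_ge0//; ring.
Qed.

End complex_arith.

Section cint.
Context {R : realType}.

Definition cmeasurable d (T : measurableType d) (f : T -> R[i]) :=
  measurable_fun [set: T] (Re \o f) /\ measurable_fun [set: T] (Im \o f).

(** The analogue of [cintegral] for any measure; for [lebesgue_rV] the two are convertible, so goals
    about [convolution] and [fourier] can be restated with [cint]. *)
Definition cint d (T : measurableType d) (m : {measure set T -> \bar R}) (f : T -> R[i]) :
    R[i] :=
  Complex (\int[m]_x Re (f x)) (\int[m]_x Im (f x)).

Definition cintegrable d (T : measurableType d) (m : {measure set T -> \bar R})
    (f : T -> R[i]) :=
  m.-integrable [set: T] (EFin \o (Re \o f)) /\
  m.-integrable [set: T] (EFin \o (Im \o f)).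

Section cmeasurable.
Context {d} {T : measurableType d}.
Implicit Types f g : T -> R[i].

Lemma cmeasurable_cst c : cmeasurable (fun _ : T => c).
Proof. by split; exact: measurable_cst. Qed.

Lemma cmeasurableD f g : cmeasurable f -> cmeasurable g ->
  cmeasurable (fun x => f x + g x).
Proof.
move=> [fr fi] [gr gi]; split; rewrite /comp; under eq_fun do rewrite ?ReD ?ImD;
exact: measurable_funD.
Qed.

Lemma cmeasurableN f : cmeasurable f -> cmeasurable (fun x => - f x).
Proof.
move=> [fr fi]; split; rewrite /comp; under eq_fun do rewrite ?ReN ?ImN;
exact: measurableT_comp.
Qed.

Lemma cmeasurableB f g : cmeasurable f -> cmeasurable g ->
  cmeasurable (fun x => f x - g x).
Proof. by move=> mf mg; apply: cmeasurableD => //; exact: cmeasurableN. Qed.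

Lemma cmeasurableM f g : cmeasurable f -> cmeasurable g ->
  cmeasurable (fun x => f x * g x).
Proof.
move=> [fr fi] [gr gi]; split; rewrite /comp.
  under eq_fun do rewrite ReM.
  by apply: measurable_funB; exact: measurable_funM.
under eq_fun do rewrite ImM.
by apply: measurable_funD; exact: measurable_funM.
Qed.

Lemma cmeasurable_comp d' (T' : measurableType d') f (h : T' -> T) :
  cmeasurable f -> measurable_fun [set: T'] h -> cmeasurable (fun x => f (h x)).
Proof.
move=> [fr fi] mh; split; [exact: (measurableT_comp fr)|exact: (measurableT_comp fi)].
Qed.

Lemma measurable_normc f : cmeasurable f ->
  measurable_fun [set: T] (fun x => normc (f x)).
Proof.
move=> [fr fi]; under eq_fun do rewrite normcRI.
under eq_fun do rewrite -powR12_sqrt ?addr_ge0 ?sqr_ge0//.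
apply: (measurableT_comp (measurable_powR _)).
by apply: measurable_funD; apply: measurable_funX.
Qed.

Lemma measurable_cnorm f : cmeasurable f ->
  measurable_fun [set: T] (fun x => (normc (f x))%:E).
Proof. by move=> mf; apply/measurable_EFinP; exact: measurable_normc. Qed.

Lemma cmeasurable_indic (A : set T) f : measurable A -> cmeasurable f ->
  cmeasurable (fun x => ((\1_A x)%:C)%C * f x).
Proof.
move=> mA mf; apply: cmeasurableM => //; split; last exact: measurable_cst.
exact: measurable_indic.
Qed.

End cmeasurable.

Section cintegrable.
Context {d} {T : measurableType d} (m : {measure set T -> \bar R}).
Implicit Types f g : T -> R[i].

Lemma cintegrable_meas f : cintegrable m f -> cmeasurable f.
Proof.
by move=> [/integrableP[/measurable_EFinP ? _] /integrableP[/measurable_EFinP ? _]].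
Qed.

Lemma cintegrableP f : cmeasurable f ->
  (\int[m]_x (normc (f x))%:E < +oo)%E -> cintegrable m f.
Proof.
move=> mf foo; have mn := measurable_cnorm mf; case: mf => fr fi.
split; apply/integrableP; split; (try exact/measurable_EFinP);
  apply: le_lt_trans foo; apply: ge0_le_integral => //; (try by move=> x _; rewrite lee_fin normc_ge0);
  try by apply/measurable_EFinP; exact: measurableT_comp.
all: by move=> x _; rewrite lee_fin ?normc_Re ?normc_Im.
Qed.

Lemma cintegrable_normc f : cintegrable m f ->
  (\int[m]_x (normc (f x))%:E < +oo)%E.
Proof.
move=> cf; have mn := measurable_cnorm (cintegrable_meas cf).
have [mr mi] := cintegrable_meas cf.
case: cf => /integrableP[_ fr] /integrableP[_ fi].
apply: le_lt_trans (_ : (\int[m]_x `|(Re (f x))%:E| + \int[m]_x `|(Im (f x))%:E| < +oo)%E).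
  rewrite -ge0_integralD//; last 2 first.
  - by apply/measurable_EFinP; exact: measurableT_comp.
  - by apply/measurable_EFinP; exact: measurableT_comp.
  apply: ge0_le_integral => //.
  - by move=> x _; rewrite lee_fin normc_ge0.
  - by apply: emeasurable_funD; apply/measurable_EFinP; exact: measurableT_comp.
  by move=> x _; rewrite lee_fin normc_leD.
exact: lte_add_pinfty.
Qed.

Lemma cintegrableZ c f : cintegrable m f -> cintegrable m (fun x => c * f x).
Proof.
move=> cf; have mf := cintegrable_meas cf; apply: cintegrableP.
  by apply: cmeasurableM => //; exact: cmeasurable_cst.
under eq_integral do rewrite Normc.normcM EFinM.
rewrite ge0_integralZl//; last 3 first.
- exact: measurable_cnorm.
- by move=> x _; rewrite lee_fin normc_ge0.
- by rewrite lee_fin normc_ge0.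
by rewrite lte_mul_pinfty ?lee_fin ?normc_ge0// cintegrable_normc.
Qed.

Lemma cintB f g : cintegrable m f -> cintegrable m g ->
  cint m (fun x => f x - g x) = cint m f - cint m g.
Proof.
move=> [fr fi] [gr gi]; apply: complex_ext; rewrite ?ReB ?ImB /=.
  by rewrite -RintegralB//; under eq_Rintegral do rewrite ReB.
by rewrite -RintegralB//; under eq_Rintegral do rewrite ImB.
Qed.

Lemma cintZ c f : cintegrable m f -> cint m (fun x => c * f x) = c * cint m f.
Proof.
move=> [fr fi]; apply: complex_ext; rewrite ?ReM ?ImM /=.
  under eq_Rintegral do rewrite ReM.
  rewrite RintegralB//; first by rewrite !RintegralZl.
    exact: (@integrableZl _ _ _ m _ measurableT (Re c) (EFin \o (Re \o f))).
  exact: (@integrableZl _ _ _ m _ measurableT (Im c) (EFin \o (Im \o f))).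
under eq_Rintegral do rewrite ImM.
rewrite RintegralD//; first by rewrite !RintegralZl.
  exact: (@integrableZl _ _ _ m _ measurableT (Re c) (EFin \o (Im \o f))).
exact: (@integrableZl _ _ _ m _ measurableT (Im c) (EFin \o (Re \o f))).
Qed.

(** Pair the integral z with itself: |z|^2 is the integral of Re z Re f + Im z Im f, which
    Cauchy-Schwarz bounds by |z| times the integral of |f|. *)
Lemma le_cint f : cmeasurable f ->
  ((normc (cint m f))%:E <= \int[m]_x (normc (f x))%:E)%E.
Proof.
move=> mf; have mn := measurable_cnorm mf.
have [foo|] := ltP (\int[m]_x (normc (f x))%:E)%E +oo%E; last first.
  by rewrite leye_eq => /eqP ->; rewrite leey.
have [cr ci] := cintegrableP mf foo.
set z := cint m f; have [->|z0] := eqVneq z 0.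
  by rewrite Normc.normc0; apply: integral_ge0 => x _; rewrite lee_fin normc_ge0.
have nz : 0 < normc z by rewrite lt_neqAle normc_ge0 eq_sym normc_eq0 z0.
have foofin : (\int[m]_x (normc (f x))%:E)%E \is a fin_num.
  by rewrite ge0_fin_numE//; apply: integral_ge0 => x _; rewrite lee_fin normc_ge0.
have inn : m.-integrable setT (EFin \o (fun x => normc (f x))).
  apply/integrableP; split => //.
  by under eq_integral do rewrite /= ger0_norm ?normc_ge0//.
rewrite -(fineK foofin) lee_fin -[fine _]/(Rintegral _ _ _).
rewrite -(ler_pM2l nz) -expr2 normc_sqr -RintegralZl//.
rewrite [X in X <= _](_ : _ = \int[m]_x (Re z * Re (f x) + Im z * Im (f x)))%R.
  apply: le_Rintegral => //.
  - apply: (@integrableD _ _ _ m _ measurableT (fun x => (Re z * Re (f x))%:E)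
      (fun x => (Im z * Im (f x))%:E)).
      exact: (@integrableZl _ _ _ m _ measurableT (Re z) (EFin \o (Re \o f))).
    exact: (@integrableZl _ _ _ m _ measurableT (Im z) (EFin \o (Im \o f))).
  - exact: (@integrableZl _ _ _ m _ measurableT (normc z) (EFin \o (fun x => normc (f x)))).
  by move=> x _; apply: (le_trans (Re_Im_le_normc _ _ _)); case: z {z0 nz}.
rewrite RintegralD//; first by rewrite !RintegralZl// !expr2.
  exact: (@integrableZl _ _ _ m _ measurableT (Re z) (EFin \o (Re \o f))).
exact: (@integrableZl _ _ _ m _ measurableT (Im z) (EFin \o (Im \o f))).
Qed.

Lemma ae_eq_cint f g : cmeasurable f -> cmeasurable g ->
  {ae m, forall x, f x = g x} -> cint m f = cint m g.
Proof.
move=> [fr fi] [gr gi] fg; rewrite /cint /Rintegral.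
congr (Complex (fine _) (fine _)); apply: ae_eq_integral => //;
  (try exact/measurable_EFinP).
all: by apply: filterS fg => x -> _.
Qed.

End cintegrable.

(** Tonelli gives the measurability of the integrals of the positive and negative parts.
    Integrability of the sections is not assumed, so convolutions are measurable whatever their
    default values are. *)
Lemma measurable_Rint {d1 d2} {T1 : measurableType d1} {T2 : measurableType d2}
  (m2 : {sigma_finite_measure set T2 -> \bar R}) (h : T1 * T2 -> R) :
  measurable_fun [set: T1 * T2] h ->
  measurable_fun [set: T1] (fun x => \int[m2]_y h (x, y)).
Proof.
move=> mh; apply: (@measurableT_comp _ _ _ _ _ _ fine) => //.
under eq_fun do rewrite integralE.
apply: emeasurable_funB.
  under eq_fun => x do under eq_integral do rewrite funeposE.
  apply: (measurable_fun_fubini_tonelli_F (fun z => maxe (h z)%:E 0)) => //.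
    by apply: measurable_maxe => //; exact/measurable_EFinP.
  by move=> z; rewrite le_max lexx orbT.
under eq_fun => x do under eq_integral do rewrite funenegE.
apply: (measurable_fun_fubini_tonelli_F (fun z => maxe (- (h z)%:E) 0)%E) => //.
  by apply: measurable_maxe => //; apply/measurable_EFinP; exact: measurableT_comp.
by move=> z; rewrite le_max lexx orbT.
Qed.

Section cfubini.
Context {d1 d2} {T1 : measurableType d1} {T2 : measurableType d2}.
Variables (m1 : {sigma_finite_measure set T1 -> \bar R}).
Variables (m2 : {sigma_finite_measure set T2 -> \bar R}).
Variable f : T1 * T2 -> R[i].
Hypothesis mf : cmeasurable f.

Lemma cmeasurable_cint : cmeasurable (fun x => cint m2 (fun y => f (x, y))).
Proof. by case: mf => fr fi; split; [exact: (measurable_Rint m2 fr)|exact: (measurable_Rint m2 fi)]. Qed.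

Lemma cint_fubini :
  (\int[m1]_x \int[m2]_y (normc (f (x, y)))%:E < +oo)%E ->
  cint m1 (fun x => cint m2 (fun y => f (x, y))) =
  cint m2 (fun y => cint m1 (fun x => f (x, y))).
Proof.
move=> foo.
have ci : cintegrable (m1 \x m2)%E f.
  apply: cintegrableP => //; rewrite fubini_tonelli1//.
    exact: measurable_cnorm.
  by move=> x; rewrite lee_fin normc_ge0.
(* The library's Fubini theorem concerns extended inner integrals; taking [fine] of them changes
   nothing outside a null set. *)
have key (h : T1 * T2 -> R) : measurable_fun setT h ->
  (m1 \x m2)%E.-integrable setT (EFin \o h) ->
  (\int[m1]_x \int[m2]_y h (x, y) = \int[m2]_y \int[m1]_x h (x, y))%R.
  move=> mh ih.
  have iF := integrable_fubini_F ih.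
  rewrite /Rintegral; congr fine.
  transitivity (\int[m1]_x \int[m2]_y (h (x, y))%:E)%E.
    apply: ae_eq_integral => //.
    - by apply/measurable_EFinP; exact: measurable_Rint.
    - exact: measurable_int iF.
    by apply: filterS (integrable_ae measurableT iF) => x /(_ I) xf _; rewrite fineK.
  rewrite -[LHS]/(\int[m1]_x \int[m2]_y ((EFin \o h) (x, y)))%E Fubini//.
  apply: ae_eq_integral => //.
  - exact: measurable_fubini_G ih.
  - apply/measurable_EFinP.
    apply: (measurable_Rint m1 (h := fun z => h (z.2, z.1))).
    by apply: measurableT_comp => //; exact: measurable_fun_pair.
  by apply: filterS (ae_integrable2 ih) => x xf _; rewrite fineK//; exact: integrable_fin_num.
case: mf => fr fi; case: ci => cr ci.
by apply: complex_ext; [exact: (key (Re \o f) fr cr)|exact: (key (Im \o f) fi ci)].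
Qed.

End cfubini.

End cint.

(** * L^p norms *)

Lemma ge0_le_poweR (R : realType) (r : R) (x y : \bar R) : 0 <= r ->
  (0 <= x -> x <= y -> x `^ r <= y `^ r)%E.
Proof.
move=> r0 x0 xy; apply: gt0_ler_poweR => //; rewrite in_itv/= leey andbT//.
exact: le_trans xy.
Qed.

Lemma measurable_powR_comp d (T : measurableType d) (R : realType) (f : T -> R)
  (r : R) : measurable_fun [set: T] f -> measurable_fun [set: T] (fun x => f x `^ r).
Proof. move=> mf; apply: (@measurableT_comp _ _ _ _ _ _ (fun x : R => x `^ r)) => //. Qed.

(** Hoelder's inequality for the measure g dm: apply the usual one to f g^(1/q) and g^(1/q'), whose
    product is f g. It serves both Young's inequality and, with the counting measure, Schur's
    test. *)
Lemma ge0_hoelder_weight d (T : measurableType d) (R : realType)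
    (m : {measure set T -> \bar R}) (f g : T -> R) (q : R) : 1 <= q ->
  measurable_fun [set: T] f -> measurable_fun [set: T] g ->
  (forall x, 0 <= f x) -> (forall x, 0 <= g x) ->
  ((\int[m]_x (f x * g x)%:E) `^ q <=
   (\int[m]_x (f x `^ q * g x)%:E) * (\int[m]_x (g x)%:E) `^ (q - 1))%E.
Proof.
move=> q1 mf mg f0 g0.
have [->|qN1] := eqVneq q 1.
  rewrite subrr poweRe0 mule1 poweRe1; last first.
    by apply: integral_ge0 => x _; rewrite lee_fin mulr_ge0.
  by under [leRHS]eq_integral do rewrite powRr1//.
have {q1 qN1}q1 : 1 < q by rewrite lt_neqAle eq_sym qN1.
have q0 : 0 < q by rewrite (lt_trans _ q1).
have qm : 0 < q - 1 by rewrite subr_gt0.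
pose q' := q / (q - 1).
have q'0 : 0 < q' by rewrite divr_gt0.
have qq' : q^-1 + q'^-1 = 1.
  by rewrite /q' invf_div -{1}(mul1r q^-1) -mulrDl addrC subrK divff ?gt_eqF.
pose F x := f x * g x `^ q^-1; pose G x := g x `^ q'^-1.
have mG : measurable_fun setT G by apply: measurable_powR_comp.
have mF : measurable_fun setT F.
  by apply: measurable_funM => //; apply: measurable_powR_comp.
have FG x : F x * G x = f x * g x.
  rewrite /F /G -mulrA -powRD; last by rewrite qq' oner_eq0.
  by rewrite qq' powRr1.
have := hoelder m mF mG q0 q'0 qq'.
rewrite Lnorm1 => H.
have {}H : (\int[m]_x (f x * g x)%:E <= 'N[m]_q%:E[EFin \o F] * 'N[m]_q'%:E[EFin \o G])%E.
  apply: le_trans H; apply: eq_leW.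
  apply: eq_integral => x _; rewrite /= FG ger0_norm// mulr_ge0//.
apply: (le_trans (ge0_le_poweR (ltW q0) _ H)).
  by apply: integral_ge0 => x _; rewrite lee_fin mulr_ge0.
rewrite poweRM ?Lnorm_ge0// powR_Lnorm; last by rewrite gt_eqF.
apply: eq_leW; congr (_ * _)%E.
  apply: eq_integral => x _; rewrite /= ger0_norm; last by rewrite mulr_ge0// powR_ge0.
  by rewrite powRM// ?powR_ge0// -powRrM mulVf ?gt_eqF// powRr1.
rewrite unlock -poweRrM.
have -> : q'^-1 * q = q - 1 by rewrite /q' invf_div divfK// gt_eqF.
congr (_ `^ _)%E; apply: eq_integral => x _.
by rewrite /= ger0_norm ?powR_ge0// -powRrM mulVf ?gt_eqF// powRr1.
Qed.

Section Lp.
Context {R : realType} {n : nat}.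
Local Notation V := 'rV[R]_n.
Local Notation mu := (@lebesgue_rV R n).
Implicit Types (f g h : V -> R[i]) (x y z : V) (p : \bar R).

Lemma in_LpP p f : in_Lp p f <-> cmeasurable f /\ (Lp_norm p f < +oo)%E.
Proof. by split=> [[]|[[]]]. Qed.

Lemma in_Lp_meas p f : in_Lp p f -> cmeasurable f.
Proof. by case. Qed.

Lemma Lp_norm_ge0 p f : (0 <= Lp_norm p f)%E.
Proof. exact: Lnorm_ge0. Qed.

Lemma Lp_norm1 f : Lp_norm 1 f = (\int[mu]_x (normc (f x))%:E)%E.
Proof.
rewrite /Lp_norm Lnorm1; apply: eq_integral => x _.
by rewrite gee0_abs// lee_fin normc_ge0.
Qed.

Lemma in_L1P f : in_Lp 1 f <-> cintegrable mu f.
Proof.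
rewrite in_LpP Lp_norm1; split=> [[mf foo]|cf]; first exact: cintegrableP.
by split; [exact: cintegrable_meas cf|exact: cintegrable_normc].
Qed.

Lemma Lp_norm_powR (r : R) f : 0 < r ->
  (Lp_norm r%:E f `^ r = \int[mu]_x (normc (f x) `^ r)%:E)%E.
Proof.
move=> r0; rewrite /Lp_norm powR_Lnorm; last by rewrite gt_eqF.
apply: eq_integral => x _.
by rewrite gee0_abs// lee_fin normc_ge0.
Qed.

(** [Lnorm] at +oo is the essential supremum only when the whole space has positive measure. *)
Lemma lebesgue_rV_setT_gt0 : (0 < mu setT)%E.
Proof.
have -> : mu setT = (\prod_(i < n) lebesgue_measure [set: measurableTypeR R])%E.
  rewrite -(@lebesgue_rV_box R n (fun=> setT))//; congr (mu _).
  by rewrite eqEsubset; split.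
elim/big_ind : _ => // [x y|i _]; first exact: mule_gt0.
apply: (@lt_le_trans _ _ (lebesgue_measure `[(0:R), 1]%classic)).
  by rewrite lebesgue_measure_itv /= lte_fin ltr01 oppr0 adde0 lte01.
by apply: le_measure => //; rewrite inE.
Qed.

Lemma Lp_normy f : Lp_norm +oo f = ess_sup mu (fun x => (normc (f x))%:E).
Proof.
rewrite /Lp_norm unlock lebesgue_rV_setT_gt0; congr ess_sup.
by apply/funext => x /=; rewrite ger0_norm ?normc_ge0.
Qed.

Lemma le_Lp_norm p f g : (1 <= p)%E -> cmeasurable f -> cmeasurable g ->
  {ae mu, forall x, normc (f x) <= normc (g x)} -> (Lp_norm p f <= Lp_norm p g)%E.
Proof.
case: p => [r||] // r1 mf mg fg; last first.
  by rewrite !Lp_normy; apply: le_ess_sup; apply: filterS fg => x; rewrite lee_fin.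
rewrite lee_fin in r1; have r0 : 0 < r by rewrite (lt_le_trans _ r1).
have -> : Lp_norm r%:E f = ((Lp_norm r%:E f `^ r) `^ r^-1)%E.
  by rewrite -poweRrM divff ?gt_eqF// poweRe1// Lp_norm_ge0.
have -> : Lp_norm r%:E g = ((Lp_norm r%:E g `^ r) `^ r^-1)%E.
  by rewrite -poweRrM divff ?gt_eqF// poweRe1// Lp_norm_ge0.
apply: ge0_le_poweR; rewrite ?invr_ge0 ?(ltW r0) ?poweR_ge0//.
rewrite !Lp_norm_powR//; apply: ae_ge0_le_integral => //.
- by move=> x _; rewrite lee_fin powR_ge0.
- by apply/measurable_EFinP; apply: measurable_powR_comp; exact: measurable_normc.
- by move=> x _; rewrite lee_fin powR_ge0.
- by apply/measurable_EFinP; apply: measurable_powR_comp; exact: measurable_normc.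
apply: filterS fg => x h _; rewrite lee_fin ge0_ler_powR// ?nnegrE ?normc_ge0//.
exact: ltW.
Qed.

Lemma eq_Lp_norm p f g : (1 <= p)%E -> cmeasurable f -> cmeasurable g ->
  {ae mu, forall x, f x = g x} -> Lp_norm p f = Lp_norm p g.
Proof.
move=> p1 mf mg fg; apply/eqP; rewrite eq_le; apply/andP; split;
apply: le_Lp_norm => //; by apply: filterS fg => x ->.
Qed.

Lemma Lp_norm_triangle p f g : (1 <= p)%E -> cmeasurable f -> cmeasurable g ->
  (Lp_norm p (fun x => (f x + g x)%R) <= Lp_norm p f + Lp_norm p g)%E.
Proof.
case: p => [r||] // r1 mf mg; last first.
  rewrite !Lp_normy; apply: le_trans (ess_supD _ _ _); apply: le_ess_sup.
  by apply: aeW => x /=; rewrite -EFinD lee_fin le_normcD.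
have := minkowski_EFin mu (measurable_normc mf) (measurable_normc mg) (r1 : (1 <= r)%R).
apply: le_trans.
pose h x : R[i] := ((normc (f x) + normc (g x))%:C)%C.
have hE x : normc (h x) = normc (f x) + normc (g x).
  by rewrite -(mulr1 (h x)) normc_realM Normc.normc1 mulr1 ger0_norm// addr_ge0 ?normc_ge0.
have mh : cmeasurable h.
  by split; [apply: measurable_funD; exact: measurable_normc|exact: measurable_cst].
apply: le_trans (le_Lp_norm (g := h) r1 _ mh _) _; first exact: cmeasurableD.
  by apply: aeW => x; rewrite hE le_normcD.
apply: eq_leW; congr Lnorm.
by apply/funext => x; congr EFin; exact: hE.
Qed.

Lemma Lp_norm_triangleB p f g : (1 <= p)%E -> cmeasurable f -> cmeasurable g ->
  (Lp_norm p (fun x => (f x - g x)%R) <= Lp_norm p f + Lp_norm p g)%E.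
Proof.
move=> p1 mf mg; apply: (le_trans (Lp_norm_triangle p1 mf (cmeasurableN mg))).
rewrite leeD2l// le_Lp_norm//; first exact: cmeasurableN.
by apply: aeW => x; rewrite normcN.
Qed.

Lemma in_LpB p f g : (1 <= p)%E -> in_Lp p f -> in_Lp p g ->
  in_Lp p (fun x => f x - g x).
Proof.
rewrite !in_LpP => p1 [mf foo] [mg goo]; split; first exact: cmeasurableB.
by apply: le_lt_trans (Lp_norm_triangleB p1 mf mg) _; exact: lte_add_pinfty.
Qed.

(** The preimage of a null set is null by the change of variables applied to its indicator. *)
Lemma ae_affine (a : R) (b : V) (P : V -> Prop) : a != 0 ->
  {ae mu, forall x, P x} -> {ae mu, forall x, P (a *: x + b)}.
Proof.
move=> a0 [N [mN N0 PN]].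
have mpre : measurable ((fun x => a *: x + b) @^-1` N).
  by rewrite -[X in measurable X]setTI; apply: (measurable_affine a b measurableT).
exists ((fun x => a *: x + b) @^-1` N); split => //; last first.
  by move=> x Px; apply: PN.
have an : (0 < `|a| ^+ n)%R by rewrite exprn_gt0// normr_gt0.
have : (\int[mu]_x (\1_N x)%:E = 0)%E by rewrite integral_indic// setIT.
rewrite (ge0_integral_affine b a0)//; last first.
  by apply/measurable_EFinP; exact: measurable_indic.
move=> /eqP; rewrite mule_eq0 eqe gt_eqF//= => /eqP.
rewrite -[X in X = _ -> _](_ : (\int[mu]_x (\1_((fun x => a *: x + b) @^-1` N) x)%:E)%E = _)//.
by rewrite integral_indic// setIT.
Qed.

End Lp.

Lemma ge0_poweR_le (R : realType) (r : R) (x y : \bar R) : 0 < r ->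
  (0 <= x -> 0 <= y -> x `^ r <= y `^ r -> x <= y)%E.
Proof.
move=> r0 x0 y0 /(ge0_le_poweR (_ : 0 <= r^-1)).
by rewrite invr_ge0 ltW// -!poweRrM divff ?gt_eqF// !poweRe1// poweR_ge0; exact.
Qed.

(** * Convolution and dilation *)

Section conv.
Context {R : realType} {n : nat}.
Local Notation V := 'rV[R]_n.
Local Notation mu := (@lebesgue_rV R n).
Implicit Types (f g h : V -> R[i]) (x y z : V) (p : \bar R).

Lemma measurable_subV : measurable_fun [set: V * V] (fun z : V * V => z.1 - z.2).
Proof. by apply: measurable_rVB. Qed.

Lemma measurable_crV (x : V) : measurable_fun [set: V] (fun y => x - y).
Proof. by apply: measurable_rVB. Qed.

Lemma measurable_rVc (y : V) : measurable_fun [set: V] (fun x => x - y).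
Proof. by apply: measurable_rVB. Qed.

Lemma ge0_integral_shift (u : V -> \bar R) (x : V) :
  measurable_fun [set: V] u -> (forall y, 0 <= u y)%E ->
  (\int[mu]_y u (y - x)%R = \int[mu]_y u y)%E.
Proof.
move=> mu0 u0; rewrite [RHS](ge0_integral_affine (- x) (a := 1))//.
rewrite normr1 expr1n mul1e; apply: eq_integral => y _.
by rewrite scale1r.
Qed.

Lemma cint_affine (a : R) (b : V) (F : V -> R[i]) : a != 0 -> cmeasurable F ->
  cint mu F = ((`|a| ^+ n)%:C)%C * cint mu (fun y => F (a *: y + b)).
Proof.
move=> a0 [Fr Fi]; apply: complex_ext; rewrite ?ReM ?ImM /=.
  by rewrite mul0r subr0; exact: (Rintegral_affine b a0 Fr).
by rewrite mul0r addr0; exact: (Rintegral_affine b a0 Fi).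
Qed.

Lemma cint_sub (F : V -> R[i]) (x : V) : cmeasurable F ->
  cint mu (fun y => F (x - y)) = cint mu F.
Proof.
move=> mF; rewrite [RHS](cint_affine x (a := -1))//.
rewrite normrN1 expr1n mul1r; congr (cint mu _); apply/funext => y.
by rewrite scaleN1r addrC.
Qed.

Lemma cint_shift (F : V -> R[i]) (x : V) : cmeasurable F ->
  cint mu (fun y => F (y - x)) = cint mu F.
Proof.
move=> mF; rewrite [RHS](cint_affine (- x) (a := 1))//.
rewrite normr1 expr1n mul1r; congr (cint mu _); apply/funext => y.
by rewrite scale1r.
Qed.

Lemma cmeasurable_crV f x : cmeasurable f -> cmeasurable (fun y => f (x - y)).
Proof. by move=> mf; apply: cmeasurable_comp => //; exact: measurable_crV. Qed.

Lemma cmeasurable_rVc f y : cmeasurable f -> cmeasurable (fun x => f (x - y)).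
Proof. by move=> mf; apply: cmeasurable_comp => //; exact: measurable_rVc. Qed.

Lemma cmeasurable_ker f g : cmeasurable f -> cmeasurable g ->
  cmeasurable (fun z : V * V => f (z.1 - z.2) * g z.2).
Proof.
move=> mf mg; apply: cmeasurableM; apply: cmeasurable_comp => //.
exact: measurable_subV.
Qed.

Lemma cmeasurable_convolution f g : cmeasurable f -> cmeasurable g ->
  cmeasurable (convolution f g).
Proof. by move=> mf mg; exact: (cmeasurable_cint mu (cmeasurable_ker mf mg)). Qed.

(** Equality holds at every point: the substitution y -> x - y preserves the integral, default value
    included. *)
Lemma convolutionC f g : cmeasurable f -> cmeasurable g ->
  convolution f g = convolution g f.
Proof.
move=> mf mg; apply/funext => x; rewrite /convolution -[LHS]/(cint mu _).
rewrite -(cint_sub x); last first.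
  by apply: cmeasurableM => //; exact: cmeasurable_crV.
congr (cint mu _); apply/funext => y.
by rewrite opprB addrCA subrr addr0 mulrC.
Qed.

Lemma ae_eq_convolutionr f g h : cmeasurable f -> cmeasurable g -> cmeasurable h ->
  {ae mu, forall x, g x = h x} -> convolution f g = convolution f h.
Proof.
move=> mf mg mh gh; apply/funext => x; apply: ae_eq_cint.
- by apply: cmeasurableM => //; exact: cmeasurable_crV.
- by apply: cmeasurableM => //; exact: cmeasurable_crV.
by apply: filterS gh => y ->.
Qed.

Lemma ae_eq_convolutionl f g h : cmeasurable f -> cmeasurable g -> cmeasurable h ->
  {ae mu, forall x, f x = h x} -> convolution f g = convolution h g.
Proof.
by move=> mf mg mh fh; rewrite convolutionC// (ae_eq_convolutionr mg mf mh fh) convolutionC.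
Qed.

(** The convolution of |f| and |g| with values in [0, +oo]. Where it is finite, [convolution f g x]
    is a genuine integral. *)
Definition absconv f g x : \bar R :=
  (\int[mu]_y (normc (f (x - y)) * normc (g y))%:E)%E.

Lemma absconv_ge0 f g x : (0 <= absconv f g x)%E.
Proof. by apply: integral_ge0 => y _; rewrite lee_fin mulr_ge0// normc_ge0. Qed.

Lemma measurable_absker f g : cmeasurable f -> cmeasurable g ->
  measurable_fun [set: V * V] (fun z : V * V => (normc (f (z.1 - z.2)) * normc (g z.2))%:E).
Proof.
move=> mf mg; under eq_fun do rewrite -Normc.normcM.
by apply: (measurable_cnorm (cmeasurable_ker mf mg)).
Qed.

Lemma measurable_absconv f g : cmeasurable f -> cmeasurable g ->
  measurable_fun [set: V] (absconv f g).
Proof.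
move=> mf mg; apply: (measurable_fun_fubini_tonelli_F
  (fun z : V * V => (normc (f (z.1 - z.2)) * normc (g z.2))%:E)).
  exact: measurable_absker.
by move=> z; rewrite lee_fin mulr_ge0// normc_ge0.
Qed.

Lemma le_absconv f g x : cmeasurable f -> cmeasurable g ->
  ((normc (convolution f g x))%:E <= absconv f g x)%E.
Proof.
move=> mf mg; apply: le_trans (le_cint mu _) _.
  by apply: cmeasurableM => //; exact: cmeasurable_crV.
by rewrite /absconv; under eq_integral do rewrite Normc.normcM.
Qed.

Lemma absconv_cintegrable f g x : cmeasurable f -> cmeasurable g ->
  (absconv f g x < +oo)%E -> cintegrable mu (fun y => f (x - y) * g y).
Proof.
move=> mf mg foo; apply: cintegrableP.
  by apply: cmeasurableM => //; exact: cmeasurable_crV.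
by under eq_integral do rewrite Normc.normcM.
Qed.

Lemma ge0_integral_conv (u v : V -> R) :
  measurable_fun [set: V] u -> measurable_fun [set: V] v ->
  (forall x, 0 <= u x) -> (forall x, 0 <= v x) ->
  (\int[mu]_x \int[mu]_y (u (x - y)%R * v y)%:E =
   (\int[mu]_x (u x)%:E) * (\int[mu]_x (v x)%:E))%E.
Proof.
move=> mu0 mv u0 v0.
rewrite (fubini_tonelli (fun z : V * V => (u (z.1 - z.2)%R * v z.2)%:E)%E)/=; last 2 first.
- apply/measurable_EFinP; apply: measurable_funM.
    exact: (measurableT_comp mu0 measurable_subV).
  exact: (measurableT_comp mv measurable_snd).
- by move=> z; rewrite lee_fin mulr_ge0.
transitivity (\int[mu]_y ((\int[mu]_x (u x)%:E) * (v y)%:E))%E.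
  apply: eq_integral => y _; under eq_integral do rewrite EFinM.
  rewrite ge0_integralZr//; last 2 first.
  - by move=> x _; rewrite lee_fin.
  - by rewrite lee_fin.
  - by rewrite (ge0_integral_shift (u := fun x => (u x)%:E) y)//; exact/measurable_EFinP.
  by apply/measurable_EFinP; exact: (measurableT_comp mu0 (measurable_rVc y)).
rewrite ge0_integralZl//.
- exact/measurable_EFinP.
- by move=> x _; rewrite lee_fin.
- by apply: integral_ge0 => x _; rewrite lee_fin.
Qed.

(* Hoelder's inequality for the measure |g(y)|dy reduces Young's inequality to
   Tonelli's theorem. *)
Lemma absconv_Lr (r : R) f g : 1 <= r -> cmeasurable f -> cmeasurable g ->
  (\int[mu]_x (absconv f g x `^ r) <= (Lp_norm r%:E f * Lp_norm 1 g) `^ r)%E.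
Proof.
move=> r1 mf mg; have r0 : 0 < r by rewrite (lt_le_trans _ r1).
have mfr : measurable_fun setT (fun x => normc (f x) `^ r).
  by apply: measurable_powR_comp; exact: measurable_normc.
have mgn := measurable_normc mg.
set G := Lp_norm 1 g.
have G0 : (0 <= G)%E by exact: Lp_norm_ge0.
apply: (@le_trans _ _ (\int[mu]_x (
   (\int[mu]_y (normc (f (x - y)%R) `^ r * normc (g y))%:E) * G `^ (r - 1)))%E).
  apply: ge0_le_integral => //.
  - by move=> x _; exact: poweR_ge0.
  - apply: (measurableT_comp (measurable_poweR _)).
    exact: measurable_absconv.
  - apply: emeasurable_funM => //.
    apply: (measurable_fun_fubini_tonelli_F
      (fun z : V * V => (normc (f (z.1 - z.2)) `^ r * normc (g z.2))%:E)).
      apply/measurable_EFinP; apply: measurable_funM.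
        exact: (measurableT_comp mfr measurable_subV).
      exact: (measurableT_comp mgn measurable_snd).
    by move=> z; rewrite lee_fin mulr_ge0// ?powR_ge0// normc_ge0.
  - move=> x _; rewrite /G Lp_norm1; apply: ge0_hoelder_weight => //.
    + by apply: measurable_normc; exact: cmeasurable_crV.
    + by move=> y; exact: normc_ge0.
    + by move=> y; exact: normc_ge0.
rewrite ge0_integralZr//; last 3 first.
- apply: (measurable_fun_fubini_tonelli_F
      (fun z : V * V => (normc (f (z.1 - z.2)) `^ r * normc (g z.2))%:E)).
    apply/measurable_EFinP; apply: measurable_funM.
      exact: (measurableT_comp mfr measurable_subV).
    exact: (measurableT_comp mgn measurable_snd).
  by move=> z; rewrite lee_fin mulr_ge0// ?powR_ge0// normc_ge0.
- by move=> x _; apply: integral_ge0 => y _; rewrite lee_fin mulr_ge0// ?powR_ge0// normc_ge0.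
- exact: poweR_ge0.
rewrite (ge0_integral_conv mfr mgn); last 2 first.
- by move=> x; exact: powR_ge0.
- by move=> x; exact: normc_ge0.
rewrite -Lp_norm_powR// -Lp_norm1 -/G poweRM ?Lp_norm_ge0// -muleA.
apply: eq_leW; congr (_ * _)%E.
have [->|GN0] := eqVneq G 0%E; first by rewrite mul0e poweR0r ?gt_eqF.
rewrite -{1}(poweRe1 G0) -poweRD; last first.
  by apply: nneg_neq0_poweRD_def => //; rewrite subr_ge0.
by rewrite addrC subrK.
Qed.

Lemma absconv_Ly f g : cmeasurable f -> cmeasurable g ->
  {ae mu, forall x, absconv f g x <= Lp_norm +oo f * Lp_norm 1 g}%E.
Proof.
move=> mf mg; apply: aeW => x; rewrite Lp_norm1 -ge0_integralZl//; last 3 first.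
- exact: measurable_cnorm.
- by move=> y _; rewrite lee_fin normc_ge0.
- exact: Lp_norm_ge0.
apply: ae_ge0_le_integral => //.
- by move=> y _; rewrite lee_fin mulr_ge0// normc_ge0.
- apply/measurable_EFinP; apply: measurable_funM; apply: measurable_normc => //.
  exact: cmeasurable_crV.
- by move=> y _; rewrite mule_ge0// ?Lp_norm_ge0// lee_fin normc_ge0.
- by apply: emeasurable_funM => //; exact: measurable_cnorm.
have := ess_sup_ge mu (fun x => (normc (f x))%:E); rewrite -Lp_normy => H.
have := ae_affine x (_ : (-1 : R) != 0) H; rewrite oppr_eq0 oner_eq0 => /(_ isT).
apply: filterS => y; rewrite scaleN1r addrC => fy _.
by rewrite EFinM lee_wpmul2r// lee_fin normc_ge0.
Qed.

(** Young's inequality, deduced from its version for [absconv]. Since the norms may be infinite,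
    only measurability is assumed. *)
Lemma Lp_norm_convolution p f g : (1 <= p)%E -> cmeasurable f -> cmeasurable g ->
  (Lp_norm p (convolution f g) <= Lp_norm p f * Lp_norm 1 g)%E.
Proof.
case: p => [r||]// r1 mf mg; last first.
  rewrite [leLHS]Lp_normy; apply/ess_supP; apply: filterS (absconv_Ly mf mg) => x.
  by apply: le_trans; exact: le_absconv.
rewrite lee_fin in r1; have r0 : 0 < r by rewrite (lt_le_trans _ r1).
have P0 : (0 <= Lp_norm r%:E f * Lp_norm 1 g)%E by rewrite mule_ge0// Lp_norm_ge0.
apply: (ge0_poweR_le r0) => //; first exact: Lp_norm_ge0.
apply: le_trans (absconv_Lr r1 mf mg); rewrite Lp_norm_powR//.
apply: ge0_le_integral => //.
- by move=> x _; rewrite lee_fin powR_ge0.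
- apply/measurable_EFinP; apply: measurable_powR_comp; apply: measurable_normc.
  exact: cmeasurable_convolution.
- apply: (measurableT_comp (measurable_poweR _)).
  exact: measurable_absconv.
move=> x _; rewrite -poweR_EFin; apply: ge0_le_poweR; first exact: ltW.
  by rewrite lee_fin normc_ge0.
exact: le_absconv.
Qed.

Lemma in_Lp_convolution p f g : (1 <= p)%E -> in_Lp p f -> in_Lp 1 g ->
  in_Lp p (convolution f g).
Proof.
rewrite !in_LpP => p1 [mf foo] [mg goo]; split; first exact: cmeasurable_convolution.
apply: le_lt_trans (Lp_norm_convolution p1 mf mg) _.
by apply: lte_mul_pinfty => //; [exact: Lp_norm_ge0|rewrite ge0_fin_numE// Lp_norm_ge0].
Qed.

Lemma ae_absconv_lty p f g : (1 <= p)%E -> in_Lp p f -> in_Lp 1 g ->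
  {ae mu, forall x, absconv f g x < +oo}%E.
Proof.
rewrite !in_LpP => p1 [mf foo] [mg goo].
have oo : (Lp_norm p f * Lp_norm 1 g < +oo)%E.
  by apply: lte_mul_pinfty => //; [exact: Lp_norm_ge0|rewrite ge0_fin_numE// Lp_norm_ge0].
case: p p1 foo oo => [r||]// r1 foo oo; last first.
  by apply: filterS (absconv_Ly mf mg) => x h; exact: le_lt_trans oo.
rewrite lee_fin in r1; have r0 : 0 < r by rewrite (lt_le_trans _ r1).
have : mu.-integrable setT (fun x => absconv f g x `^ r)%E.
  apply/integrableP; split.
    apply: (measurableT_comp (measurable_poweR _)).
    exact: measurable_absconv.
  under eq_integral do rewrite gee0_abs ?poweR_ge0//.
  apply: le_lt_trans (absconv_Lr r1 mf mg) _; exact: poweR_lty.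
move=> /(integrable_ae measurableT); apply: filterS => x /(_ I).
rewrite ge0_fin_numE ?poweR_ge0//; apply: lty_poweRy.
by rewrite gt_eqF.
Qed.

Lemma ae_convolution_cintegrable p f g : (1 <= p)%E -> in_Lp p f -> in_Lp 1 g ->
  {ae mu, forall x, cintegrable mu (fun y => f (x - y) * g y)}.
Proof.
move=> p1 fp g1; apply: filterS (ae_absconv_lty p1 fp g1) => x.
by apply: absconv_cintegrable; [exact: in_Lp_meas fp|exact: in_Lp_meas g1].
Qed.

Lemma convolutionBl p f h g : (1 <= p)%E -> in_Lp p f -> in_Lp p h -> in_Lp 1 g ->
  {ae mu, forall x, convolution (fun y => f y - h y) g x =
    convolution f g x - convolution h g x}.
Proof.
move=> p1 fp hp g1; have := ae_convolution_cintegrable p1 hp g1.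
apply: filterS2 (ae_convolution_cintegrable p1 fp g1) => x fi hi.
rewrite /convolution -[RHS](cintB fi hi) -[LHS]/(cint mu _).
by congr (cint mu _); apply/funext => y; rewrite mulrBl.
Qed.

Lemma convolutionBr p f g h : (1 <= p)%E -> in_Lp p f -> in_Lp 1 g -> in_Lp 1 h ->
  {ae mu, forall x, convolution f (fun y => g y - h y) x =
    convolution f g x - convolution f h x}.
Proof.
move=> p1 fp g1 h1; have := ae_convolution_cintegrable p1 fp h1.
apply: filterS2 (ae_convolution_cintegrable p1 fp g1) => x fi hi.
rewrite /convolution -[RHS](cintB fi hi) -[LHS]/(cint mu _).
by congr (cint mu _); apply/funext => y; rewrite mulrBr.
Qed.

Lemma cintZ_nz c (F : V -> R[i]) : (c != 0 -> cintegrable mu F) ->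
  cint mu (fun y => c * F y) = c * cint mu F.
Proof.
have [->|c0 /(_ isT)] := eqVneq c 0; last exact: cintZ.
rewrite mul0r; under eq_fun do rewrite mul0r.
by move=> _; apply: complex_ext; rewrite /= /Rintegral integral0.
Qed.

(** Fubini for (w, y) |-> f (x - w) g (w - y) h y, at the points x where |f| * (|g| * |h|) is
    finite; by Young's inequality this is almost every x. *)
Lemma convolutionA p f g h : (1 <= p)%E -> in_Lp p f -> in_Lp 1 g -> in_Lp 1 h ->
  {ae mu, forall x, convolution (convolution f g) h x =
    convolution f (convolution g h) x}.
Proof.
move=> p1 fp g1 h1.
have mf := in_Lp_meas fp; have mg := in_Lp_meas g1; have mh := in_Lp_meas h1.
have aG := ae_absconv_lty (lexx 1%E) g1 h1.
(* [G] is |g| * |h| made finite everywhere: a function in L^1, to which [ae_absconv_lty] can be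
   applied together with f. *)
pose G x : R[i] := ((fine (absconv g h x))%:C)%C.
have mG : cmeasurable G.
  split; last exact: measurable_cst.
  by apply: (measurableT_comp (f := fine)) => //; exact: measurable_absconv.
have nG x : normc (G x) = fine (absconv g h x).
  by rewrite -(mulr1 (G x)) normc_realM Normc.normc1 mulr1 ger0_norm// fine_ge0// absconv_ge0.
have G1 : in_Lp 1 G.
  apply/in_LpP; split => //; rewrite Lp_norm1; under eq_integral do rewrite nG.
  have [_ goo] := (in_LpP _ _).1 g1; have [_ hoo] := (in_LpP _ _).1 h1.
  have : (\int[mu]_x (absconv g h x `^ 1) < +oo)%E.
    apply: le_lt_trans (absconv_Lr (lexx 1) mg mh) _; apply: poweR_lty.
    by apply: lte_mul_pinfty => //; [exact: Lp_norm_ge0|rewrite ge0_fin_numE// Lp_norm_ge0].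
  apply: le_lt_trans; apply: ge0_le_integral => //.
  - by move=> x _; rewrite lee_fin fine_ge0// absconv_ge0.
  - by apply/measurable_EFinP; apply: (measurableT_comp (f := fine)) => //; exact: measurable_absconv.
  - by apply: (measurableT_comp (measurable_poweR _)); exact: measurable_absconv.
  move=> x _; rewrite poweRe1 ?absconv_ge0//.
  by have := absconv_ge0 g h x; case: (absconv g h x) => //= *; rewrite ?leey.
have mF x : cmeasurable (fun z : V * V => f (x - z.1) * (g (z.1 - z.2) * h z.2)).
  apply: cmeasurableM; last exact: cmeasurable_ker.
  apply: (cmeasurable_comp (f := fun y => f (x - y)) (h := fst)) => //.
  exact: cmeasurable_crV.
apply: filterS (ae_absconv_lty p1 fp G1) => x Nx.
have key : (\int[mu]_w \int[mu]_y (normc (f (x - w) * (g (w - y) * h y)))%:E < +oo)%E.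
  apply: le_lt_trans Nx; apply: eq_leW.
  apply: ae_eq_integral => //.
  - apply: (measurable_fun_fubini_tonelli_F (fun z : V * V =>
     (normc (f (x - z.1) * (g (z.1 - z.2) * h z.2)))%:E)).
      exact: measurable_cnorm.
    by move=> z; rewrite lee_fin normc_ge0.
  - apply/measurable_EFinP; apply: measurable_funM; apply: measurable_normc => //.
    exact: cmeasurable_crV.
  apply: filterS aG => w goo _; rewrite EFinM nG fineK ?ge0_fin_numE ?absconv_ge0//.
  rewrite -ge0_integralZl//.
  - by apply: eq_integral => y _; rewrite !Normc.normcM.
  - by apply/measurable_EFinP; apply: measurable_funM; apply: measurable_normc => //;
      exact: cmeasurable_crV.
  - by move=> y _; rewrite lee_fin mulr_ge0// normc_ge0.
  - by rewrite lee_fin normc_ge0.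
have ci : cintegrable (mu \x mu)%E (fun z : V * V => f (x - z.1) * (g (z.1 - z.2) * h z.2)).
  apply: cintegrableP => //.
  rewrite (fubini_tonelli1 (fun z : V * V => (normc (f (x - z.1) * (g (z.1 - z.2) * h z.2)))%:E)) //.
    exact: measurable_cnorm.
  by move=> z; rewrite lee_fin normc_ge0.
transitivity (cint mu (fun w => cint mu (fun y => f (x - w) * (g (w - y) * h y)))); last first.
  apply: ae_eq_cint.
  - exact: (cmeasurable_cint mu (mF x)).
  - by apply: cmeasurableM; [exact: cmeasurable_crV|exact: cmeasurable_convolution].
  apply: filterS aG => w goo; apply: cintZ_nz => _; exact: absconv_cintegrable.
have [cr cim] := ci.
rewrite (cint_fubini (mF x) key); apply: ae_eq_cint.
- by apply: cmeasurableM => //; apply: cmeasurable_crV; exact: cmeasurable_convolution.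
- have mFs : cmeasurable (fun z : V * V => f (x - z.2) * (g (z.2 - z.1) * h z.1)).
    by apply: (cmeasurable_comp (f := fun z : V * V => f (x - z.1) * (g (z.1 - z.2) * h z.2))
      (h := fun z : V * V => (z.2, z.1))) => //; exact: measurable_fun_pair.
  exact: (cmeasurable_cint mu mFs).
apply: filterS2 (ae_integrable2 cr) (ae_integrable2 cim) => y yr yi.
have ciy : cintegrable mu (fun w => f (x - w) * (g (w - y) * h y)) by split.
have mw : cmeasurable (fun w : V => f (x - w) * g (w - y)).
  by apply: cmeasurableM; [exact: cmeasurable_crV|exact: cmeasurable_rVc].
transitivity (cint mu (fun w : V => h y * (f (x - w) * g (w - y)))); last first.
  by congr (cint mu _); apply/funext => w; ring.
(* When [h y] is nonzero, dividing the integrable section by it gives the integrability needed to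
   pull [h y] out; when it vanishes, both sides are 0. *)
rewrite cintZ_nz; last first.
  move=> hy0.
  have := cintegrableZ (h y)^-1 ciy.
  congr cintegrable; apply/funext => w.
  by field.
rewrite mulrC; congr (_ * _).
rewrite -[RHS](cint_shift (- y))//; congr (cint mu _); apply/funext => w.
by rewrite opprK addrK (addrC w) opprD addrA.
Qed.

End conv.

(** A positive factor maps infinite integrals to infinite ones, so the default value 0 appears on
    both sides at once. This is what makes [convolution_dilate] an equality of functions. *)
Lemma gt0_RintegralZl d (T : measurableType d) (R : realType)
    (m : {measure set T -> \bar R}) (k : R) (u : T -> R) : 0 < k ->
  measurable_fun [set: T] u ->
  (\int[m]_x (k * u x) = k * \int[m]_x u x)%R.
Proof.
move=> k0 mU; have k0' := ltW k0.
rewrite /Rintegral.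
have -> : (\int[m]_x (k * u x)%:E = k%:E * \int[m]_x (u x)%:E)%E.
  rewrite integralE [X in (_ * X)%E]integralE gt0_muleBr//.
  have mU' : measurable_fun setT (EFin \o u) by exact/measurable_EFinP.
  congr (_ - _)%E.
    rewrite -ge0_integralZl//; last exact: measurable_funepos.
    by rewrite -(ge0_funeposM _ k0').
  rewrite -ge0_integralZl//; last exact: measurable_funeneg.
  by rewrite -(ge0_funenegM _ k0').
case: (integral _ _ _) => [r||]; first by [].
  by rewrite gt0_muley ?lte_fin// mulr0.
by rewrite gt0_muleNy ?lte_fin// mulr0.
Qed.

Lemma gt0_cintZ d (T : measurableType d) (R : realType)
    (m : {measure set T -> \bar R}) (k : R) (F : T -> R[i]) : 0 < k ->
  cmeasurable F -> cint m (fun x => (k%:C)%C * F x) = (k%:C)%C * cint m F.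
Proof.
move=> k0 [mr mi]; apply: complex_ext; rewrite ?ReM ?ImM /= ?mul0r ?subr0 ?addr0.
  rewrite -gt0_RintegralZl//; apply: eq_Rintegral => x _.
  by case: (F x) => u v /=; rewrite mul0r subr0.
rewrite -gt0_RintegralZl//; apply: eq_Rintegral => x _.
by case: (F x) => u v /=; rewrite mul0r addr0.
Qed.

Section dilate.
Context {R : realType} {n : nat}.
Local Notation V := 'rV[R]_n.
Local Notation mu := (@lebesgue_rV R n).
Implicit Types (f g h : V -> R[i]) (x y z : V) (p : \bar R) (e : R).

Lemma cmeasurable_dilate e g : cmeasurable g -> cmeasurable (dilate e g).
Proof.
move=> mg; apply: cmeasurableM; first exact: cmeasurable_cst.
apply: (cmeasurable_comp (h := fun x => e^-1 *: x)) => //.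
exact: measurable_rVZ.
Qed.

Lemma normc_dilate e g x : 0 < e -> normc (dilate e g x) = e ^- n * normc (g (e^-1 *: x)).
Proof. by move=> e0; rewrite normc_realM ger0_norm// invr_ge0 exprn_ge0// ltW. Qed.

Lemma dilateE e g x : e != 0 -> dilate e g (e *: x) = ((e ^- n)%:C)%C * g x.
Proof. by move=> e0; rewrite /dilate scalerA mulVf// scale1r. Qed.

Lemma ge0_integral_scale e (u : V -> \bar R) : 0 < e -> measurable_fun [set: V] u ->
  (forall x, 0 <= u x)%E ->
  (\int[mu]_x u x = (e ^+ n)%:E * \int[mu]_x u (e *: x)%R)%E.
Proof.
move=> e0 mU u0; rewrite (ge0_integral_affine 0 (a := e))// ?gt_eqF// gtr0_norm//.
by congr (_ * _)%E; apply: eq_integral => x _; rewrite addr0.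
Qed.

Lemma Lp_norm1_dilate e g : 0 < e -> cmeasurable g -> Lp_norm 1 (dilate e g) = Lp_norm 1 g.
Proof.
move=> e0 mg; rewrite !Lp_norm1 (ge0_integral_scale e0); last 2 first.
- exact/measurable_cnorm/cmeasurable_dilate.
- by move=> x; rewrite lee_fin normc_ge0.
have en0 : e ^+ n != 0 by rewrite expf_neq0// gt_eqF.
under eq_integral => x _.
  rewrite normc_dilate// scalerA mulVf ?gt_eqF// scale1r EFinM; over.
rewrite ge0_integralZl//; first by rewrite muleA -EFinM divff// mul1e.
- exact: measurable_cnorm.
- by move=> x _; rewrite lee_fin normc_ge0.
- by rewrite lee_fin invr_ge0 exprn_ge0// ltW.
Qed.

Lemma in_L1_dilate e g : 0 < e -> in_Lp 1 g -> in_Lp 1 (dilate e g).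
Proof.
by rewrite !in_LpP => e0 [mg goo]; rewrite Lp_norm1_dilate//; split => //; exact: cmeasurable_dilate.
Qed.

Lemma cint_dilate e g : 0 < e -> in_Lp 1 g -> cint mu (dilate e g) = cint mu g.
Proof.
move=> e0 g1; have mg := in_Lp_meas g1.
rewrite (cint_affine 0 (a := e)) ?gt_eqF//; last exact: cmeasurable_dilate.
under eq_fun do rewrite addr0 dilateE ?gt_eqF//.
rewrite cintZ; last exact/in_L1P.
rewrite mulrA gtr0_norm// -rmorphM divff ?rmorph1 ?mul1r//.
by rewrite expf_neq0// gt_eqF.
Qed.

Lemma dilate_dilate a b g : dilate a (dilate b g) = dilate (a * b) g.
Proof.
apply/funext => x; rewrite /dilate mulrA -rmorphM scalerA; congr ((_%:C)%C * g (_ *: _)).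
  by rewrite exprMn invfM.
by rewrite invfM mulrC.
Qed.

Lemma dilate1 g : dilate 1 g = g.
Proof. by apply/funext => x; rewrite /dilate expr1n invr1 mul1r scale1r. Qed.

Lemma dilateB e f g : dilate e (fun x => f x - g x) = (fun x => dilate e f x - dilate e g x).
Proof. by apply/funext => x; rewrite /dilate mulrBr. Qed.

Lemma ae_dilate e f g : 0 < e -> {ae mu, forall x, f x = g x} ->
  {ae mu, forall x, dilate e f x = dilate e g x}.
Proof.
move=> e0 /(@ae_affine _ _ e^-1 0 (fun x => f x = g x)); rewrite invr_eq0 gt_eqF// => /(_ isT).
by apply: filterS => x; rewrite addr0 /dilate => ->.
Qed.

Lemma convolution_dilate e f g : 0 < e -> cmeasurable f -> cmeasurable g ->
  convolution (dilate e f) (dilate e g) = dilate e (convolution f g).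
Proof.
move=> e0 mf mg; have eN0 : e != 0 by rewrite gt_eqF.
have en0 : e ^+ n != 0 by rewrite expf_neq0.
apply/funext => x; rewrite /convolution -[LHS]/(cint mu _) /dilate -[cintegral _]/(cint mu _).
rewrite (cint_affine 0 eN0); last first.
  apply: cmeasurableM; last exact: cmeasurable_dilate.
  exact: (cmeasurable_crV x (cmeasurable_dilate e mf)).
set F := (X in cint mu X).
set G := (X in _ = _ * cint mu X).
have -> : F = fun y => ((e ^- n * e ^- n)%:C)%C * G y.
  apply/funext => y; rewrite /F /G addr0 scalerBr !scalerA mulVf// scale1r rmorphM/=.
  by ring.
rewrite gt0_cintZ; last 2 first.
- by rewrite mulr_gt0// invr_gt0 exprn_gt0.
- by apply: cmeasurableM => //; exact: cmeasurable_crV.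
rewrite gtr0_norm// mulrA -rmorphM; congr ((_%:C)%C * _).
by rewrite mulrA divff// mul1r.
Qed.

End dilate.

Lemma ecvg0P {R : realType} (u : nat -> \bar R) : (forall k, 0 <= u k)%E ->
  (u @ \oo --> 0%E) <->
  (forall e : R, 0 < e -> exists K, forall k, (K <= k)%N -> (u k <= e%:E)%E).
Proof.
move=> u0; split=> [ucv e e0|H].
  have [[K1 _ H1] /cvgr0Pnorm_le/(_ _ e0)[K2 _ H2]] := (fine_cvgP _ _).1 ucv.
  exists (maxn K1 K2) => k; rewrite geq_max => /andP[/H1 fk /H2/=].
  by rewrite ger0_norm ?fine_ge0// -lee_fin fineK.
apply/fine_cvgP; split.
  have [K HK] := H _ ltr01; exists K => // k /= Kk.
  by rewrite ge0_fin_numE//; apply: le_lt_trans (HK _ Kk) _; rewrite ltry.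
apply/cvgr0Pnorm_le => e e0; have [K HK] := H _ e0; exists K => // k /= Kk.
rewrite /= ger0_norm ?fine_ge0// -lee_fin fineK ?HK//.
by rewrite ge0_fin_numE//; apply: le_lt_trans (HK _ Kk) _; rewrite ltry.
Qed.

Lemma ge0_dominated_cvg0 {d} {T : measurableType d} {R : realType}
    (m : {measure set T -> \bar R}) (F : nat -> T -> \bar R) (G : T -> \bar R) :
  (forall k, measurable_fun [set: T] (F k)) -> (forall k x, 0 <= F k x)%E ->
  {ae m, forall x, F ^~ x @ \oo --> 0%E} -> m.-integrable [set: T] G ->
  (forall k x, F k x <= G x)%E -> (\int[m]_x F k x)%E @[k --> \oo] --> 0%E.
Proof.
move=> mF F0 Fcv iG FG.
have [] := @dominated_convergence _ _ _ m setT measurableT F (cst 0%E) G mF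
  (measurable_cst _) _ iG _.
- by apply: filterS Fcv => x h _.
- by apply: aeW => x k _; rewrite gee0_abs.
by rewrite integral0.
Qed.

(** * Approximate identities *)

Lemma ge0_integral_tail {d} {T : measurableType d} {R : realType}
    (m : {measure set T -> \bar R}) (B : nat -> set T) (u : T -> R) (e : R) : 0 < e ->
  (forall k, measurable (B k)) -> (forall x, exists K, forall k, (K <= k)%N -> B k x) ->
  m.-integrable setT (EFin \o u) -> (forall x, 0 <= u x) ->
  exists K, forall k, (K <= k)%N -> (\int[m]_x (\1_(~` B k) x * u x)%:E <= e%:E)%E.
Proof.
move=> e0 mB exB iu u0; have /measurable_EFinP mu := measurable_int _ iu.
pose F k x : \bar R := (\1_(~` B k) x * u x)%:E.
have F0 k x : (0 <= F k x)%E by rewrite lee_fin mulr_ge0.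
apply: ((ecvg0P (fun k => integral_ge0 _ (fun x _ => F0 k x))).1 _ _ e0).
apply: ge0_dominated_cvg0 iu _ => //.
- move=> k; apply/measurable_EFinP; apply: measurable_funM => //.
  by apply: measurable_indic; exact: measurableC.
- apply: aeW => x; have [K BK] := exB x.
  apply: cvg_near_cst; exists K => // k /BK Bkx.
  by rewrite /F indicE memNset ?mul0r// => /(_ Bkx).
- by move=> k x; rewrite lee_fin ler_piMl// indicE lern1 leq_b1.
Qed.

(** * Continuity of translations in L^1 *)

Section L1_translation.
Context {R : realType}.

Section product.
Context {d1 d2} {T1 : measurableType d1} {T2 : measurableType d2}.
Variables (m1 : {sigma_finite_measure set T1 -> \bar R}).
Variables (m2 : {sigma_finite_measure set T2 -> \bar R}).
Variable S : nat -> T2 -> T2.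
Hypothesis mS : forall k, measurable_fun [set: T2] (S k).
Hypothesis Spres : forall k (h : T2 -> \bar R), measurable_fun [set: T2] h ->
  (forall y, 0 <= h y)%E -> (\int[m2]_y h (S k y) = \int[m2]_y h y)%E.
Hypothesis Scv : forall v : T2 -> R, m2.-integrable setT (EFin \o v) ->
  (\int[m2]_y `|v (S k y) - v y|%:E)%E @[k --> \oo] --> 0%E.

(** For almost every x the inner integral tends to 0 by [Scv]. As [S k] preserves [m2], it is
    dominated by twice the integral of |w (x, .)|, which is integrable in x. *)
Lemma L1_translation_prod (w : T1 * T2 -> R) :
  (m1 \x m2)%E.-integrable setT (EFin \o w) ->
  (\int[m1]_x \int[m2]_y `|w (x, S k y) - w (x, y)|%:E)%E @[k --> \oo] --> 0%E.
Proof.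
move=> iw; have /measurable_EFinP mw := measurable_int _ iw.
have mwS k : measurable_fun setT (fun z : T1 * T2 => w (z.1, S k z.2)).
  apply: (measurableT_comp mw); apply: measurable_fun_pair => //.
  exact: measurableT_comp.
have mD k : measurable_fun setT (fun z : T1 * T2 => `|w (z.1, S k z.2) - w (z.1, z.2)|%:E).
  apply/measurable_EFinP; apply: measurableT_comp => //.
  apply: measurable_funB => //.
  by apply: (measurableT_comp mw); apply: measurable_fun_pair.
have mN : measurable_fun setT (fun z : T1 * T2 => `|w (z.1, z.2)|%:E).
  apply/measurable_EFinP; apply: measurableT_comp => //.
  by apply: (measurableT_comp mw); apply: measurable_fun_pair.
have mx (x : T1) : measurable_fun setT (fun y : T2 => w (x, y)).
  by apply: (measurableT_comp mw); apply: measurable_fun_pair.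
pose G x := (2%:E * \int[m2]_y `|w (x, y)|%:E)%E.
have mI : measurable_fun setT (fun x => \int[m2]_y `|w (x, y)|%:E)%E.
  exact: (measurable_fun_fubini_tonelli_F (fun z : T1 * T2 => `|w (z.1, z.2)|%:E)).
have iG : m1.-integrable setT G.
  apply: integrableZl => //; apply/integrableP; split => //.
  have [_] := integrableP _ _ _ iw; rewrite fubini_tonelli1//; last first.
    by apply: measurableT_comp => //; exact/measurable_EFinP.
  by move=> H; under eq_integral => x _ do rewrite gee0_abs ?integral_ge0//; exact: H.
apply: ge0_dominated_cvg0 iG _.
- move=> k; exact: (measurable_fun_fubini_tonelli_F
    (fun z : T1 * T2 => `|w (z.1, S k z.2) - w (z.1, z.2)|%:E)).
- by move=> k x; exact: integral_ge0.
- by apply: filterS (ae_integrable1 iw) => x ix; exact: Scv.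
move=> k x.
rewrite /G (natrD _ 1 1) EFinD ge0_muleDl ?lee_fin//.
rewrite !mul1e -{1}(@Spres k (fun y => `|w (x, y)|%:E))//; last first.
  by apply/measurable_EFinP; apply: measurableT_comp.
have mxS : measurable_fun setT (fun y : T2 => w (x, S k y)) by exact: (measurableT_comp (mx x) (mS k)).
rewrite -ge0_integralD//.
- apply: ge0_le_integral => //.
  + by apply/measurable_EFinP; apply: measurableT_comp => //; exact: measurable_funB.
  + by apply: emeasurable_funD; apply/measurable_EFinP; apply: measurableT_comp.
  + by move=> y _; rewrite -EFinD lee_fin ler_normB.
- by apply/measurable_EFinP; apply: measurableT_comp.
- by apply/measurable_EFinP; apply: measurableT_comp.
Qed.
End product.

Local Notation leb := (@lebesgue_measure R).

Lemma ae_neq (a : R) : {ae leb, forall x, x != a}.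
Proof.
exists [set a]; split; [exact: measurable_set1|exact: lebesgue_measure_set1|].
by move=> x /= /negP; rewrite negbK => /eqP.
Qed.

Lemma integrable_tail (u : R -> R) (e : R) : 0 < e ->
  leb.-integrable setT (EFin \o u) ->
  exists2 N : R, 0 < N & (\int[leb]_x (\1_(~` `[- N, N]%classic) x * `|u x|)%:E <= e%:E)%E.
Proof.
move=> e0 iu; have := ge0_integral_tail (m := leb)
  (B := fun k => `[- k%:R, k%:R]%classic) (u := fun x => `|u x|) e0.
case=> // [x||K HK].
- exists (Num.bound x) => k kx; rewrite /= in_itv/= -ler_norml.
  by apply: (le_trans (ltW (unstable.ltr_norm_bound _))); rewrite ler_nat.
- exact: (integrable_norm iu).
by exists K.+1%:R => //; exact: HK.
Qed.

(** Half of e pays for the tail of u outside [-N, N], the other half for a continuous approximation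
    on this interval. Truncation to the interval creates jumps at N and -N only, a null set that
    dominated convergence tolerates. *)
Lemma L1_approx (u : R -> R) (e : R) : 0 < e -> leb.-integrable setT (EFin \o u) ->
  exists v : R -> R, exists2 N : R, 0 < N &
    [/\ measurable_fun [set: R] v, (exists M : R, forall x, `|v x| <= M),
    (forall x, N < `|x| -> v x = 0),
    (forall x, x != N -> x != - N -> {for x, continuous v}) &
    (\int[leb]_x `|u x - v x|%:E <= e%:E)%E].
Proof.
move=> e0 iu; have /measurable_EFinP mu := measurable_int _ iu.
have e2 : 0 < e / 2 by rewrite divr_gt0.
have [N N0 tailN] := integrable_tail e2 iu.
pose E : set R := `[- N, N]%classic.
have mE : measurable E by exact: measurable_itv.
have inE' x : (x \in E) = (`|x| <= N) by rewrite mem_setE in_itv/= -ler_norml.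
have Efin : (leb E < +oo)%E.
  by rewrite /E lebesgue_measure_itv/=; case: ifPn => // _; rewrite -EFinD ltry.
have iuE : leb.-integrable E (EFin \o u) by apply: integrableS iu.
have [g_ [cg _ gcv]] := approximation_continuous_integrable mE Efin iuE.
have I0 k : (0 <= \int[leb]_(x in E) `|(u x - g_ k x)%:E|)%E by exact: integral_ge0.
have [K /(_ K (leqnn K)) HK] := (ecvg0P I0).1 gcv _ e2.
set g := g_ K in HK; have {}cg : continuous g by exact: cg.
have mg : measurable_fun setT g by exact: continuous_measurable_fun.
pose v x := \1_E x * g x.
have vE x : `|x| <= N -> v x = g x by rewrite -inE' /v indicE => ->; rewrite mul1r.
have vNE x : N < `|x| -> v x = 0.
  by rewrite ltNge -inE' /v indicE => /negbTE ->; rewrite mul0r.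
exists v, N => //; split => //.
- by apply: measurable_funM => //; exact: measurable_indic.
- have cag : {within `[- N, N], continuous (fun x => `|g x|)}.
    apply: continuous_subspaceT => x; apply: (@continuous_comp _ _ _ g Num.norm) => //.
      exact: cg.
    exact: norm_continuous.
  have NN : - N <= N by lra.
  have [c _ Hc] := EVT_max NN cag.
  exists `|g c| => x; have [xN|xN] := leP `|x| N; last by rewrite vNE// normr0.
  by rewrite vE//; apply: Hc; rewrite in_itv/= -ler_norml.
- move=> x xN xN'; have d0 : 0 < `| `|x| - N |.
    rewrite normr_gt0 subr_eq0; apply/negP => /eqP xE; move: xN xN'.
    by rewrite -xE; case: (ger0P x) => _; rewrite ?opprK eqxx.
  have [xlt|xgt] := ltP `|x| N.
    have H : \forall y \near x, g y = v y.
      exists `| `|x| - N | => //= y /= xy; rewrite vE//.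
      rewrite (@ltr0_norm _ (`|x| - N)) ?subr_lt0// in xy.
      have := ler_normB x (x - y); rewrite opprB addrC subrK; lra.
    suff : v y @[y --> x] --> v x by [].
    rewrite (vE x (ltW xlt)); exact: (cvg_trans (near_eq_cvg H) (cg x)).
  have xgt' : N < `|x| by rewrite lt_neqAle xgt andbT eq_sym -subr_eq0 -normr_gt0.
  have H : \forall y \near x, (cst 0 : R -> R) y = v y.
    exists `| `|x| - N | => //= y /= xy; rewrite vNE//.
    rewrite (@gtr0_norm _ (`|x| - N)) ?subr_gt0// in xy.
    have := ler_normD y (x - y); rewrite addrC subrK; lra.
  suff : v y @[y --> x] --> v x by [].
  rewrite (vNE x)//; exact: (cvg_trans (near_eq_cvg H) (cvg_cst _)).
have {}HK : (\int[leb]_x (\1_E x * `|u x - g x|)%:E <= (e / 2)%:E)%E.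
  apply: le_trans HK; rewrite [leRHS]integral_mkcond; apply: eq_leW.
  apply: eq_integral => x _; rewrite /patch indicE.
  by case: ifPn => _; rewrite ?mul0r ?mul1r.
have mEc : measurable (~` E) by exact: measurableC.
rewrite (@eq_integral _ _ _ leb _ (fun x => (\1_E x * `|u x - g x|)%:E +
   (\1_(~` E) x * `|u x|)%:E)%E); last first.
  move=> x _; rewrite !indicE in_setC; case: (boolP (x \in E)) => /= xE.
    by rewrite mul0r adde0 mul1r vE// -inE'.
  by rewrite mul0r add0e mul1r vNE ?subr0// ltNge -inE'.
rewrite ge0_integralD//; last 2 first.
- apply/measurable_EFinP; apply: measurable_funM; first exact: measurable_indic.
  by apply: measurableT_comp => //; exact: measurable_funB.
- apply/measurable_EFinP; apply: measurable_funM; last exact: measurableT_comp.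
  exact: measurable_indic.
rewrite (le_trans (leeD HK tailN))// -EFinD lee_fin; lra.
Qed.

(** Replacing u by the v of [L1_approx] costs e/3 twice. The differences v (x - t k) - v x tend to 0
    off {N, -N} and are bounded by 2 M on an interval which, the sequence t being bounded, contains
    all the translated supports. *)
Lemma L1_translation1 (u : R -> R) (t : nat -> R) : leb.-integrable setT (EFin \o u) ->
  t @ \oo --> (0 : R) ->
  (\int[leb]_x `|u (x - t k)%R - u x|%:E)%E @[k --> \oo] --> 0%E.
Proof.
move=> iu t0; have /measurable_EFinP mu := measurable_int _ iu.
have mshift (w : R -> R) c : measurable_fun setT w ->
    measurable_fun [set: R] (fun x => w (x - c)).
  by move=> mw; apply: measurableT_comp => //; exact: measurable_funB.
have mD (w : R -> R) c : measurable_fun setT w ->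
    measurable_fun [set: R] (fun x => `|w (x - c) - w x|%:E).
  move=> mw; apply/measurable_EFinP; apply: measurableT_comp => //.
  by apply: measurable_funB => //; exact: mshift.
apply/ecvg0P => [k|e e0]; first exact: integral_ge0.
have e3 : 0 < e / 3 by rewrite divr_gt0.
have [v [N N0 [mv [M vM] vN vc uv]]] := L1_approx e3 iu.
have [B tB] : exists B : R, forall k, `|t k| <= B.
  have /cvg_seq_bounded[B [_ HB]] : cvgn t by apply/cvg_ex; exists 0.
  by exists (B + 1) => k; apply: HB => //; rewrite ltrDl.
have M0 : 0 <= M by apply: le_trans (vM 0).
have /ecvg0P : (\int[leb]_x `|v (x - t k)%R - v x|%:E)%E @[k --> \oo] --> 0%E.
  pose J : set R := `[- (N + B), N + B]%classic.
  have iG : leb.-integrable setT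
      (fun x => (2 * M)%:E * (EFin \o \1_J) x)%E.
    by apply: integrableZl => //; exact: integrable_indic_itv.
  apply: ge0_dominated_cvg0 iG _.
  - by move=> k; exact: mD.
  - by [].
  - apply: (@filterS2 _ _ (ae_filter_ringOfSetsType leb)) (ae_neq N) (ae_neq (- N)) => x xN xN'.
    have tx : (x - t k) @[k --> \oo] --> x.
      by rewrite -[X in _ --> X]subr0; apply: cvgB => //; exact: cvg_cst.
    have vtx : v (x - t k) @[k --> \oo] --> v x.
      by apply: continuous_cvg => //; exact: vc.
    apply/ecvg0P => // d d0; move/cvgrPdist_le: vtx => /(_ _ d0)[K _ HK].
    by exists K => k Kk; rewrite lee_fin distrC; exact: HK.
  move=> k x; rewrite -EFinM lee_fin /= indicE /J mem_setE in_itv/= -ler_norml.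
  case: (leP `|x| (N + B)) => /= [_|xNB].
    by rewrite mulr1 mulr_natl mulr2n (le_trans (ler_normB _ _))// lerD.
  have tk := tB k; have tk0 := normr_ge0 (t k).
  have xt : `|x| <= `|x - t k| + `|t k| by rewrite -{1}(subrK (t k) x) ler_normD.
  by rewrite mulr0 !vN ?subr0 ?normr0//; lra.
have I0 k : (0 <= \int[leb]_x `|v (x - t k)%R - v x|%:E)%E by exact: integral_ge0.
move=> /(_ I0)/(_ _ e3)[K HK]; exists K => k Kk.
have muv : measurable_fun setT (fun x => `|u x - v x|%:E).
  apply/measurable_EFinP; apply: measurableT_comp => //.
  exact: measurable_funB.
have muvt : measurable_fun setT (fun x : R => `|u (x - t k) - v (x - t k)|%:E).
  exact: (measurableT_comp muv (mshift id (t k) (@measurable_id _ _ _))).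
apply: (@le_trans _ _ (\int[leb]_x (`|u (x - t k)%R - v (x - t k)%R|%:E +
   (`|v (x - t k)%R - v x|%:E + `|u x - v x|%:E)))%E).
  apply: ge0_le_integral => //.
  - exact: mD.
  - by apply: emeasurable_funD => //; apply: emeasurable_funD => //; exact: mD.
  move=> x _; rewrite -!EFinD lee_fin.
  have := ler_normD (u (x - t k) - v (x - t k)) (v (x - t k) - v x - (u x - v x)).
  have := ler_normB (v (x - t k) - v x) (u x - v x).
  rewrite (_ : u (x - t k) - v (x - t k) + (v (x - t k) - v x - (u x - v x)) =
    u (x - t k) - u x); [lra|ring].
rewrite ge0_integralD//; last 2 first.
- by move=> x _; exact: adde_ge0.
- by apply: emeasurable_funD => //; exact: mD.
rewrite ge0_integralD//; last exact: mD.
have -> : (\int[leb]_x `|u (x - t k)%R - v (x - t k)%R|%:E = \int[leb]_x `|u x - v x|%:E)%E.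
  rewrite [RHS](ge0_integral_affine1 (- t k) (a := 1))//.
  by rewrite normr1 mul1e; apply: eq_integral => x _; rewrite /affine1 mul1r.
rewrite (le_trans (leeD uv (leeD (HK _ Kk) uv)))// -!EFinD lee_fin; lra.
Qed.

(** Induction on n: translate by the first coordinate and by the others in turn, each time with
    [L1_translation_prod]. *)
Lemma L1_translation_rV n (u : 'rV[R]_n -> R) (z : nat -> 'rV[R]_n) :
  (@lebesgue_rV R n).-integrable setT (EFin \o u) ->
  (forall i, z k ord0 i @[k --> \oo] --> (0 : R)) ->
  (\int[@lebesgue_rV R n]_x `|u (x - z k)%R - u x|%:E)%E @[k --> \oo] --> 0%E.
Proof.
elim: n u z => [|n IH] u z iu z0.
  apply/ecvg0P => [k|e e0]; first exact: integral_ge0.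
  exists 0%N => k _; under eq_integral => x _.
    have -> : x - z k = x by apply/rowP => -[].
    rewrite subrr normr0; over.
  by rewrite integral0 lee_fin ltW.
have /measurable_EFinP mu := measurable_int _ iu.
pose w (p : measurableTypeR R * 'rV[R]_n) := u (cons_rV p).
have mw : measurable_fun setT w.
  by apply: (measurableT_comp mu); exact: measurable_cons_rV.
have iw : (leb \x lebesgue_rV n)%E.-integrable setT (EFin \o w).
  apply/integrableP; split; first exact/measurable_EFinP.
  have [_] := integrableP _ _ _ iu; rewrite ge0_integral_consrV//; last first.
    by apply: measurableT_comp => //; exact/measurable_EFinP.
  rewrite fubini_tonelli1//.
  by apply: measurableT_comp => //; exact/measurable_EFinP.
(* [L1_translation_prod] translates the second factor, so the factors are swapped to treat the first
   coordinate. *)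
pose w' (p : 'rV[R]_n * measurableTypeR R) := w (p.2, p.1).
have mw' : measurable_fun setT w'.
  by apply: (measurableT_comp mw); exact: measurable_fun_pair.
have iw' : (lebesgue_rV n \x leb)%E.-integrable setT (EFin \o w').
  apply/integrableP; split; first exact/measurable_EFinP.
  have [_] := integrableP _ _ _ iw; rewrite fubini_tonelli2//; last first.
    by apply: measurableT_comp => //; exact/measurable_EFinP.
  rewrite fubini_tonelli1//.
  by apply: measurableT_comp => //; exact/measurable_EFinP.
pose z' k : 'rV[R]_n := (uncons_rV (z k)).2.
pose t k : R := z k ord0 ord0.
have mS k : measurable_fun [set: 'rV[R]_n] (fun v => v - z' k) by exact: measurable_rVc.
have mt k : measurable_fun [set: measurableTypeR R] (fun x : measurableTypeR R => x - t k : measurableTypeR R).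
  exact: measurable_funB.
have A0 : (\int[leb]_x \int[lebesgue_rV n]_v `|w (x, v - z' k)%R - w (x, v)|%:E)%E @[k --> \oo] --> 0%E.
  apply: (@L1_translation_prod _ _ _ _ leb (lebesgue_rV n) (fun k v => v - z' k)) => //.
    by move=> k h mh h0; exact: ge0_integral_shift.
  move=> v iv; apply: IH => // i.
  rewrite (_ : (fun k => _) = fun k => z k ord0 (lift ord0 i)); first exact: z0.
  by apply/funext => k; rewrite /z' /uncons_rV mxE.
have B0 : (\int[lebesgue_rV n]_v \int[leb]_x `|w (x - t k, v)%R - w (x, v)|%:E)%E @[k --> \oo] --> 0%E.
  apply: (@L1_translation_prod _ _ _ _ (lebesgue_rV n) leb (fun k x => x - t k) _ _ _ w') => //.
    move=> k h mh h0; rewrite [RHS](ge0_integral_affine1 (- t k) (a := 1))//.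
    by rewrite normr1 mul1e; apply: eq_integral => x _; rewrite /affine1 mul1r.
  by move=> v iv; apply: L1_translation1 => //; exact: z0.
have I0 k : (0 <= \int[leb]_x \int[lebesgue_rV n]_v `|w (x, v - z' k)%R - w (x, v)|%:E)%E.
  by apply: integral_ge0 => x _; exact: integral_ge0.
have J0 k : (0 <= \int[lebesgue_rV n]_v \int[leb]_x `|w (x - t k, v)%R - w (x, v)|%:E)%E.
  by apply: integral_ge0 => x _; exact: integral_ge0.
apply/ecvg0P => [k|e e0]; first exact: integral_ge0.
have e2 : 0 < e / 2 by rewrite divr_gt0.
have [K1 H1] := (ecvg0P I0).1 A0 _ e2; have [K2 H2] := (ecvg0P J0).1 B0 _ e2.
exists (maxn K1 K2) => k; rewrite geq_max => /andP[/H1 {}H1 /H2 {}H2].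
have mabs (T : measurableType _) (f g : T -> R) : measurable_fun setT f -> measurable_fun setT g ->
    measurable_fun setT (fun x => `|f x - g x|%:E).
  by move=> mf mg; apply/measurable_EFinP; apply: measurableT_comp => //; exact: measurable_funB.
rewrite ge0_integral_consrV//; last first.
  by apply: mabs => //; apply: (measurableT_comp mu); exact: measurable_rVc.
pose F1 (p : measurableTypeR R * 'rV[R]_n) := `|w (p.1 - t k, p.2 - z' k)%R - w (p.1 - t k, p.2)%R|%:E.
pose F2 (p : measurableTypeR R * 'rV[R]_n) := `|w (p.1 - t k, p.2)%R - w p|%:E.
have mp1 : measurable_fun setT (fun p : measurableTypeR R * 'rV[R]_n => (p.1 - t k, p.2) : measurableTypeR R * 'rV[R]_n).
  by apply: measurable_fun_pair => //; exact: (measurableT_comp (mt k)).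
have mp2 : measurable_fun setT (fun p : measurableTypeR R * 'rV[R]_n => (p.1 - t k, p.2 - z' k) : measurableTypeR R * 'rV[R]_n).
  by apply: measurable_fun_pair; [exact: (measurableT_comp (mt k))|exact: (measurableT_comp (mS k))].
have mF1 : measurable_fun setT F1.
  by apply: mabs; [exact: (measurableT_comp mw mp2)|exact: (measurableT_comp mw mp1)].
have mF2 : measurable_fun setT F2.
  by apply: mabs => //; exact: (measurableT_comp mw mp1).
have F10 q : (0 <= F1 q)%E by rewrite lee_fin.
have F20 q : (0 <= F2 q)%E by rewrite lee_fin.
apply: (@le_trans _ _ (\int[leb]_x ((\int[lebesgue_rV n]_v F1 (x, v)) + (\int[lebesgue_rV n]_v F2 (x, v))))%E).
  apply: ge0_le_integral => //.
  - by move=> x _; exact: integral_ge0.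
  - apply: (measurable_fun_fubini_tonelli_F (fun p => `|u (cons_rV p - z k) - u (cons_rV p)|%:E)) => //.
    apply: mabs => //; apply: (measurableT_comp mu).
    by apply: measurable_rVB => //; exact: measurable_cons_rV.
  - apply: emeasurable_funD.
      exact: (measurable_fun_fubini_tonelli_F F1 mF1 F10).
    exact: (measurable_fun_fubini_tonelli_F F2 mF2 F20).
  have mxv (x : measurableTypeR R) : measurable_fun setT (fun v : 'rV[R]_n => (x, v)).
    exact: measurable_fun_pair.
  move=> x _; rewrite -ge0_integralD//; last 2 first.
  - exact: (measurableT_comp mF1 (mxv x)).
  - exact: (measurableT_comp mF2 (mxv x)).
  apply: ge0_le_integral => //.
  - apply: mabs; last exact: (measurableT_comp mw (mxv x)).
    apply: (measurableT_comp mu); apply: measurable_rVB => //.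
    by apply: measurableT_comp (mxv x); exact: measurable_cons_rV.
  - apply: emeasurable_funD.
      exact: (measurableT_comp mF1 (mxv x)).
    exact: (measurableT_comp mF2 (mxv x)).
  move=> v _; rewrite /F1 /F2 -EFinD lee_fin /=.
  have -> : u (cons_rV (x, v) - z k) = w (x - t k, v - z' k).
    rewrite -(scale1r (cons_rV (x, v))) cons_rV_affine /w !mul1r !scale1r.
    congr (u (cons_rV (_, _))); first by rewrite /= mxE.
    by rewrite /=; congr (_ + _); apply/rowP => i; rewrite !mxE.
  by rewrite -[X in `|X|](subrKA (w (x - t k, v))) ler_normD.
rewrite ge0_integralD//; last 4 first.
- by move=> x _; exact: integral_ge0.
- exact: (measurable_fun_fubini_tonelli_F F1 mF1 F10).
- by move=> x _; exact: integral_ge0.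
- exact: (measurable_fun_fubini_tonelli_F F2 mF2 F20).
rewrite (_ : e = e / 2 + e / 2); last by field.
rewrite EFinD; apply: leeD.
  apply: le_trans H1; apply: eq_leW.
  pose G x := (\int[lebesgue_rV n]_v `|w (x, v - z' k)%R - w (x, v)|%:E)%E.
  (* In [F1] the first coordinate is still shifted by [t k]; the invariance of the outer integral
     removes this shift. *)
  rewrite [RHS](ge0_integral_affine1 (- t k) (oner_neq0 _) (f := G))//.
  - by rewrite normr1 mul1e; apply: eq_integral => x _; rewrite /G /affine1 mul1r.
  - apply: (measurable_fun_fubini_tonelli_F (fun p : measurableTypeR R * 'rV[R]_n => `|w (p.1, p.2 - z' k)%R - w p|%:E)) => //.
    apply: mabs => //; apply: (measurableT_comp mw).
    by apply: measurable_fun_pair => //; exact: (measurableT_comp (mS k)).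
  - by move=> x; exact: integral_ge0.
by rewrite (fubini_tonelli F2).
Qed.

End L1_translation.

Section approximate_identity.
Context {R : realType} {n : nat}.
Local Notation V := 'rV[R]_n.
Local Notation mu := (@lebesgue_rV R n).
Implicit Types (f g h : V -> R[i]) (x y z : V) (e : R).

(** The L^1 modulus of continuity of f. *)
Definition transl f y : \bar R := (\int[mu]_x (normc (f (x - y) - f x))%:E)%E.

Lemma transl_ge0 f y : (0 <= transl f y)%E.
Proof. by apply: integral_ge0 => x _; rewrite lee_fin normc_ge0. Qed.

Lemma cmeasurable_translker f : cmeasurable f ->
  cmeasurable (fun z : V * V => f (z.1 - z.2) - f z.1).
Proof.
move=> mf; apply: cmeasurableB; apply: cmeasurable_comp => //.
exact: measurable_subV.
Qed.

Lemma measurable_transl f : cmeasurable f -> measurable_fun [set: V] (transl f).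
Proof.
move=> mf; apply: (measurable_fun_fubini_tonelli_G
  (fun z : V * V => (normc (f (z.1 - z.2) - f z.1))%:E)).
  exact: measurable_cnorm (cmeasurable_translker mf).
by move=> z; rewrite lee_fin normc_ge0.
Qed.

Lemma transl_le f y : cmeasurable f -> (transl f y <= Lp_norm 1 f + Lp_norm 1 f)%E.
Proof.
move=> mf; have mn := measurable_cnorm mf.
rewrite !Lp_norm1 -{1}(ge0_integral_shift y mn); last by move=> x; rewrite lee_fin normc_ge0.
have mfy : cmeasurable (fun x => f (x - y)) by exact: cmeasurable_rVc.
have n0 x : (0 <= (normc (f x))%:E)%E by rewrite lee_fin normc_ge0.
rewrite -ge0_integralD//; last exact: (measurable_cnorm mfy).
apply: ge0_le_integral => //.
- by move=> x _; rewrite lee_fin normc_ge0.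
- by apply: measurable_cnorm; exact: cmeasurableB.
- by apply: emeasurable_funD => //; exact: measurable_cnorm.
by move=> x _; rewrite -EFinD lee_fin normcB.
Qed.

Lemma transl_cvg f (z : nat -> V) : in_Lp 1 f ->
  (forall i, z k ord0 i @[k --> \oo] --> (0 : R)) ->
  transl f (z k) @[k --> \oo] --> 0%E.
Proof.
move=> /[dup] f1 /in_L1P[fr fi] z0; have [mr mi] := in_Lp_meas f1.
have I0 (u : V -> R) k : (0 <= \int[mu]_x `|u (x - z k)%R - u x|%:E)%E.
  exact: integral_ge0.
have mD (u : V -> R) k : measurable_fun setT u ->
    measurable_fun setT (fun x : V => `|u (x - z k)%R - u x|%:E).
  move=> mu0; apply/measurable_EFinP; apply: measurableT_comp => //.
  by apply: measurable_funB => //; apply: (measurableT_comp mu0); exact: measurable_rVc.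
apply/ecvg0P => [k|e e0]; first exact: transl_ge0.
have e2 : 0 < e / 2 by rewrite divr_gt0.
have [K1 H1] := (ecvg0P (I0 _)).1 (L1_translation_rV fr z0) _ e2.
have [K2 H2] := (ecvg0P (I0 _)).1 (L1_translation_rV fi z0) _ e2.
exists (maxn K1 K2) => k; rewrite geq_max => /andP[/H1 {}H1 /H2 {}H2].
rewrite (_ : e = e / 2 + e / 2); last by field.
rewrite EFinD; apply: le_trans (leeD H1 H2).
rewrite -ge0_integralD//; last 2 first.
- exact: (mD (Re \o f)).
- exact: (mD (Im \o f)).
apply: ge0_le_integral => //.
- by move=> x _; rewrite lee_fin normc_ge0.
- apply: measurable_cnorm; apply: cmeasurableB; last by split.
  by apply: cmeasurable_rVc; split.
- by apply: emeasurable_funD; [exact: (mD (Re \o f))|exact: (mD (Im \o f))].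
by move=> x _; rewrite -EFinD lee_fin /= -ReB -ImB normc_leD.
Qed.

(** As g_e has the integral of g, the difference is the integral of (f (x - y) - f x) g_e (y) in y.
    Tonelli and the substitution y -> e y finish. *)
Lemma convolution_dilate_sub_le f g e : 0 < e -> in_Lp 1 f -> in_Lp 1 g ->
  (Lp_norm 1 (fun x => (convolution f (dilate e g) x - cint mu g * f x)%R) <=
   \int[mu]_y (transl f (e *: y)%R * (normc (g y))%:E))%E.
Proof.
move=> e0 f1 g1; have mf := in_Lp_meas f1; have mg := in_Lp_meas g1.
have ge1 := in_L1_dilate e0 g1; have mge := in_Lp_meas ge1.
have mker : cmeasurable (fun z : V * V => (f (z.1 - z.2) - f z.1) * dilate e g z.2).
  apply: cmeasurableM; first exact: cmeasurable_translker.
  exact: (cmeasurable_comp mge).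
have mkern := measurable_cnorm mker.
have kern0 (z : V * V) : (0 <= (normc ((f (z.1 - z.2) - f z.1) * dilate e g z.2))%:E)%E.
  by rewrite lee_fin normc_ge0.
rewrite Lp_norm1.
apply: (@le_trans _ _ (\int[mu]_x \int[mu]_y
   (normc ((f (x - y) - f x) * dilate e g y))%:E)%E).
  apply: ae_ge0_le_integral => //.
  - by move=> x _; rewrite lee_fin normc_ge0.
  - apply: measurable_cnorm; apply: cmeasurableB; first exact: cmeasurable_convolution.
    by apply: cmeasurableM => //; exact: cmeasurable_cst.
  - by move=> x _; apply: integral_ge0 => y _; rewrite lee_fin normc_ge0.
  - exact: (measurable_fun_fubini_tonelli_F _ mkern kern0).
  apply: filterS (ae_convolution_cintegrable (lexx 1%E) f1 ge1) => x cx _.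
  have -> : convolution f (dilate e g) x - cint mu g * f x =
      cint mu (fun y => (f (x - y) - f x) * dilate e g y).
    rewrite -(cint_dilate e0 g1) mulrC -cintZ; last exact/in_L1P.
    rewrite /convolution -[cintegral _]/(cint mu _) -cintB//; last first.
      by apply: cintegrableZ; exact/in_L1P.
    by congr (cint mu _); apply/funext => y; rewrite mulrBl.
  apply: le_cint; apply: cmeasurableM => //; apply: cmeasurableB.
    exact: cmeasurable_crV.
  exact: cmeasurable_cst.
rewrite (fubini_tonelli (fun z : V * V => (normc ((f (z.1 - z.2) - f z.1) * dilate e g z.2))%:E))//=.
have mtr := measurable_transl mf.
rewrite (@eq_integral _ _ _ mu setT (fun y => transl f y * (normc (dilate e g y))%:E)%E); last first.
  move=> y _; under eq_integral do rewrite Normc.normcM EFinM.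
  rewrite ge0_integralZr//.
  - apply: measurable_cnorm; apply: cmeasurableB => //; exact: cmeasurable_rVc.
  - by move=> x _; rewrite lee_fin normc_ge0.
  - by rewrite lee_fin normc_ge0.
have en0 : e ^+ n != 0 by rewrite expf_neq0// gt_eqF.
rewrite (ge0_integral_scale e0); last 2 first.
- by apply: emeasurable_funM => //; exact: measurable_cnorm.
- by move=> x; rewrite mule_ge0 ?transl_ge0// lee_fin normc_ge0.
rewrite -ge0_integralZl//.
- apply: eq_leW; apply: eq_integral => y _.
  rewrite normc_dilate// scalerA mulVf ?gt_eqF// scale1r.
  by rewrite muleCA -EFinM mulrA divff// mul1r.
- apply: emeasurable_funM.
    by apply: (measurableT_comp mtr); exact: measurable_rVZ.
  apply: measurable_cnorm; apply: (cmeasurable_comp mge); exact: measurable_rVZ.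
- by move=> x _; rewrite mule_ge0 ?transl_ge0// lee_fin normc_ge0.
- by rewrite lee_fin exprn_ge0// ltW.
Qed.

(** Dominated convergence is a statement on sequences, so the proof goes by contradiction with a
    sequence of bad scales tending to 0. The integral of g is left arbitrary: the values 0 and 1 are
    both needed later. *)
Lemma approximate_identity f g (k : R) : 0 < k -> in_Lp 1 f -> in_Lp 1 g ->
  exists2 e0 : R, 0 < e0 & forall e, 0 < e -> e <= e0 ->
  (Lp_norm 1 (fun x => (convolution f (dilate e g) x - cint mu g * f x)%R) <= k%:E)%E.
Proof.
move=> k0 f1 g1; have mf := in_Lp_meas f1; have mg := in_Lp_meas g1.
apply: contrapT => H.
have {}H (j : nat) : exists e, [/\ 0 < e, e <= j.+1%:R^-1 &
   (k%:E < Lp_norm 1 (fun x => (convolution f (dilate e g) x - cint mu g * f x)%R))%E].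
  apply: contrapT => Hj; apply: H; exists j.+1%:R^-1 => // e e0 ej.
  by rewrite leNgt; apply/negP => ke; apply: Hj; exists e.
have [e_ He] := choice H.
have e_0 : e_ j @[j --> \oo] --> (0 : R).
  apply: (@squeeze_cvgr _ _ _ _ (cst 0) (@harmonic R)).
  - by apply: nearW => j; have [/ltW -> ? _] := He j.
  - exact: cvg_cst.
  - exact: cvg_harmonic.
have cv : (\int[mu]_y (transl f (e_ j *: y)%R * (normc (g y))%:E))%E @[j --> \oo] --> 0%E.
  have iG : mu.-integrable setT (fun y => (Lp_norm 1 f + Lp_norm 1 f) * (normc (g y))%:E)%E.
    have [_ foo] := (in_LpP _ _).1 f1.
    have ffin : (Lp_norm 1 f + Lp_norm 1 f)%E \is a fin_num.
      by rewrite fin_numD ge0_fin_numE ?Lp_norm_ge0// foo.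
    rewrite -(fineK ffin); apply: integrableZl => //.
    have [_ goo] := (in_LpP _ _).1 g1.
    apply/integrableP; split; first exact: measurable_cnorm.
    by rewrite Lp_norm1 in goo; under eq_integral do rewrite gee0_abs ?lee_fin ?normc_ge0//.
  apply: ge0_dominated_cvg0 iG _.
  - move=> j; apply: emeasurable_funM; last exact: measurable_cnorm.
    by apply: (measurableT_comp (measurable_transl mf)); exact: measurable_rVZ.
  - by move=> j y; rewrite mule_ge0 ?transl_ge0// lee_fin normc_ge0.
  - apply: aeW => y.
    have : transl f (e_ j *: y) @[j --> \oo] --> 0%E.
      apply: transl_cvg => // i; under eq_fun do rewrite mxE.
      rewrite (_ : 0 = 0 * y ord0 i); last by rewrite mul0r.
      by apply: cvgM => //; exact: cvg_cst.
    move=> h.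
    have := cvgeZr (isT : (normc (g y))%:E \is a fin_num) h.
    by rewrite mul0e.
  - by move=> j y; rewrite lee_wpmul2r ?lee_fin ?normc_ge0// transl_le.
have I0 j : (0 <= \int[mu]_y (transl f (e_ j *: y)%R * (normc (g y))%:E))%E.
  by apply: integral_ge0 => y _; rewrite mule_ge0 ?transl_ge0// lee_fin normc_ge0.
have [K /(_ _ (leqnn K))] := (ecvg0P I0).1 cv _ k0.
have [e0 _ kl] := He K => h; move: kl; rewrite ltNge => /negP; apply.
exact: (le_trans (convolution_dilate_sub_le e0 f1 g1)).
Qed.

End approximate_identity.

(** * Uniqueness of the Fourier transform *)

Section kernel1.
Context {R : realType}.
Local Notation leb := (@lebesgue_measure R).

Lemma FTC_global (f F : R -> R) (a b : R) : a < b -> continuous f ->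
  (forall x : R, is_derive x 1 F (f x)) ->
  (\int[leb]_(x in `[a, b]) (f x)%:E = (F b - F a)%:E)%E.
Proof.
move=> ab cf dF.
have cF : continuous F.
  by move=> x; apply: differentiable_continuous; apply/derivable1_diffP.
rewrite (@continuous_FTC2 _ f F) ?EFinB//.
- exact: continuous_subspaceT.
- split.
  + by move=> x _.
  + by apply: cvg_at_right_filter; exact: cF.
  + by apply: cvg_at_left_filter; exact: cF.
by move=> x _; rewrite derive1E derive_val.
Qed.

(** A majorant that is integrable because its primitive is [atan]; it dominates the Fejer kernel
    and, multiplied over the coordinates, Schwartz functions. *)
Definition cauchy (x : R) : R := (1 + x ^+ 2)^-1.

Lemma cauchy_den_gt0 (x : R) : 0 < 1 + x ^+ 2.
Proof. by rewrite ltr_pwDl// sqr_ge0. Qed.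

Lemma cauchy_gt0 x : 0 < cauchy x.
Proof. by rewrite invr_gt0 cauchy_den_gt0. Qed.

Lemma continuous_cauchy : continuous cauchy.
Proof.
move=> x; apply: cvgV; first by rewrite gt_eqF// cauchy_den_gt0.
by apply: cvgD; [exact: cvg_cst|exact: exprn_continuous].
Qed.

Lemma measurable_cauchy : measurable_fun [set: R] cauchy.
Proof. by apply: continuous_measurable_fun; exact: continuous_cauchy. Qed.

Lemma integral_cauchy_lty : (\int[leb]_x (cauchy x)%:E < +oo)%E.
Proof.
rewrite ge0_symfun_integralT; last 3 first.
- by move=> x; rewrite ltW// cauchy_gt0.
- exact: continuous_cauchy.
- by move=> x; rewrite /cauchy /= sqrrN.
rewrite (_ : [set x | _] = `[0%R, +oo[%classic); last first.
  by rewrite set_itvE.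
rewrite lte_mul_pinfty ?lee_fin//.
rewrite ge0_integral_ereal_sup//; last 2 first.
- by move=> x; rewrite ltW// cauchy_gt0.
- exact: measurable_cauchy.
apply: (@le_lt_trans _ _ (pi / 2)%:E); last by rewrite ltry.
apply: ge_ereal_sup => _ [i _ <-].
rewrite (@FTC_global _ atan)//; last exact: continuous_cauchy.
by rewrite atan0 subr0 lee_fin ltW// atan_ltpi2.
Qed.

(** The triangle function 1 - |x| on [-1, 1], split into its two affine pieces. At 0 both pieces
    count and the value is 2, on a null set. *)
Definition tri (x : R) : R := \1_`[-1, 0] x * (1 + x) + \1_`[0, 1] x * (1 - x).

Lemma tri_ge0 x : 0 <= tri x.
Proof.
rewrite /tri !indicE !mem_setE !in_itv/=.
by rewrite addr_ge0//; case: andP => [[? ?]|_]; rewrite ?mul0r ?mul1r//; lra.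
Qed.

Lemma measurable_tri : measurable_fun [set: R] tri.
Proof.
apply: measurable_funD; apply: measurable_funM => //.
  exact: measurable_funD.
exact: measurable_funB.
Qed.

Lemma integrable_tri_part (A : set R) (p c : R -> R) : measurable A -> (leb A < +oo)%E ->
  (forall x, x \in A -> `|p x * c x| <= 1) ->
  measurable_fun setT p -> measurable_fun setT c ->
  leb.-integrable setT (fun x => (\1_A x * (p x * c x))%:E).
Proof.
move=> mA Afin b mp mc.
apply: (@le_integrable _ _ _ leb setT measurableT _ (EFin \o \1_A)) => //.
- apply/measurable_EFinP; apply: measurable_funM; first exact: measurable_indic.
  exact: measurable_funM.
- move=> x _; rewrite /= lee_fin indicE; case: (boolP (x \in A)) => xA /=.
    by rewrite mul1r normr1 b.
  by rewrite mul0r normr0.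
apply/integrableP; split; first by apply/measurable_EFinP; exact: measurable_indic.
by under eq_integral do rewrite gee0_abs ?lee_fin//; rewrite integral_indic// setIT.
Qed.

Lemma integral_tri_mul (c : R -> R) : continuous c -> (forall x, `|c x| <= 1) ->
  leb.-integrable setT (fun x => (tri x * c x)%:E) /\
  (\int[leb]_x (tri x * c x)%:E = \int[leb]_(x in `[(-1)%R, 0%R]) ((1 + x) * c x)%:E
    + \int[leb]_(x in `[0%R, 1%R]) ((1 - x) * c x)%:E)%E.
Proof.
move=> cc c1; have mc : measurable_fun setT c by exact: continuous_measurable_fun.
have i1 : leb.-integrable setT (fun x => (\1_`[-1, 0] x * ((1 + x) * c x))%:E).
  apply: integrable_tri_part => //.
  - by rewrite lebesgue_measure_itv/=; case: ifPn => // _; rewrite -EFinD ltry.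
  - move=> x; rewrite mem_setE in_itv/= => /andP[x1 x2]; rewrite normrM mulr_ile1//.
    by rewrite ger0_norm; lra.
  - exact: measurable_funD.
have i2 : leb.-integrable setT (fun x => (\1_`[0, 1] x * ((1 - x) * c x))%:E).
  apply: integrable_tri_part => //.
  - by rewrite lebesgue_measure_itv/=; case: ifPn => // _; rewrite -EFinD ltry.
  - move=> x; rewrite mem_setE in_itv/= => /andP[x1 x2]; rewrite normrM mulr_ile1//.
    by rewrite ger0_norm; lra.
  - exact: measurable_funB.
have E x : (tri x * c x)%:E = ((\1_`[-1, 0] x * ((1 + x) * c x))%:E + (\1_`[0, 1] x * ((1 - x) * c x))%:E)%E.
  by rewrite -EFinD; congr EFin; rewrite /tri mulrDl !mulrA.
split.
  by under eq_fun do rewrite E; exact: integrableD.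
under eq_integral do rewrite E.
rewrite integralD//; congr (_ + _)%E.
  rewrite [RHS]integral_mkcond; apply: eq_integral => x _.
  by rewrite /patch indicE; case: ifPn => _; rewrite ?mul1r ?mul0r.
rewrite [RHS]integral_mkcond; apply: eq_integral => x _.
by rewrite /patch indicE; case: ifPn => _; rewrite ?mul1r ?mul0r.
Qed.

Lemma continuous_lin (A B : R) (c : R -> R) : continuous c ->
  continuous (fun x => (A + B * x) * c x).
Proof.
move=> cc x; apply: cvgM; last exact: cc.
apply: cvgD; first exact: cvg_cst.
by apply: cvgM; [exact: cvg_cst|exact: cvg_id].
Qed.

Lemma continuous_scale (w : R) (c : R -> R) : continuous c -> continuous (fun x => c (w * x)).
Proof.
move=> cc x; apply: continuous_comp; last exact: cc.
by apply: cvgM; [exact: cvg_cst|exact: cvg_id].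
Qed.

Lemma is_derive_trigo_scale (w x : R) :
  is_derive x 1 (fun x => sin (w * x)) (w * cos (w * x)) /\
  is_derive x 1 (fun x => cos (w * x)) (w * - sin (w * x)).
Proof.
have dw : is_derive x 1 (fun x => w * x) w.
  by apply: is_derive_eq; rewrite ?scaler0 ?addr0 ?add0r// /GRing.scale/= mulr1.
split; rewrite mulrC; first exact: (is_derive1_comp (f := sin) (g := fun x => w * x)).
exact: (is_derive1_comp (f := cos) (g := fun x => w * x)).
Qed.

(** The primitive comes from an integration by parts. *)
Lemma is_derive_lin_cos (A B w x : R) : w != 0 ->
  is_derive x 1 (fun x => (A + B * x) * sin (w * x) / w + B * cos (w * x) / w ^+ 2)
    ((A + B * x) * cos (w * x)).
Proof.
move=> w0.
have [ds dc] := is_derive_trigo_scale w x.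
apply: is_derive_eq.
by rewrite /GRing.scale/=; field.
Qed.

Lemma is_derive_lin_sin (A B w x : R) : w != 0 ->
  is_derive x 1 (fun x => - ((A + B * x) * cos (w * x) / w) + B * sin (w * x) / w ^+ 2)
    ((A + B * x) * sin (w * x)).
Proof.
move=> w0.
have [ds dc] := is_derive_trigo_scale w x.
apply: is_derive_eq.
by rewrite /GRing.scale/=; field.
Qed.

Lemma abs_cos_le1 (x : R) : `|cos x| <= 1.
Proof. by rewrite ler_norml cos_geN1 cos_le1. Qed.

Lemma abs_sin_le1 (x : R) : `|sin x| <= 1.
Proof. by rewrite ler_norml sin_geN1 sin_le1. Qed.

Lemma integral_tri_cos (w : R) : w != 0 ->
  (\int[leb]_x (tri x * cos (w * x))%:E = (2 * (1 - cos w) / w ^+ 2)%:E)%E.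
Proof.
move=> w0.
have cc : continuous (fun x => cos (w * x)) by apply: continuous_scale; exact: continuous_cos.
have [_ ->] := integral_tri_mul cc (fun x => abs_cos_le1 _).
have H1 := @continuous_lin 1 1 _ cc; have H2 := @continuous_lin 1 (-1) _ cc.
have -> : (\int[leb]_(x in `[(-1)%R, 0%R]) ((1 + x) * cos (w * x))%:E =
    ((1 - cos w) / w ^+ 2)%:E)%E.
  under eq_integral do rewrite -[X in 1 + X]mul1r.
  rewrite (FTC_global _ H1 (fun x => is_derive_lin_cos 1 1 x w0)); last by lra.
  by rewrite !mulr0 !(mulrN1 w) cosN sinN cos0 sin0; congr EFin; field.
have -> : (\int[leb]_(x in `[0%R, 1%R]) ((1 - x) * cos (w * x))%:E =
    ((1 - cos w) / w ^+ 2)%:E)%E.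
  under eq_integral do rewrite -[X in 1 + X]mulN1r.
  rewrite (FTC_global _ H2 (fun x => is_derive_lin_cos 1 (-1) x w0)); last by lra.
  by rewrite !mulr0 !(mulr1 w) cos0 sin0; congr EFin; field.
by rewrite -EFinD; congr EFin; field.
Qed.

Lemma integral_tri_sin (w : R) : (\int[leb]_x (tri x * sin (w * x))%:E = 0)%E.
Proof.
have [->|w0] := eqVneq w 0.
  by under eq_integral do rewrite mul0r sin0 mulr0; rewrite integral0.
have cc : continuous (fun x => sin (w * x)) by apply: continuous_scale; exact: continuous_sin.
have [_ ->] := integral_tri_mul cc (fun x => abs_sin_le1 _).
have H1 := @continuous_lin 1 1 _ cc; have H2 := @continuous_lin 1 (-1) _ cc.
have -> : (\int[leb]_(x in `[(-1)%R, 0%R]) ((1 + x) * sin (w * x))%:E =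
    (- w^-1 + sin w / w ^+ 2)%:E)%E.
  under eq_integral do rewrite -[X in 1 + X]mul1r.
  rewrite (FTC_global _ H1 (fun x => is_derive_lin_sin 1 1 x w0)); last by lra.
  by rewrite !mulr0 !(mulrN1 w) cosN sinN cos0 sin0; congr EFin; field.
have -> : (\int[leb]_(x in `[0%R, 1%R]) ((1 - x) * sin (w * x))%:E =
    (w^-1 - sin w / w ^+ 2)%:E)%E.
  under eq_integral do rewrite -[X in 1 + X]mulN1r.
  rewrite (FTC_global _ H2 (fun x => is_derive_lin_sin 1 (-1) x w0)); last by lra.
  by rewrite !mulr0 !(mulr1 w) cos0 sin0; congr EFin; field.
by rewrite -EFinD; congr EFin; field.
Qed.

(** The Fourier transform of the triangle function, that is (sin (pi t) / (pi t))^2 for t nonzero.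
    The integral form also covers t = 0 and gives measurability. *)
Definition fejer (t : R) : R := (\int[leb]_s (tri s * cos (2 * pi * t * s)))%R.

Lemma integrable_tri_cos (w : R) : leb.-integrable setT (fun x => (tri x * cos (w * x))%:E).
Proof.
have cc : continuous (fun x => cos (w * x)) by apply: continuous_scale; exact: continuous_cos.
by have [] := integral_tri_mul cc (fun x => abs_cos_le1 _).
Qed.

Lemma integrable_tri : leb.-integrable setT (EFin \o tri).
Proof.
by have := integrable_tri_cos 0; under eq_fun do rewrite mul0r cos0 mulr1.
Qed.

Lemma fejerE t : t != 0 -> fejer t = 2 * (1 - cos (2 * pi * t)) / (2 * pi * t) ^+ 2.
Proof.
by move=> t0; rewrite /fejer /Rintegral integral_tri_cos// !mulf_neq0// ?gt_eqF ?pi_gt0.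
Qed.

Lemma fejer_ge0 t : 0 <= fejer t.
Proof.
have [->|t0] := eqVneq t 0.
  by apply: Rintegral_ge0 => x _; rewrite mulr0 mul0r cos0 mulr1 tri_ge0.
by rewrite fejerE// divr_ge0 ?sqr_ge0// mulr_ge0// subr_ge0 cos_le1.
Qed.

Lemma fejer_le t : fejer t <= fejer 0.
Proof.
rewrite /fejer; apply: le_Rintegral => //; try exact: integrable_tri_cos.
by move=> x _; rewrite mulr0 mul0r cos0 ler_wpM2l ?tri_ge0 ?cos_le1.
Qed.

(** In (1 + t^2) [fejer t], the first term is at most [fejer 0], and the second, (1 - cos (2 pi t))
    / (2 pi^2), is at most 1. *)
Lemma fejer_le_cauchy t : fejer t <= (fejer 0 + 1) * cauchy t.
Proof.
rewrite ler_pdivlMr ?cauchy_den_gt0// mulrDr mulr1 lerD ?fejer_le//.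
have [->|t0] := eqVneq t 0; first by rewrite expr0n mulr0.
have p1 : 1 <= (pi : R) by rewrite (le_trans _ (pi_ge2 _))// ler1n.
have c1 := cos_geN1 (2 * pi * t).
rewrite fejerE//.
have t2 : 0 < t ^+ 2 by rewrite exprn_even_gt0.
have E (c q : R) : q != 0 -> 2 * (1 - c) / (2 * q * t) ^+ 2 * t ^+ 2 = (1 - c) / 2 / q ^+ 2.
  by move=> q0; field; rewrite q0.
rewrite E ?gt_eqF ?pi_gt0//.
rewrite ler_pdivrMr ?exprn_gt0 ?pi_gt0// mul1r.
have : 1 <= (pi : R) ^+ 2 by rewrite exprn_ege1.
lra.
Qed.

Lemma measurable_fejer : measurable_fun [set: R] fejer.
Proof.
apply: (measurable_Rint leb (h := fun z : measurableTypeR R * measurableTypeR R =>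
  tri z.2 * cos (2 * pi * z.1 * z.2))).
apply: measurable_funM; first exact: (measurableT_comp measurable_tri).
apply: (measurableT_comp (f := cos)).
  by apply: continuous_measurable_fun; exact: continuous_cos.
by apply: measurable_funM => //; apply: measurable_funM.
Qed.

Lemma integral_fejer_lty : (\int[leb]_x (fejer x)%:E < +oo)%E.
Proof.
apply: (@le_lt_trans _ _ (\int[leb]_x ((fejer 0 + 1)%:E * (cauchy x)%:E))%E).
  apply: ge0_le_integral => //.
  - by move=> x _; rewrite lee_fin fejer_ge0.
  - by apply/measurable_EFinP; exact: measurable_fejer.
  - by apply: emeasurable_funM => //; apply/measurable_EFinP; exact: measurable_cauchy.
  - by move=> x _; rewrite -EFinM lee_fin fejer_le_cauchy.
rewrite ge0_integralZl//.
- apply: lte_mul_pinfty => //; last exact: integral_cauchy_lty.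
  by rewrite lee_fin addr_ge0// fejer_ge0.
- by apply/measurable_EFinP; exact: measurable_cauchy.
- by move=> x _; rewrite lee_fin ltW// cauchy_gt0.
- by rewrite lee_fin addr_ge0// fejer_ge0.
Qed.

Lemma integral_fejer_gt0 : (0 < \int[leb]_x (fejer x)%:E)%E.
Proof.
rewrite lt0e integral_ge0 ?andbT; last by move=> x _; rewrite lee_fin fejer_ge0.
apply/negP => /eqP H.
have mf : measurable_fun setT (fun x => (fejer x)%:E).
  by apply/measurable_EFinP; exact: measurable_fejer.
have : (\int[leb]_x `|(fejer x)%:E| = 0)%E.
  by under eq_integral do rewrite gee0_abs ?lee_fin ?fejer_ge0//.
move=> /(ae_eq_integral_abs leb measurableT mf)[N [mN N0 sub]].
(* If the integral vanished, the null set [N] would contain ]0, 1/2[, where the kernel is positive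
   because cos (2 pi t) < 1. *)
have : (leb `]0%R, 2^-1%R[%classic <= leb N)%E.
  apply: le_measure; rewrite ?inE// => x /=; rewrite in_itv/= => /andP[x0 x2].
  apply: sub => /(_ I) /=; apply/eqP; rewrite eqe gt_eqF// fejerE ?gt_eqF//.
  have pp := pi_gt0 R.
  rewrite divr_gt0// ?exprn_gt0 ?mulr_gt0// subr_gt0 -[ltRHS]cos0 ltr_cos ?in_itv/= ?lexx ?pi_ge0//.
    by rewrite !mulr_gt0.
  apply/andP; split; nra.
rewrite N0 lebesgue_measure_itv/= lte_fin invr_gt0 ltr0n -EFinD lee_fin; lra.
Qed.

End kernel1.

(** * Tensor products and the Fourier transform on R^n *)

Section fourier.
Context {R : realType}.
Local Notation leb := (@lebesgue_measure R).

Definition expi (t : R) : R[i] := Complex (cos t) (sin t).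

Lemma expiD s t : expi (s + t) = expi s * expi t.
Proof.
apply: complex_ext; rewrite ?ReM ?ImM /=; first by rewrite cosD.
by rewrite sinD addrC.
Qed.

Lemma expi0 : expi 0 = 1.
Proof. by rewrite /expi cos0 sin0. Qed.

Lemma normc_expi t : normc (expi t) = 1.
Proof. by rewrite /= cos2Dsin2 sqrtr1. Qed.

Lemma cmeasurable_expi d (T : measurableType d) (u : T -> R) :
  measurable_fun setT u -> cmeasurable (fun x => expi (u x)).
Proof.
move=> mu0; split.
  apply: (measurableT_comp (f := @cos R)) => //.
  by apply: continuous_measurable_fun; exact: continuous_cos.
apply: (measurableT_comp (f := @sin R)) => //.
by apply: continuous_measurable_fun; exact: continuous_sin.
Qed.

Lemma cint_prod12 d1 d2 (T1 : measurableType d1) (T2 : measurableType d2)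
    (m1 : {sigma_finite_measure set T1 -> \bar R})
    (m2 : {sigma_finite_measure set T2 -> \bar R}) (f : T1 * T2 -> R[i]) :
  cintegrable (m1 \x m2)%E f ->
  cint (m1 \x m2)%E f = cint m1 (fun x => cint m2 (fun y => f (x, y))).
Proof.
have key (h : T1 * T2 -> R) : (m1 \x m2)%E.-integrable setT (EFin \o h) ->
    (\int[(m1 \x m2)%E]_z h z = \int[m1]_x \int[m2]_y h (x, y))%R.
  move=> ih; have /measurable_EFinP mh := measurable_int _ ih.
  have iF := integrable_fubini_F ih.
  rewrite /Rintegral; congr fine.
  rewrite -(integral12_prod_meas1 ih).
  apply: ae_eq_integral => //.
  - exact: measurable_int iF.
  - by apply/measurable_EFinP; exact: measurable_Rint.
  by apply: filterS (integrable_ae measurableT iF) => x /(_ I) xf _; rewrite fineK.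
move=> [fr fi]; apply: complex_ext; first exact: (key (Re \o f) fr).
exact: (key (Im \o f) fi).
Qed.

Section prod_rV.
Variable (n : nat).

Lemma cons_rV_ord0 (s : R) (v : 'rV[R]_n) : cons_rV (s, v) ord0 ord0 = s.
Proof.
rewrite /cons_rV /=; have -> : ord0 = lshift n (ord0 : 'I_1) by exact: val_inj.
by rewrite [LHS]row_mxEl mxE.
Qed.

Lemma cons_rV_lift (s : R) (v : 'rV[R]_n) i : cons_rV (s, v) ord0 (lift ord0 i) = v ord0 i.
Proof.
rewrite /cons_rV /=; have -> : lift ord0 i = rshift 1 i by exact: val_inj.
by rewrite [LHS]row_mxEr.
Qed.

Lemma dotprod_cons (x : 'rV[R]_n.+1) s v :
  dotprod x (cons_rV (s, v)) =
  x ord0 ord0 * s + dotprod (uncons_rV x).2 v.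
Proof.
rewrite /dotprod big_ord_recl cons_rV_ord0; congr (_ + _).
by apply: eq_bigr => i _; rewrite cons_rV_lift /uncons_rV mxE.
Qed.
End prod_rV.

Definition prodf (u : R -> R) n (x : 'rV[R]_n) : R := \prod_(i < n) u (x ord0 i).

Lemma prodf_ge0 u n (x : 'rV[R]_n) : (forall t, 0 <= u t) -> 0 <= prodf u x.
Proof. by move=> u0; apply: prodr_ge0 => i _. Qed.

Lemma measurable_prodf u n : measurable_fun setT u ->
  measurable_fun [set: 'rV[R]_n] (prodf u (n := n)).
Proof.
move=> mu0; apply: measurable_prod => i _.
by apply: (measurableT_comp mu0); exact: measurable_coord_rV.
Qed.

Lemma prodf_cons u n s (v : 'rV[R]_n) : prodf u (cons_rV (s, v)) = u s * prodf u v.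
Proof.
rewrite /prodf big_ord_recl cons_rV_ord0; congr (_ * _).
by apply: eq_bigr => i _; rewrite cons_rV_lift.
Qed.

Lemma integral_prodf (u : R -> R) n : measurable_fun setT u -> (forall t, 0 <= u t) ->
  (\int[@lebesgue_rV R n]_x (prodf u x)%:E = \prod_(i < n) \int[leb]_t (u t)%:E)%E.
Proof.
move=> mu0 u0; elim: n => [|n IH].
  rewrite big_ord0 (eq_integral (cst 1%E)); last by move=> x _; rewrite /prodf big_ord0.
  by rewrite integral_cst//= mul1e; exact: diracT.
rewrite ge0_integral_consrV; last 2 first.
- by apply/measurable_EFinP; exact: measurable_prodf.
- by move=> x; rewrite lee_fin prodf_ge0.
rewrite big_ord_recl -IH -ge0_integralZr//; last 3 first.
- exact/measurable_EFinP.
- by move=> x _; rewrite lee_fin.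
- by apply: integral_ge0 => x _; rewrite lee_fin prodf_ge0.
apply: eq_integral => s _; under eq_integral do rewrite prodf_cons EFinM.
rewrite ge0_integralZl//.
- by apply/measurable_EFinP; exact: measurable_prodf.
- by move=> x _; rewrite lee_fin prodf_ge0.
- by rewrite lee_fin.
Qed.

Lemma integrable_prodf (u : R -> R) n : measurable_fun setT u -> (forall t, 0 <= u t) ->
  (\int[leb]_t (u t)%:E < +oo)%E ->
  (@lebesgue_rV R n).-integrable setT (EFin \o prodf u (n := n)).
Proof.
move=> mu0 u0 uoo; apply/integrableP; split.
  by apply/measurable_EFinP; exact: measurable_prodf.
under eq_integral do rewrite /= ger0_norm ?prodf_ge0//.
rewrite integral_prodf//.
have foo : (\int[leb]_t (u t)%:E)%E \is a fin_num.
  by rewrite ge0_fin_numE// integral_ge0// => x _; rewrite lee_fin.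
elim: n => [|n IH]; first by rewrite big_ord0 ltry.
rewrite big_ord_recl; apply: lte_mul_pinfty => //.
by apply: integral_ge0 => x _; rewrite lee_fin.
Qed.

Lemma measurable_dotprod n (x : 'rV[R]_n) : measurable_fun [set: 'rV[R]_n] (dotprod x).
Proof.
apply: measurable_sum => i; apply: measurable_funM => //; exact: measurable_coord_rV.
Qed.

Lemma cint_consrV n (H : 'rV[R]_n.+1 -> R[i]) : cintegrable (lebesgue_rV n.+1) H ->
  cint (lebesgue_rV n.+1) H =
  cint leb (fun s => cint (lebesgue_rV n) (fun v => H (cons_rV (s, v)))).
Proof.
move=> cH; have mH := cintegrable_meas cH.
have mHc : cmeasurable (fun z : measurableTypeR R * 'rV[R]_n => H (cons_rV z)).
  by apply: (cmeasurable_comp mH); exact: measurable_cons_rV.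
have cHc : cintegrable (leb \x lebesgue_rV n)%E (fun z => H (cons_rV z)).
  apply: cintegrableP => //; have := cintegrable_normc cH.
  rewrite ge0_integral_consrV; last 2 first.
  - exact: measurable_cnorm.
  - by move=> x; rewrite lee_fin normc_ge0.
  rewrite (fubini_tonelli1 (fun z : measurableTypeR R * 'rV[R]_n => (normc (H (cons_rV z)))%:E))//.
    exact: measurable_cnorm.
  by move=> x; rewrite lee_fin normc_ge0.
rewrite -(cint_prod12 cHc); case: cH => Hr Hi; case: cHc => Hcr Hci.
apply: complex_ext; rewrite /= /Rintegral; congr fine.
  exact: (integral_pushforward (measurable_cons_rV (n:=n)) (measurable_int _ Hr) Hcr measurableT).
exact: (integral_pushforward (measurable_cons_rV (n:=n)) (measurable_int _ Hi) Hci measurableT).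
Qed.

Lemma normc_realC (r : R) : normc (r%:C)%C = `|r|.
Proof. by rewrite /= expr0n addr0 sqrtr_sqr. Qed.

Lemma cintegrable_mulexpi d (T : measurableType d) (m : {measure set T -> \bar R})
    (u w : T -> R) : m.-integrable setT (EFin \o u) -> measurable_fun setT w ->
  cintegrable m (fun x => ((u x)%:C)%C * expi (w x)).
Proof.
move=> iu mw; have /integrableP[/measurable_EFinP mu0 uoo] := iu.
apply: cintegrableP.
  by apply: cmeasurableM; [split => //; exact: measurable_cst|exact: cmeasurable_expi].
apply: le_lt_trans uoo; apply: eq_leW.
by apply: eq_integral => x _; rewrite Normc.normcM normc_expi mulr1 normc_realC.
Qed.

Lemma integral_tri_lty : (\int[leb]_t (tri t)%:E < +oo)%E.
Proof.
have /integrableP[_] := @integrable_tri R.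
by under eq_integral do rewrite /= ger0_norm ?tri_ge0//.
Qed.

Lemma integrable_prodf_tri n : (@lebesgue_rV R n).-integrable setT (EFin \o prodf tri (n := n)).
Proof.
apply: integrable_prodf; [exact: measurable_tri|exact: tri_ge0|exact: integral_tri_lty].
Qed.

Lemma cintegrable_tri n (x : 'rV[R]_n) :
  cintegrable (@lebesgue_rV R n)
    (fun xi => ((prodf tri xi)%:C)%C * expi (2 * pi * dotprod x xi)).
Proof.
apply: cintegrable_mulexpi; first exact: integrable_prodf_tri.
by apply: measurable_funM => //; exact: measurable_dotprod.
Qed.

(** Induction on n: the exponential splits over the first coordinate and the others. The sine part
    of each one-dimensional factor vanishes by [integral_tri_sin], whence a real value. *)
Lemma cint_tri n (x : 'rV[R]_n) :
  cint (@lebesgue_rV R n) (fun xi => ((prodf tri xi)%:C)%C * expi (2 * pi * dotprod x xi)) =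
  ((prodf fejer x)%:C)%C.
Proof.
elim: n x => [|n IH] x.
  rewrite /prodf big_ord0.
  rewrite (_ : (fun xi => _) = fun=> 1); last first.
    by apply/funext => xi; rewrite /dotprod !big_ord0 mulr0 expi0 mulr1.
  apply: complex_ext => /=; rewrite /Rintegral.
    by rewrite (integral_cst _ measurableT 1%E) mul1e -[RHS]/(fine 1); congr fine; exact: diracT.
  by rewrite integral0.
rewrite cint_consrV; last exact: cintegrable_tri.
have iu : leb.-integrable setT (EFin \o @tri R) by exact: integrable_tri.
have mw : measurable_fun setT (fun s : measurableTypeR R => 2 * pi * (x ord0 ord0 * s)).
  by do 2 apply: measurable_funM => //.
transitivity (cint leb (fun s => ((prodf fejer (uncons_rV x).2)%:C)%C *
    (((tri s)%:C)%C * expi (2 * pi * (x ord0 ord0 * s))))).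
  congr (cint _ _); apply/funext => s.
  rewrite -IH [RHS]mulrC -cintZ; last exact: cintegrable_tri.
  congr (cint _ _); apply/funext => v.
  rewrite prodf_cons dotprod_cons mulrDr expiD rmorphM /=.
  ring.
rewrite cintZ; last exact: cintegrable_mulexpi.
have -> : prodf fejer x = prodf fejer (uncons_rV x).2 * fejer (x ord0 ord0).
  rewrite /prodf big_ord_recl mulrC; congr (_ * _).
  by apply: eq_bigr => i _; rewrite /uncons_rV mxE.
rewrite rmorphM; congr (_ * _); apply: complex_ext => /=.
  rewrite /fejer; apply: eq_Rintegral => s _.
  by rewrite mul0r subr0 !mulrA.
rewrite /Rintegral -[RHS]/(fine 0); congr fine.
rewrite -[RHS](integral_tri_sin (2 * pi * x ord0 ord0)).
by apply: eq_integral => s _; rewrite mul0r addr0 !mulrA.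
Qed.

(* The n-dimensional Fejer kernel [prodf fejer] is integrable, has nonzero integral
   and is the Fourier transform of an integrable function ([cint_tri]): a function
   with vanishing Fourier transform is therefore killed by an approximate identity. *)
Lemma in_L1_fejer n : in_Lp 1 (fun x : 'rV[R]_n => ((prodf fejer x)%:C)%C).
Proof.
apply/in_L1P; split; last exact: integrable0.
apply: integrable_prodf; [exact: measurable_fejer|exact: fejer_ge0|exact: integral_fejer_lty].
Qed.

Lemma cint_fejer_neq0 n :
  cint (@lebesgue_rV R n) (fun x => ((prodf fejer x)%:C)%C) != 0.
Proof.
apply/negP => /eqP /(congr1 Re)/= /eqP; rewrite fine_eq0; last first.
  apply: integrable_fin_num => //.
  apply: integrable_prodf; [exact: measurable_fejer|exact: fejer_ge0|exact: integral_fejer_lty].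
rewrite integral_prodf; [|exact: measurable_fejer|exact: fejer_ge0].
suff /negP : (\prod_(i < n) \int[leb]_t (fejer t)%:E != 0)%E by [].
elim: n => [|n IH]; first by rewrite big_ord0 onee_neq0.
by rewrite big_ord_recl mule_neq0// gt_eqF// integral_fejer_gt0.
Qed.

Section uniqueness.
Variable n : nat.
Local Notation V := 'rV[R]_n.
Local Notation mu := (@lebesgue_rV R n).
Implicit Types f g : V -> R[i].

Lemma fourierE f xi : fourier f xi = cint mu (fun x => f x * expi (- (2 * pi * dotprod x xi))).
Proof.
congr (cint mu _); apply/funext => x; congr (_ * _).
by rewrite /expi cosN sinN.
Qed.

Lemma dotprodC (x y : V) : dotprod x y = dotprod y x.
Proof. by apply: eq_bigr => i _; rewrite mulrC. Qed.

Lemma dotprodZl (a : R) (x y : V) : dotprod (a *: x) y = a * dotprod x y.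
Proof. by rewrite /dotprod mulr_sumr; apply: eq_bigr => i _; rewrite mxE mulrA. Qed.

Lemma dotprodZr (a : R) (x y : V) : dotprod x (a *: y) = a * dotprod x y.
Proof. by rewrite dotprodC dotprodZl dotprodC. Qed.

Lemma dotprodBl (x y z : V) : dotprod (x - y) z = dotprod x z - dotprod y z.
Proof. by rewrite /dotprod -sumrB; apply: eq_bigr => i _; rewrite !mxE mulrBl. Qed.

Lemma measurable_dotprodl (x : V) : measurable_fun [set: V] (fun y => dotprod y x).
Proof. by under eq_fun do rewrite dotprodC; exact: measurable_dotprod. Qed.

Lemma measurable_dotprod2 : measurable_fun [set: V * V] (fun z : V * V => dotprod z.1 z.2).
Proof.
apply: measurable_sum => i; apply: measurable_funM.
  by apply: (measurableT_comp (measurable_coord_rV i)).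
by apply: (measurableT_comp (measurable_coord_rV i)).
Qed.

Lemma cintegrable_mulexpi2 f (w : V -> R) : in_Lp 1 f -> measurable_fun setT w ->
  cintegrable mu (fun x => f x * expi (w x)).
Proof.
move=> /in_LpP[mf foo] mw; apply: cintegrableP.
  by apply: cmeasurableM => //; exact: cmeasurable_expi.
rewrite Lp_norm1 in foo.
by under eq_integral do rewrite Normc.normcM normc_expi mulr1.
Qed.

Lemma measurable_phase (c : R) (xi : V) : measurable_fun [set: V] (fun x => - (c * dotprod x xi)).
Proof.
by apply: measurableT_comp => //; apply: measurable_funM => //; exact: measurable_dotprodl.
Qed.

Lemma fourierB f g xi : in_Lp 1 f -> in_Lp 1 g ->
  fourier (fun x => f x - g x) xi = fourier f xi - fourier g xi.
Proof.
move=> f1 g1; rewrite !fourierE -cintB; last 2 first.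
- by apply: cintegrable_mulexpi2 => //; exact: measurable_phase.
- by apply: cintegrable_mulexpi2 => //; exact: measurable_phase.
by congr (cint mu _); apply/funext => x; rewrite mulrBl.
Qed.

Lemma fourier_dilate e f xi : 0 < e -> in_Lp 1 f ->
  fourier (dilate e f) xi = fourier f (e *: xi).
Proof.
move=> e0 f1; have mf := in_Lp_meas f1; rewrite !fourierE.
rewrite (cint_affine 0 (a := e)) ?gt_eqF//; last first.
  apply: cmeasurableM; first exact: cmeasurable_dilate.
  by apply: cmeasurable_expi; exact: measurable_phase.
rewrite -cintZ; last first.
  apply: (@eq_ind _ (fun x => ((e ^- n)%:C)%C * (f x * expi (- (2 * pi * dotprod x (e *: xi))))) (cintegrable mu)).
    by apply: cintegrableZ; apply: cintegrable_mulexpi2 => //; exact: measurable_phase.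
  by apply/funext => x; rewrite addr0 dilateE ?gt_eqF// dotprodZl dotprodZr mulrA.
congr (cint mu _); apply/funext => x.
rewrite addr0 dilateE ?gt_eqF// dotprodZl dotprodZr !mulrA -rmorphM gtr0_norm//.
by rewrite divff ?rmorph1 ?mul1r// expf_neq0// gt_eqF.
Qed.

(** Fubini, then a translation of the inner integral: the character at x is the product of those at
    y and at x - y. *)
Lemma fourier_convolution f g xi : in_Lp 1 f -> in_Lp 1 g ->
  fourier (convolution f g) xi = fourier f xi * fourier g xi.
Proof.
move=> f1 g1; have mf := in_Lp_meas f1; have mg := in_Lp_meas g1.
rewrite !fourierE.
pose ex (x : V) := expi (- (2 * pi * dotprod x xi)).
have mex : cmeasurable ex by apply: cmeasurable_expi; exact: measurable_phase.
have nex x : normc (ex x) = 1 by exact: normc_expi.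
pose K (z : V * V) := f (z.1 - z.2) * g z.2 * ex z.1.
have mK : cmeasurable K.
  apply: cmeasurableM; first exact: cmeasurable_ker.
  exact: (cmeasurable_comp mex).
have Koo : (\int[mu]_x \int[mu]_y (normc (K (x, y)))%:E < +oo)%E.
  under eq_integral => x _ do under eq_integral => y _ do
    rewrite /K Normc.normcM nex mulr1 Normc.normcM.
  rewrite (ge0_integral_conv (measurable_normc mf) (measurable_normc mg)); last 2 first.
  - by move=> x; exact: normc_ge0.
  - by move=> x; exact: normc_ge0.
  rewrite -!Lp_norm1; have [_ foo] := (in_LpP _ _).1 f1; have [_ goo] := (in_LpP _ _).1 g1.
  by apply: lte_mul_pinfty => //; [exact: Lp_norm_ge0|rewrite ge0_fin_numE// Lp_norm_ge0].
transitivity (cint mu (fun x => cint mu (fun y => K (x, y)))).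
  apply: ae_eq_cint.
  - by apply: cmeasurableM => //; exact: cmeasurable_convolution.
  - exact: (cmeasurable_cint mu mK).
  apply: filterS (ae_convolution_cintegrable (lexx 1%E) f1 g1) => x cx.
  rewrite mulrC /convolution -[cintegral _]/(cint mu _) -cintZ//.
  by congr (cint mu _); apply/funext => y; rewrite /K /= mulrC.
rewrite (cint_fubini mK Koo) -cintZ; last by apply: cintegrable_mulexpi2 => //; exact: measurable_phase.
congr (cint mu _); apply/funext => y.
rewrite mulrC -cintZ; last by apply: cintegrable_mulexpi2 => //; exact: measurable_phase.
rewrite -[RHS](cint_shift y); last first.
  apply: cmeasurableM; first exact: cmeasurable_cst.
  by apply: cmeasurableM.
congr (cint mu _); apply/funext => x; rewrite /K /= /ex dotprodBl.
rewrite (_ : - (2 * pi * dotprod x xi) =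
  - (2 * pi * dotprod y xi) + - (2 * pi * (dotprod x xi - dotprod y xi))); last by ring.
by rewrite expiD; ring.
Qed.

(** Write the dilated Fejer kernel at x - y as an integral over frequencies with [cint_tri] and
    exchange the integrals: the integral in y is then a multiple of [fourier f] at e^-1 xi. *)
Lemma fourier_eq0_convolution f e : 0 < e -> in_Lp 1 f -> (forall xi, fourier f xi = 0) ->
  convolution f (dilate e (fun x => ((prodf fejer x)%:C)%C)) = (fun=> 0).
Proof.
move=> e0 f1 F0; have mf := in_Lp_meas f1.
have k1 := in_L1_dilate e0 (in_L1_fejer n); have mk := in_Lp_meas k1.
rewrite convolutionC//; apply/funext => x; rewrite /convolution -[LHS]/(cint mu _).
pose ph (y xi : V) : R := 2 * pi * dotprod (e^-1 *: (x - y)) xi.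
pose K (z : V * V) : R[i] := ((e ^- n * prodf tri z.2)%:C)%C * expi (ph z.1 z.2) * f z.1.
have mph : measurable_fun setT (fun z : V * V => ph z.1 z.2).
  apply: measurable_funM => //.
  have mz : measurable_fun setT (fun z : V * V => (e^-1 *: (x - z.1), z.2)).
    apply: measurable_fun_pair => //; apply: measurable_rVZ => //.
    by apply: measurable_rVB.
  exact: (measurableT_comp measurable_dotprod2 mz).
have mK : cmeasurable K.
  apply: cmeasurableM; last exact: (cmeasurable_comp mf).
  apply: cmeasurableM; last exact: cmeasurable_expi.
  split; last exact: measurable_cst.
  apply: measurable_funM => //.
  by apply: (measurableT_comp (measurable_prodf (@measurable_tri R))).
have nK z : normc (K z) = (e ^- n * prodf tri z.2) * normc (f z.1).
  rewrite /K Normc.normcM Normc.normcM normc_expi mulr1 normc_realC ger0_norm//.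
  by rewrite mulr_ge0// ?prodf_ge0// ?invr_ge0 ?exprn_ge0 ?ltW//; exact: tri_ge0.
have itri := integrable_prodf_tri n.
have Koo : (\int[mu]_y \int[mu]_xi (normc (K (y, xi)))%:E < +oo)%E.
  have trifin : (\int[mu]_xi (prodf tri xi)%:E)%E \is a fin_num by exact: integrable_fin_num.
  have en : 0 <= e ^- n by rewrite invr_ge0 exprn_ge0// ltW.
  rewrite (eq_integral (fun y => ((e ^- n)%:E * \int[mu]_xi (prodf tri xi)%:E) * (normc (f y))%:E)%E); last first.
    move=> y _; under eq_integral do rewrite nK /= -mulrA EFinM EFinM muleA.
    rewrite ge0_integralZr//; last 3 first.
    - apply: emeasurable_funM => //; apply/measurable_EFinP.
      exact: (measurable_prodf (@measurable_tri R)).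
    - by move=> xi _; rewrite mule_ge0 ?lee_fin// prodf_ge0//; exact: tri_ge0.
    - by rewrite lee_fin normc_ge0.
    rewrite ge0_integralZl//.
    - by apply/measurable_EFinP; exact: (measurable_prodf (@measurable_tri R)).
    - by move=> xi _; rewrite lee_fin prodf_ge0//; exact: tri_ge0.
  have [_ foo] := (in_LpP _ _).1 f1; rewrite Lp_norm1 in foo.
  rewrite ge0_integralZl//; last 3 first.
  - exact: measurable_cnorm.
  - by move=> y _; rewrite lee_fin normc_ge0.
  - rewrite mule_ge0//; apply: integral_ge0 => xi _; rewrite lee_fin prodf_ge0//; exact: tri_ge0.
  apply: lte_mul_pinfty => //.
    rewrite mule_ge0//; apply: integral_ge0 => xi _; rewrite lee_fin prodf_ge0//; exact: tri_ge0.
  by rewrite fin_numM.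
transitivity (cint mu (fun y => cint mu (fun xi => K (y, xi)))).
  congr (cint mu _); apply/funext => y.
  rewrite /dilate -cint_tri mulrC.
  rewrite -cintZ; last exact: cintegrable_tri.
  rewrite -cintZ; last by apply: cintegrableZ; exact: cintegrable_tri.
  by congr (cint mu _); apply/funext => xi; rewrite /K /ph /= rmorphM /=; ring.
rewrite (cint_fubini mK Koo).
transitivity (cint mu (fun _ : V => 0 : R[i])); last first.
  by apply: complex_ext; rewrite /= /Rintegral integral0.
congr (cint mu _); apply/funext => xi.
pose c : R[i] := ((e ^- n * prodf tri xi)%:C)%C * expi (2 * pi * dotprod (e^-1 *: x) xi).
transitivity (c * fourier f (e^-1 *: xi)); last by rewrite F0 mulr0.
rewrite fourierE -cintZ; last by apply: cintegrable_mulexpi2 => //; exact: measurable_phase.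
congr (cint mu _); apply/funext => y; rewrite /K /c /ph /= scalerBr dotprodBl mulrBr expiD.
rewrite dotprodZr dotprodZl dotprodZl; ring.
Qed.

Lemma fourier_eq0 f : in_Lp 1 f -> (forall xi, fourier f xi = 0) ->
  {ae mu, forall x, f x = 0}.
Proof.
move=> f1 F0; have mf := in_Lp_meas f1.
set k : V -> R[i] := fun x => ((prodf fejer x)%:C)%C.
have k1 : in_Lp 1 k by exact: in_L1_fejer.
have c0 := cint_fejer_neq0 n.
have z0 : (\int[mu]_x (normc (cint mu k * f x))%:E)%E = 0%E.
  apply/eqP; rewrite eq_le integral_ge0 ?andbT; last by move=> x _; rewrite lee_fin normc_ge0.
  (* The mollifications of f vanish, so the approximation error is the norm of ([cint mu k]) f
     itself, and it is at most any d > 0. *)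
  apply/lee_addgt0Pr => d d0; rewrite add0e.
  have [e0 e00 /(_ _ e00 (lexx _))] := approximate_identity d0 f1 k1.
  apply: le_trans; rewrite fourier_eq0_convolution// Lp_norm1.
  by under [leRHS]eq_integral do rewrite sub0r normcN.
have mck : cmeasurable (fun x => cint mu k * f x).
  by apply: cmeasurableM => //; exact: cmeasurable_cst.
have : (\int[mu]_x `|(normc (cint mu k * f x))%:E|)%E = 0%E.
  by under eq_integral do rewrite gee0_abs ?lee_fin ?normc_ge0//.
move=> /(ae_eq_integral_abs mu measurableT (measurable_cnorm mck)).
apply: filterS => x /(_ I) /= [] /eqP; rewrite normc_eq0 mulf_eq0 (negbTE c0) /=.
by move/eqP.
Qed.

End uniqueness.

End fourier.

(** * Schwartz functions *)

Section measurable_continuous.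
Context {R : realType} {n : nat}.
Local Notation V := 'rV[R]_n.

(** Meant for functions composed with [grid k], which depend only on the integer parts of the
    rescaled coordinates; nothing is asked of [h]. *)
Lemma measurable_fun_countable d (T : measurableType d) (C : countType) (m : T -> C)
    d' (T' : measurableType d') (h : C -> T') :
  (forall c, measurable (m @^-1` [set c])) -> measurable_fun [set: T] (h \o m).
Proof.
move=> mm _ B mB; rewrite setTI.
rewrite (_ : _ @^-1` B = \bigcup_c (if `[< B (h c) >] then m @^-1` [set c] else set0)).
  apply: countable_bigcupT_measurable; first exact: countableP.
  by move=> c; case: asboolP => // _; exact: measurable0.
rewrite eqEsubset; split=> x /=.
  by move=> Bx; exists (m x) => //=; case: asboolP.
by move=> [c _]; case: asboolP => //= Bc ->.
Qed.

Lemma cvg_rV (x : nat -> V) (l : V) : (forall i, x k ord0 i @[k --> \oo] --> l ord0 i) ->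
  x k @[k --> \oo] --> l.
Proof.
move=> xl A [P lP PA].
have : \forall k \near \oo, forall i, P ord0 i (x k ord0 i).
  by apply: filter_forall => i; exact: xl.
by apply: filterS => k Pk; apply: PA => j i; rewrite ord1.
Qed.

Definition grid (k : nat) (x : V) : V := \row_i ((Num.floor (2 ^+ k * x ord0 i))%:~R / 2 ^+ k).

Lemma cvg_grid x : grid k x @[k --> \oo] --> x.
Proof.
apply: cvg_rV => i; under eq_cvg do rewrite mxE.
apply/cvgrPdist_le => e e0.
have := near_half_pow_le e0; apply: filterS => k ke; apply: le_trans ke.
have k0 : 0 < 2 ^+ k :> R by rewrite exprn_gt0.
have /andP[a b] := floor_itv (2 ^+ k * x ord0 i).
have xE : x ord0 i = (2 ^+ k * x ord0 i) / 2 ^+ k by rewrite mulrAC mulfV ?gt_eqF// mul1r.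
rewrite {1}xE -mulrBl normrM (gtr0_norm (x := (2 ^+ k)^-1)) ?invr_gt0//.
rewrite ler_piMl ?invr_ge0 ?(ltW k0)// ger0_norm ?subr_ge0//.
by move: b; rewrite intrD lerBlDr addrC; exact: ltW.
Qed.

Lemma measurable_comp_grid k (h : V -> R) : measurable_fun [set: V] (h \o grid k).
Proof.
pose m (x : V) : {ffun 'I_n -> int} := [ffun i => Num.floor (2 ^+ k * x ord0 i)].
pose H (c : {ffun 'I_n -> int}) : R := h (\row_i ((c i)%:~R / 2 ^+ k)).
rewrite (_ : h \o grid k = H \o m); last first.
  by apply/funext => x; congr (h _); apply/rowP => i; rewrite !mxE ffunE.
apply: measurable_fun_countable => c.
rewrite (_ : _ @^-1` _ = \bigcap_(i in [set: 'I_n])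
    ((fun x : V => 2 ^+ k * x ord0 i) @^-1` `[(c i)%:~R, (c i + 1)%:~R[)).
  apply: fin_bigcap_measurable => [|i _]; first exact: finite_finset.
  rewrite -[X in measurable X]setTI.
  by apply: (measurable_funM _ (measurable_coord_rV i)) => //.
rewrite eqEsubset; split=> x /=.
  move=> <- i _ /=; rewrite /m ffunE in_itv/=; exact: floor_itv.
by move=> H1; apply/ffunP => i; rewrite ffunE; apply: floor_def; have := H1 i I; rewrite /= in_itv.
Qed.

(** The sigma-algebra is generated by the coordinates and not by the open sets, so h is obtained as
    the pointwise limit of its values at the points rounded to the grid of step 2^-k. *)
Lemma continuous_measurable_rV (h : V -> R) : continuous h -> measurable_fun [set: V] h.
Proof.
move=> ch; apply: (measurable_fun_cvg (h := fun k => h \o grid k)).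
  by move=> k; exact: measurable_comp_grid.
by move=> x _; apply: (continuous_cvg _ (ch x)); exact: cvg_grid.
Qed.

(** Expand the product of the 1 + x_i^2 over the subsets J of coordinates; rapid decrease with
    exponent 2 on J and 0 elsewhere bounds each term times |h|. *)
Lemma rapidly_decreasing_le_prodf (h : V -> R) : rapidly_decreasing h ->
  exists2 M : R, 0 <= M & forall x, `|h x| <= M * prodf cauchy x.
Proof.
move=> hh.
have /choice[M hM] : forall J : {set 'I_n}, exists M : R, forall x : V,
    (\prod_i (if i \in J then x ord0 i ^+ 2 else 1)) * `|h x| <= M.
  move=> J; have [M hM] := hh (fun i => if i \in J then 2 else 0)%N [::].
  exists M => x; apply: le_trans (hM x); rewrite normrM ler_wpM2r//.
  rewrite normr_prod ler_prod// => i _; case: ifPn => _; rewrite ?expr0 ?normr1 ?ler01 ?lexx//.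
  by rewrite sqr_ge0 ler_norm.
exists (\sum_J `|M J|); first by apply: sumr_ge0.
move=> x; rewrite /prodf.
have p0 : 0 < \prod_(i < n) (1 + x ord0 i ^+ 2).
  by apply: prodr_gt0 => i _; exact: cauchy_den_gt0.
have -> : \prod_(i < n) cauchy (x ord0 i) = (\prod_(i < n) (1 + x ord0 i ^+ 2))^-1.
  by rewrite -prodfV.
rewrite ler_pdivlMr//.
rewrite mulrC; under eq_bigr do rewrite addrC.
rewrite bigA_distr mulr_suml.
by apply: ler_sum => J _; apply: le_trans (hM J x) _; rewrite ler_norm.
Qed.

Lemma schwartz_in_L1 (f : V -> R[i]) : schwartz f -> in_Lp 1 f.
Proof.
move=> [sr si dr di].
suff ih (h : V -> R) : smooth h -> rapidly_decreasing h ->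
    (@lebesgue_rV R n).-integrable setT (EFin \o h).
  by apply/in_L1P; split; apply: ih.
move=> sh /rapidly_decreasing_le_prodf[M M0 hM].
have ip : (@lebesgue_rV R n).-integrable setT (EFin \o (fun x : V => M * prodf cauchy x)).
  have := integrableZl measurableT M (integrable_prodf n measurable_cauchy
    (fun t => ltW (cauchy_gt0 t)) integral_cauchy_lty).
  by apply: eq_integrable => // x _; rewrite /= EFinM.
apply: (le_integrable measurableT _ _ ip).
  by apply/measurable_EFinP; apply: continuous_measurable_rV; have [] := sh [::].
move=> x _ /=; rewrite lee_fin; apply: le_trans (hM x) _; exact: ler_norm.
Qed.

End measurable_continuous.

(** * The cutoff on the Fourier side *)

Section cutoff.
Context {R : realType} {n : nat} (zeta : 'rV[R]_n -> R[i]).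
Hypothesis zetaP : LP_cutoff zeta.
Local Notation V := 'rV[R]_n.
Local Notation mu := (@lebesgue_rV R n).

Lemma LP_cutoff_in_L1 : in_Lp 1 zeta.
Proof. by case: zetaP => /schwartz_in_L1. Qed.

Let z1 := LP_cutoff_in_L1.
Let mz := in_Lp_meas z1.

Lemma fourier_LP1 xi : eucl_norm xi <= 1 -> fourier zeta xi = 1.
Proof. by case: zetaP => _ _ [U [_ sU]] U1 xi1; apply: U1; apply: sU. Qed.

Lemma fourier_LP0 xi : 2 <= eucl_norm xi -> fourier zeta xi = 0.
Proof.
case: zetaP => _ supp _ xi2; apply/eqP; apply: contraTT xi2 => nz; rewrite -ltNge.
by apply: supp; apply: subset_closure.
Qed.

Lemma eucl_normZ (a : R) (x : V) : 0 <= a -> eucl_norm (a *: x) = a * eucl_norm x.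
Proof.
move=> a0; rewrite /eucl_norm; under eq_bigr do rewrite mxE exprMn.
by rewrite -mulr_sumr sqrtrM ?sqr_ge0// sqrtr_sqr ger0_norm.
Qed.

Lemma cint_LP : cint mu zeta = 1.
Proof.
rewrite -(@fourier_LP1 0); last first.
  rewrite /eucl_norm big1 ?sqrtr0 ?ler01// => i _.
  by rewrite mxE expr0n.
rewrite fourierE; congr (cint mu _); apply/funext => x.
rewrite (_ : dotprod x 0 = 0) ?mulr0 ?oppr0 ?expi0 ?mulr1//.
by apply: big1 => i _; rewrite mxE mulr0.
Qed.

(** For |xi| < 2 the point b xi lies in the unit ball, where the second transform is 1; for |xi| >=
    2 the first one vanishes. So both sides have the same transform. *)
Lemma LP_absorb1 b : 0 < b -> b <= 2^-1 ->
  {ae mu, forall x, convolution zeta (dilate b zeta) x = zeta x}.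
Proof.
move=> b0 b2; have zb : in_Lp 1 (dilate b zeta) by exact: in_L1_dilate.
have zzb : in_Lp 1 (convolution zeta (dilate b zeta)) by exact: in_Lp_convolution.
have : {ae mu, forall x, convolution zeta (dilate b zeta) x - zeta x = 0}.
  apply: fourier_eq0; first exact: in_LpB.
  move=> xi; rewrite fourierB// fourier_convolution// fourier_dilate//.
  have [lt2|ge2] := ltP (eucl_norm xi) 2; last by rewrite fourier_LP0// mul0r subrr.
  rewrite (fourier_LP1 (xi := b *: xi)) ?mulr1 ?subrr//.
  rewrite eucl_normZ ?(ltW b0)//.
  have : b * eucl_norm xi <= 2^-1 * 2.
    by apply: ler_pM => //; [exact: ltW|rewrite /eucl_norm sqrtr_ge0|exact: ltW].
  by rewrite mulVf.
by apply: filterS => x /eqP; rewrite subr_eq0 => /eqP.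
Qed.

Lemma LP_absorb a b : 0 < b -> b <= a / 2 ->
  {ae mu, forall x, convolution (dilate a zeta) (dilate b zeta) x = dilate a zeta x}.
Proof.
move=> b0 ba; have a0 : 0 < a by rewrite -(pmulr_lgt0 _ (x := 2^-1)) ?invr_gt0// (lt_le_trans b0).
have ab : a * (b / a) = b by rewrite mulrC divfK// gt_eqF.
have -> : dilate b zeta = dilate a (dilate (b / a) zeta) by rewrite dilate_dilate ab.
rewrite convolution_dilate//; last exact: cmeasurable_dilate.
apply: ae_dilate => //; apply: LP_absorb1; first by rewrite divr_gt0.
by rewrite ler_pdivrMr// mulrC.
Qed.

End cutoff.

Lemma powR_cvg {R : realType} (a : nat -> R) (l r : R) : 0 < l -> a @ \oo --> l ->
  (a k `^ r) @[k --> \oo] --> l `^ r.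
Proof.
move=> l0 al; have -> : l `^ r = expR (r * ln l) by rewrite /powR gt_eqF.
have c : expR (r * ln (a k)) @[k --> \oo] --> expR (r * ln l).
  apply: continuous_cvg; first exact: continuous_expR.
  apply: cvgMr; apply: continuous_cvg => //; exact: continuous_ln.
apply: cvg_trans c; apply: near_eq_cvg; near=> k.
by rewrite /powR gt_eqF//; near: k; exact: (cvgr_gt l al 0 l0).
Unshelve. all: by end_near. Qed.

(** The integrals are summable, so the series of the [F k] is finite almost everywhere, and its
    terms tend to 0 there. *)
Lemma ae_cvg0 d (T : measurableType d) (R : realType) (m : {measure set T -> \bar R})
    (F : nat -> T -> \bar R) :
  (forall k, measurable_fun [set: T] (F k)) -> (forall k x, 0 <= F k x)%E ->
  (forall k, \int[m]_x F k x <= (1 / (2 ^ k.+1)%:R)%:E)%E ->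
  {ae m, forall x, F ^~ x @ \oo --> 0%E}.
Proof.
move=> mF F0 hF.
have : (\int[m]_x \sum_(k <oo) F k x < +oo)%E.
  rewrite integral_nneseries//; apply: (le_lt_trans _ (ltry 1)).
  apply: le_trans (epsilon_trick0 xpredT ler01).
  by apply: lee_nneseries => [k _ _|k _]; [exact: integral_ge0|exact: hF].
move=> foo; have : {ae m, forall x, (\sum_(k <oo) F k x)%E \is a fin_num}.
  have : m.-integrable setT (fun x => \sum_(k <oo) F k x)%E.
    apply/integrableP; split; first exact: ge0_emeasurable_sum.
    by under eq_integral do rewrite gee0_abs ?nneseries_ge0//.
  by move=> /(integrable_ae measurableT); apply: filterS => x; apply.
apply: filterS => x; rewrite ge0_fin_numE ?nneseries_ge0// => xoo.
have cv := nneseries_tail_cvg xoo (fun k _ => F0 k x).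
apply: (squeeze_cvge _ (cvg_cst _) cv); apply: nearW => k; rewrite F0 /=.
by have := @nneseries_lim_ge _ (F ^~ x) xpredT k k.+1 (fun n _ _ => F0 n x); rewrite big_nat1.
Qed.

Lemma measurable_normc_gt d (T : measurableType d) (R : realType) (h : T -> R[i])
  (t : R) : cmeasurable h -> measurable [set x | (t < normc (h x))%R].
Proof.
move=> mh; rewrite (_ : mkset _ = (fun x => normc (h x)) @^-1` `]t, +oo[).
  by rewrite -[X in measurable X]setTI; apply: (measurable_normc mh).
by rewrite eqEsubset; split=> x; rewrite /= in_itv/= andbT.
Qed.

(** * Recovering a function from its mollifications *)

Section boxes.
Context {R : realType} {n : nat}.
Local Notation V := 'rV[R]_n.
Local Notation mu := (@lebesgue_rV R n).
Implicit Types (f g h w : V -> R[i]) (x y : V) (k m : nat).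

Definition box k : set V := [set x | forall i, `[- k%:R, k%:R]%classic (x ord0 i)].

Lemma boxP k x : box k x <-> forall i, `|x ord0 i| <= k%:R.
Proof. by split=> H i; have := H i; rewrite /= in_itv/= ler_norml. Qed.

Lemma measurable_box k : measurable (box k).
Proof.
rewrite (_ : box k = \bigcap_(i in [set: 'I_n])
    ((fun x : V => x ord0 i) @^-1` `[- k%:R, k%:R])).
  apply: fin_bigcap_measurable => [|i _]; first exact: finite_finset.
  by rewrite -[X in measurable X]setTI; apply: (measurable_coord_rV i).
by rewrite eqEsubset; split=> x /= H i; [move=> _|]; exact: H.
Qed.

Lemma lebesgue_box_lty k : (mu (box k) < +oo)%E.
Proof.
have -> : mu (box k) =
    (\prod_(i < n) lebesgue_measure (`[(- k%:R)%R, k%:R]%classic : set (measurableTypeR R)))%E.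
  exact: (@lebesgue_rV_box R n (fun=> `[- k%:R, k%:R]%classic) (fun=> measurable_itv _)).
suff : (\prod_(i < n) lebesgue_measure (`[(- k%:R)%R, k%:R]%classic : set (measurableTypeR R)))%E \is a fin_num.
  by rewrite fin_numElt => /andP[].
elim/big_ind : _ => // [x y|i _]; first exact: fin_numM.
by rewrite lebesgue_measure_itv/=; case: ifP.
Qed.

Lemma sub_box k m : (k <= m)%N -> box k `<=` box m.
Proof.
by move=> km x /boxP xk; apply/boxP => i; apply: le_trans (xk i) _; rewrite ler_nat.
Qed.

Lemma in_box x : exists m, box m x.
Proof.
exists (Num.bound (\sum_i `|x ord0 i|)); apply/boxP => i.
apply/ltW; apply: le_lt_trans (archi_boundP _); last by apply: sumr_ge0.
by rewrite (bigD1 i)//= lerDl sumr_ge0.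
Qed.

Lemma L1_tail g (e : R) : 0 < e -> in_Lp 1 g ->
  exists m, (\int[mu]_x (\1_(~` box m) x * normc (g x))%:E <= e%:E)%E.
Proof.
move=> e0 /in_LpP[mg]; rewrite Lp_norm1 => goo.
have := ge0_integral_tail (m := mu) (B := box) (u := fun x => normc (g x)) e0 measurable_box.
case=> [x||x|K /(_ K (leqnn K)) HK].
- by have [k kx] := in_box x; exists k => j kj; exact: sub_box kx.
- apply/integrableP; split; first exact: measurable_cnorm.
  by under eq_integral do rewrite gee0_abs ?lee_fin ?normc_ge0//.
- exact: normc_ge0.
by exists K.
Qed.

(** After the substitution y -> e y, a point y of [box m] moves x by at most 1 in each coordinate,
    hence stays where w vanishes. Only the tail of g meets w, which is bounded by T. *)
Lemma absconv_vanishing w g k m (T e : R) : cmeasurable w -> cmeasurable g ->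
  (forall x, normc (w x) <= T) -> (forall x, box k.+1 x -> w x = 0) ->
  0 < e -> e * m%:R <= 1 -> forall x, box k x ->
  (absconv w (dilate e g) x <=
   T%:E * \int[mu]_y (\1_(~` box m) y * normc (g y))%:E)%E.
Proof.
move=> mw mg wT w0 e0 em x kx.
have T0 : 0 <= T by apply: le_trans (wT 0); exact: normc_ge0.
have mwx := cmeasurable_crV x mw; have mge := cmeasurable_dilate e mg.
rewrite /absconv (ge0_integral_scale e0); last 2 first.
- by apply/measurable_EFinP; apply: measurable_funM; apply: measurable_normc.
- by move=> y; rewrite lee_fin mulr_ge0 ?normc_ge0.
have mS : measurable_fun [set: V] (fun y => e *: y) by exact: measurable_rVZ.
have mB : measurable_fun [set: V] (fun y => (\1_(~` box m) y * normc (g y))%:E).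
  apply/measurable_EFinP; apply: measurable_funM; last exact: measurable_normc.
  by apply: measurable_indic; apply: measurableC; exact: measurable_box.
have mA : measurable_fun [set: V]
    (fun y => (normc (w (x - e *: y)) * normc (dilate e g (e *: y)))%:E).
  apply/measurable_EFinP; apply: measurable_funM; apply: measurable_normc.
    exact: (cmeasurable_comp mwx mS).
  exact: (cmeasurable_comp mge mS).
have en0 : 0 < e ^+ n by rewrite exprn_gt0.
rewrite -ge0_integralZl//; last 2 first.
- by move=> y _; rewrite lee_fin mulr_ge0 ?normc_ge0.
- by rewrite lee_fin ltW.
rewrite -ge0_integralZl//; last first.
  by move=> y _; rewrite lee_fin mulr_ge0 ?normc_ge0.
apply: ge0_le_integral => //.
- by move=> y _; rewrite mule_ge0 ?lee_fin ?(ltW en0)// mulr_ge0 ?normc_ge0.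
- exact: measurable_funeM.
- exact: measurable_funeM.
move=> y _; rewrite -!EFinM lee_fin normc_dilate// scalerA mulVf ?gt_eqF// scale1r.
rewrite mulrCA mulrA mulrA mulfK ?gt_eqF// mulrA ler_wpM2r ?normc_ge0//.
rewrite indicE; case: (pselect (box m y)) => ym.
  rewrite w0 ?Normc.normc0 ?mulr_ge0//; apply/boxP => i; rewrite !mxE.
  apply: le_trans (ler_normB _ _) _; rewrite -natr1; apply: lerD.
    exact: (boxP _ _).1 kx i.
  rewrite normrM (gtr0_norm e0); apply: le_trans em.
  by rewrite ler_pM2l//; exact: (boxP _ _).1 ym i.
by rewrite mem_set// mulr1.
Qed.

(** For finite p take T = 1, since |h| <= |h|^p where |h| > 1. For p = +oo take the norm itself,
    which |h| exceeds on a null set only. *)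
Lemma Lp_large_part p h : (1 <= p)%E -> in_Lp p h ->
  exists2 T : R, 0 <= T &
  (\int[mu]_x (\1_[set x | (T < normc (h x))%R] x * normc (h x))%:E < +oo)%E.
Proof.
move=> p1 /in_LpP[mh hoo].
have mA (T : R) : measurable [set x | (T < normc (h x))%R].
  exact: measurable_normc_gt.
have mI (T : R) : measurable_fun setT (fun x => (\1_[set x | (T < normc (h x))%R] x * normc (h x))%:E).
  apply/measurable_EFinP; apply: measurable_funM; last exact: measurable_normc.
  exact: measurable_indic.
case: p p1 hoo => [r r1 hoo|_ hoo|//]; last first.
  exists (fine (Lp_norm +oo h)); first by rewrite fine_ge0// Lp_norm_ge0.
  rewrite (ge0_ae_eq_integral (g := cst 0%E))//; first by rewrite integral0.
    by move=> x _; rewrite lee_fin mulr_ge0 ?normc_ge0.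
  have := ess_sup_ge mu (fun x => (normc (h x))%:E); rewrite -Lp_normy.
  apply: filterS => x hx _; congr EFin; rewrite indicE.
  rewrite memNset ?mul0r//= => /=; apply/negP; rewrite -leNgt -lee_fin fineK//.
  by rewrite ge0_fin_numE ?Lp_norm_ge0.
rewrite lee_fin in r1; have r0 : 0 < r by rewrite (lt_le_trans _ r1).
exists 1 => //.
apply: le_lt_trans (_ : (Lp_norm r%:E h `^ r < +oo)%E); last first.
  by rewrite poweR_lty.
rewrite Lp_norm_powR//; apply: ge0_le_integral => //.
- by move=> x _; rewrite lee_fin mulr_ge0 ?normc_ge0.
- by apply/measurable_EFinP; apply: measurable_powR_comp; exact: measurable_normc.
move=> x _; rewrite lee_fin indicE; case: (ltP 1 (normc (h x))) => hx.
  rewrite mem_set//= mul1r -{1}(powRr1 (normc_ge0 (h x))).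
  by apply: ler_powR => //; exact: ltW.
by rewrite memNset ?mul0r ?powR_ge0//=; apply/negP; rewrite -leNgt.
Qed.

(** Local L^1 convergence, for all p at once. The part [h1] of h where |h| is large or x is near the
    box lies in L^1 and obeys [approximate_identity]; the rest [w] is bounded and vanishes near the
    box, so [absconv_vanishing] applies. *)
Lemma convolution_dilate_cvg_box p h g k (e : R) : (1 <= p)%E -> in_Lp p h ->
  in_Lp 1 g -> cint mu g = 1 -> 0 < e ->
  exists2 e0 : R, 0 < e0 & forall a, 0 < a -> a <= e0 ->
  (\int[mu]_x (\1_(box k) x * normc (convolution h (dilate a g) x - h x))%:E <= e%:E)%E.
Proof.
move=> p1 hp g1 gint e0; have mh := in_Lp_meas hp; have mg := in_Lp_meas g1.
have [T T0 hT] := Lp_large_part p1 hp.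
set L := [set x | (T < normc (h x))%R] in hT.
have mL : measurable L.
  exact: measurable_normc_gt.
have mBk := measurable_box k; have mBk1 := measurable_box k.+1.
have mA : measurable (L `|` box k.+1) by exact: measurableU.
pose h1 x := ((\1_(L `|` box k.+1) x)%:C)%C * h x.
pose w x := h x - h1 x.
have mh1 : cmeasurable h1 by exact: cmeasurable_indic.
have mw : cmeasurable w by exact: cmeasurableB.
have nh1 x : normc (h1 x) = \1_(L `|` box k.+1) x * normc (h x).
  by rewrite normc_realM ger0_norm.
have h1p : in_Lp p h1.
  apply/in_LpP; split=> //; apply: le_lt_trans ((in_LpP _ _).1 hp).2.
  apply: le_Lp_norm => //; apply: aeW => x; rewrite nh1 ler_piMl ?normc_ge0// indicE.
have h11 : in_Lp 1 h1.
  apply/in_LpP; split=> //; rewrite Lp_norm1.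
  (* On [L] the function is integrable by the choice of [T]; on the rest of the box it is at most
     [T], and the box has finite measure. *)
  apply: le_lt_trans (_ : (\int[mu]_x (\1_L x * normc (h x))%:E +
    T%:E * mu (box k.+1) < +oo)%E); last first.
    apply: lte_add_pinfty => //; apply: lte_mul_pinfty => //.
    exact: lebesgue_box_lty.
  have mI1 : measurable_fun setT (fun x => (\1_L x * normc (h x))%:E).
    by apply/measurable_EFinP; apply: measurable_funM => //; exact: measurable_normc.
  have mI2 : measurable_fun setT (fun x => (T * \1_(box k.+1) x)%:E).
    by apply/measurable_EFinP; apply: measurable_funM.
  rewrite -[X in (T%:E * mu X)%E]setIT -integral_indic// -ge0_integralZl//; last first.
    by apply/measurable_EFinP; exact: measurable_indic.
  rewrite -ge0_integralD//; last 2 first.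
  - by move=> x _; rewrite lee_fin mulr_ge0 ?normc_ge0.
  - by move=> x _; rewrite -EFinM lee_fin mulr_ge0.
  apply: ge0_le_integral => //.
  - by move=> x _; rewrite lee_fin normc_ge0.
  - exact: measurable_cnorm.
  - by apply: emeasurable_funD.
  move=> x _; rewrite -EFinM -EFinD lee_fin nh1 !indicE in_setU.
  case: (boolP (x \in L)) => xL /=; first by rewrite lerDl mulr_ge0.
  rewrite mul0r add0r mulrC ler_wpM2r// leNgt; apply/negP => Tx.
  by move/negP : xL; apply; rewrite inE.
have wT x : normc (w x) <= T.
  rewrite /w /h1 indicE in_setU.
  case: (boolP (x \in L)) => xL /=; first by rewrite mul1r subrr Normc.normc0.
  case: (_ \in _) => /=; first by rewrite mul1r subrr Normc.normc0.
  rewrite mul0r subr0 leNgt; apply/negP => Tx.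
  by move/negP : xL; apply; rewrite inE.
have w0 x : box k.+1 x -> w x = 0.
  by move=> xk; rewrite /w /h1 indicE in_setU (mem_set xk) orbT mul1r subrr.
have e2 : 0 < e / 2 by rewrite divr_gt0.
pose c := fine (mu (box k)).
have c0 : 0 <= c by rewrite fine_ge0.
have cE : mu (box k) = c%:E.
  by rewrite fineK// ge0_fin_numE// lebesgue_box_lty.
have [e1 e10 H1] := approximate_identity e2 h11 g1.
(* The tail of g is taken so small that, multiplied by [T] and by the measure [c] of the box, it
   stays below e/2; the 1 keeps the divisor positive. *)
have Tc : 0 < T * c + 1 by rewrite ltr_wpDl// mulr_ge0.
have [m Hm] := L1_tail (divr_gt0 e2 Tc) g1.
exists (Num.min e1 m.+1%:R^-1); first by rewrite lt_min e10 invr_gt0 ltr0Sn.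
move=> a a0; rewrite le_min => /andP[ae1 am].
have am1 : a * m%:R <= 1.
  apply: le_trans (_ : m.+1%:R^-1 * m%:R <= 1).
    by rewrite ler_wpM2r.
  by rewrite mulrC ler_pdivrMr ?ltr0Sn// mul1r ler_nat.
have ga1 := in_L1_dilate a0 g1; have mga := in_Lp_meas ga1.
have mhg := cmeasurable_convolution mh mga.
have mh1g := cmeasurable_convolution mh1 mga.
pose t := T * (e / 2 / (T * c + 1)).
have mI1 : measurable_fun setT
    (fun x => (normc (convolution h1 (dilate a g) x - cint mu g * h1 x))%:E).
  apply: measurable_cnorm; apply: cmeasurableB => //.
  by apply: cmeasurableM => //; exact: cmeasurable_cst.
have t0 : 0 <= t by rewrite mulr_ge0// divr_ge0// ltW.
have mI2 : measurable_fun setT (fun x => (t * \1_(box k) x)%:E).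
  by apply/measurable_EFinP; apply: measurable_funM.
apply: le_trans (_ : _ <= \int[mu]_x ((normc (convolution h1 (dilate a g) x - cint mu g * h1 x))%:E
  + (t * \1_(box k) x)%:E))%E _.
  apply: ae_ge0_le_integral => //.
  - by move=> x _; rewrite lee_fin mulr_ge0 ?normc_ge0.
  - apply/measurable_EFinP; apply: measurable_funM => //.
    by apply: measurable_normc; exact: cmeasurableB.
  - by move=> x _; rewrite -EFinD lee_fin addr_ge0 ?normc_ge0// mulr_ge0.
  - exact: emeasurable_funD.
  have := convolutionBl p1 hp h1p ga1; apply: filterS => x hx _.
  rewrite -EFinD lee_fin gint mul1r indicE.
  case: (boolP (x \in box k)) => xk /=; last by rewrite mul0r mulr0 addr0 normc_ge0.
  rewrite mul1r mulr1; have xk' : box k x by rewrite inE in xk.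
  have -> : convolution h (dilate a g) x - h x =
      (convolution h1 (dilate a g) x - h1 x) + convolution w (dilate a g) x.
    rewrite /w hx; have := w0 x (sub_box (leqnSn k) xk'); rewrite /w => /eqP.
    by rewrite subr_eq0 => /eqP ->; ring.
  apply: le_trans (le_normcD _ _) _; rewrite lerD2l.
  rewrite -lee_fin; apply: le_trans (le_absconv x mw mga) _.
  apply: le_trans (absconv_vanishing mw mg wT w0 a0 am1 xk') _.
  by rewrite /t EFinM lee_wpmul2l.
rewrite ge0_integralD//; last 2 first.
- by move=> x _; rewrite lee_fin normc_ge0.
- by move=> x _; rewrite lee_fin mulr_ge0.
have -> : e%:E = ((e / 2)%:E + (e / 2)%:E)%E by rewrite -EFinD; congr EFin; field.
apply: leeD; first by rewrite -Lp_norm1 H1.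
under eq_integral do rewrite EFinM.
rewrite ge0_integralZl//; last by apply/measurable_EFinP; exact: measurable_indic.
have -> : (\int[mu]_x (\1_(box k) x)%:E = c%:E)%E by rewrite integral_indic// setIT; exact: cE.
rewrite -EFinM lee_fin /t.
have -> : T * (e / 2 / (T * c + 1)) * c = T * c / (T * c + 1) * (e / 2) by ring.
by rewrite ler_piMl ?(ltW e2)// ler_pdivrMr// mul1r lerDl.
Qed.

(** Choose scales whose errors on [box k] are summable: along them the mollifications converge to h
    almost everywhere, as every point lies in all large boxes. The bound passes to the limit by
    Fatou's lemma, or pointwise if p = +oo. *)
Lemma Lp_norm_le_convolution_dilate p h g (M : \bar R) : (1 <= p)%E -> in_Lp p h ->
  in_Lp 1 g -> cint mu g = 1 ->
  (forall J, Lp_norm p (convolution h (dilate (2 ^- J) g)) <= M)%E ->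
  (Lp_norm p h <= M)%E.
Proof.
move=> p1 hp g1 gint hM; have mh := in_Lp_meas hp; have mg := in_Lp_meas g1.
have mu_ J : cmeasurable (convolution h (dilate (2 ^- J) g)).
  by apply: cmeasurable_convolution => //; exact: cmeasurable_dilate.
have /choice[J HJ] (k : nat) : exists J, (\int[mu]_x
    (\1_(box k) x * normc (convolution h (dilate (2 ^- J) g) x - h x))%:E <=
    (1 / (2 ^ k.+1)%:R)%:E)%E.
  have ek : 0 < 1 / (2 ^ k.+1)%:R :> R by rewrite divr_gt0// ltr0n expn_gt0.
  have [e0 e00 H] := convolution_dilate_cvg_box k p1 hp g1 gint ek.
  have [j jH] := ex_half_pow_le e00.
  by exists j; apply: H => //; rewrite invr_gt0 exprn_gt0.
pose u k := convolution h (dilate (2 ^- J k) g).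
pose F k x : \bar R := (\1_(box k) x * normc (u k x - h x))%:E.
have mF k : measurable_fun setT (F k).
  apply/measurable_EFinP; apply: measurable_funM; last first.
    by apply: measurable_normc; apply: cmeasurableB => //; exact: mu_.
  by apply: measurable_indic; exact: measurable_box.
have Fcv : {ae mu, forall x, normc (u k x) @[k --> \oo] --> normc (h x)}.
  have F0 k x : (0 <= F k x)%E by rewrite lee_fin mulr_ge0 ?normc_ge0.
  apply: filterS (ae_cvg0 mF F0 HJ) => x Fx; apply/cvgrPdist_le => e e0.
  have [K HK] := (ecvg0P (fun k => F0 k x)).1 Fx _ e0.
  have [m mx] := in_box x.
  exists (maxn K m) => // k km; have /andP[Kk mk] : (K <= k)%N && (m <= k)%N by rewrite -geq_max.
  have := HK _ Kk; rewrite /F indicE (mem_set (sub_box mk mx)) mul1r lee_fin.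
  apply: le_trans; rewrite ler_norml; apply/andP; split.
    rewrite lerNl opprB lerBlDr -{1}(subrK (h x) (u k x)); exact: le_normcD.
  rewrite lerBlDr -(normcN (u k x - h x)) opprB -{1}(subrK (u k x) (h x)); exact: le_normcD.
have [->|Mfin] := eqVneq M +oo%E; first by rewrite leey.
have M0 : (0 <= M)%E by apply: le_trans (hM 0); exact: Lp_norm_ge0.
have {}Mfin : M \is a fin_num by rewrite ge0_fin_numE// ltey.
case: p p1 hp hM => [r r1 hp hM|_ hp hM|//]; last first.
  rewrite Lp_normy; apply/ess_supP.
  have : {ae mu, forall x, forall k, ((normc (u k x))%:E <= M)%E}.
    apply: ae_foralln => k; apply/ess_supP; rewrite -Lp_normy; exact: hM.
  apply: filterS2 Fcv => x cvx uM; rewrite -(fineK Mfin) lee_fin.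
  rewrite -(cvg_lim _ cvx)//; apply: limr_le; first exact: cvgP cvx.
  apply: nearW => k.
  by rewrite -lee_fin fineK.
rewrite lee_fin in r1; have r0 : 0 < r by rewrite (lt_le_trans _ r1).
apply: (ge0_poweR_le r0) => //; first exact: Lp_norm_ge0.
rewrite Lp_norm_powR//.
have mP f : cmeasurable f -> measurable_fun setT (fun x => (normc (f x) `^ r)%:E).
  by move=> mf; apply/measurable_EFinP; apply: measurable_powR_comp; exact: measurable_normc.
have := @fatou _ _ _ mu setT measurableT (fun k x => (normc (u k x) `^ r)%:E)
  (fun k => mP _ (mu_ _)) (fun k x _ => powR_ge0 _ _).
move=> fat; apply: le_trans (_ : (limn_einf (fun k => \int[mu]_x (normc (u k x) `^ r)%:E) <= _)%E).
  apply: le_trans fat; apply: ae_ge0_le_integral => //.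
  - by move=> x _; rewrite lee_fin powR_ge0.
  - exact: mP.
  - move=> x _; rewrite limn_einf_lim; apply: lime_ge.
      exact: is_cvg_einfs.
    apply: nearW => k; apply: le_ereal_inf_tmp => _ [j _ <-]; by rewrite lee_fin powR_ge0.
  - apply: (emeasurable_fun_cvg (fun k x => einfs (fun j => (normc (u j x) `^ r)%:E) k)).
      by apply: measurable_fun_einfs => k; apply: mP; exact: mu_.
    by move=> x _; rewrite limn_einf_lim; exact: is_cvg_einfs.
  apply: filterS Fcv => x cvx _.
  (* [powR_cvg] requires a positive limit; at the zeros of h the inequality is trivial. *)
  have [->|hx] := eqVneq (h x) 0.
    rewrite Normc.normc0 powR0 ?gt_eqF// limn_einf_lim; apply: lime_ge.
      exact: is_cvg_einfs.
    apply: nearW => k; apply: le_ereal_inf_tmp => _ [j _ <-]; by rewrite lee_fin powR_ge0.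
  have hx0 : 0 < normc (h x) by rewrite lt_neqAle normc_ge0 andbT eq_sym normc_eq0.
  have : (normc (u k x) `^ r)%:E @[k --> \oo] --> (normc (h x) `^ r)%:E.
    have H := powR_cvg (r := r) hx0 cvx.
    by apply/fine_cvgP; split; [exact: nearW|exact: H].
  by move=> /cvg_limn_einf_sup[-> _].
rewrite limn_einf_lim; apply: lime_le; first exact: is_cvg_einfs.
apply: nearW => k; apply: (@le_trans _ _ (Lp_norm r%:E (u k) `^ r)%E).
  by apply: ereal_inf_lbound; exists k; [exact: leqnn|rewrite Lp_norm_powR].
by apply: ge0_le_poweR; [exact: ltW|exact: Lp_norm_ge0|exact: hM].
Qed.

End boxes.

(** The absorption step of both block estimates; it is the finiteness of x that allows half of x to
    be subtracted. *)
Lemma le_absorb_half (R : realType) (x y : \bar R) : (0 <= x)%E -> (x < +oo)%E ->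
  (x <= y + 2^-1%:E * x)%E -> (x <= 2%:E * y)%E.
Proof.
case: x => [x| |]//; case: y => [y| |]// x0 _.
- by rewrite -EFinM -EFinD -EFinM !lee_fin => h; lra.
- by rewrite gt0_muley ?lte_fin// leey.
Qed.

Section Lp_extra.
Context {R : realType} {n : nat}.
Local Notation V := 'rV[R]_n.
Local Notation mu := (@lebesgue_rV R n).
Implicit Types (f g h : V -> R[i]) (p : \bar R).

Lemma convolutionAC p f g h : (1 <= p)%E -> in_Lp p f -> in_Lp 1 g -> in_Lp 1 h ->
  {ae mu, forall x, convolution (convolution f g) h x =
    convolution (convolution f h) g x}.
Proof.
move=> p1 fp g1 h1; apply: filterS2 (convolutionA p1 fp g1 h1) (convolutionA p1 fp h1 g1).
by move=> x -> ->; rewrite (convolutionC (in_Lp_meas g1) (in_Lp_meas h1)).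
Qed.

Lemma Lp_norm1Z (c : R[i]) f : cmeasurable f ->
  Lp_norm 1 (fun x => c * f x) = ((normc c)%:E * Lp_norm 1 f)%E.
Proof.
move=> mf; rewrite !Lp_norm1 -ge0_integralZl//.
- by apply: eq_integral => x _; rewrite Normc.normcM EFinM.
- exact: measurable_cnorm.
- by move=> x _; rewrite lee_fin normc_ge0.
- by rewrite lee_fin normc_ge0.
Qed.

Lemma in_L1Z (c : R[i]) f : in_Lp 1 f -> in_Lp 1 (fun x => c * f x).
Proof. by move=> /in_L1P f1; apply/in_L1P; exact: cintegrableZ. Qed.

Lemma convolutionZl (c : R[i]) f g : in_Lp 1 f -> in_Lp 1 g ->
  {ae mu, forall x, convolution (fun y => c * f y) g x = c * convolution f g x}.
Proof.
move=> f1 g1; apply: filterS (ae_convolution_cintegrable (lexx _) f1 g1) => x cx.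
rewrite /convolution -[LHS]/(cint mu _) -[X in _ * X]/(cint mu _) -cintZ//.
by congr (cint mu _); apply/funext => y; rewrite mulrA.
Qed.

Lemma Lp_norm_lty p f : in_Lp p f -> (Lp_norm p f < +oo)%E.
Proof. by case. Qed.

Lemma dilate_div (e s : R) g : e != 0 -> dilate s g = dilate e (dilate (s / e) g).
Proof. by move=> e0; rewrite dilate_dilate mulrC divfK. Qed.

Lemma dilate_convolution_sub g h (s e : R) : 0 < s -> 0 < e -> in_Lp 1 g -> in_Lp 1 h ->
  Lp_norm 1 (fun x => dilate s g x - convolution (dilate s g) (dilate e h) x) =
  Lp_norm 1 (fun x => g x - convolution g (dilate (e / s) h) x).
Proof.
move=> s0 e0 g1 h1; have es0 : 0 < e / s by rewrite divr_gt0.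
rewrite (@dilate_div s e) ?gt_eqF//.
have mg := in_Lp_meas g1.
have mh : cmeasurable (dilate (e / s) h) by apply: cmeasurable_dilate; exact: in_Lp_meas h1.
rewrite convolution_dilate//.
have := @dilateB R n s g (convolution g (dilate (e / s) h)) => <-.
by rewrite Lp_norm1_dilate//; apply: cmeasurableB => //; exact: cmeasurable_convolution.
Qed.

End Lp_extra.

(** * Littlewood-Paley kernels *)

Section LP_kernel.
Context {R : realType} {n : nat} (zeta : 'rV[R]_n -> R[i]).
Hypothesis zetaP : LP_cutoff zeta.
Local Notation V := 'rV[R]_n.
Local Notation mu := (@lebesgue_rV R n).
Implicit Types (f g h : V -> R[i]) (p : \bar R) (j : nat).

Let z1 := LP_cutoff_in_L1 zetaP.
Let mz := in_Lp_meas z1.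

Let zd1 (a : R) : 0 < a -> in_Lp 1 (dilate a zeta).
Proof. by move=> a0; exact: in_L1_dilate. Qed.

Definition LP_kernel j : V -> R[i] :=
  if j is j'.+1 then dilate (2 ^- j') (LP_phi zeta) else zeta.

Lemma LP_blockE f j : LP_block zeta f j = convolution f (LP_kernel j).
Proof. by case: j. Qed.

Let pow0 j : 0 < 2 ^- j :> R.
Proof. by rewrite invr_gt0 exprn_gt0. Qed.

Lemma LP_kernelS j : LP_kernel j.+1 =
  fun x => dilate (2 ^- j.+1) zeta x - dilate (2 ^- j) zeta x.
Proof.
rewrite /LP_kernel /LP_phi.
have := @dilateB R n (2 ^- j) (dilate 2^-1 zeta) zeta.
rewrite dilate_dilate -invfM -exprSr => <-.
by [].
Qed.

Lemma in_L1_LP_kernel j : in_Lp 1 (LP_kernel j).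
Proof. by case: j => [//|j]; rewrite LP_kernelS; apply: in_LpB => //; exact: zd1. Qed.

Let K1 := in_L1_LP_kernel.
Let mK j := in_Lp_meas (K1 j).

Lemma Lp_norm_LP_kernel j : (Lp_norm 1 (LP_kernel j) <= Lp_norm 1 zeta + Lp_norm 1 zeta)%E.
Proof.
case: j => [|j]; first by rewrite /= leeDl// Lp_norm_ge0.
rewrite LP_kernelS; apply: le_trans (Lp_norm_triangleB (lexx _) _ _) _;
  rewrite ?Lp_norm1_dilate//; exact: in_Lp_meas (zd1 _).
Qed.

Lemma LP_kernel_absorb j (b : R) : 0 < b -> b <= 2 ^- j.+1 ->
  {ae mu, forall x, convolution (LP_kernel j) (dilate b zeta) x = LP_kernel j x}.
Proof.
move=> b0; case: j => [|j] bj.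
  by apply: LP_absorb1 => //; rewrite expr1 in bj.
rewrite LP_kernelS.
apply: filterS3 (convolutionBl (lexx _) (zd1 (pow0 j.+1)) (zd1 (pow0 j)) (zd1 b0))
  (LP_absorb zetaP (a := 2 ^- j.+1) b0 _) (LP_absorb zetaP (a := 2 ^- j) b0 _).
- by move=> x -> -> ->.
- by rewrite -invfM -exprSr.
- apply: le_trans bj _; rewrite -invfM -exprSr lef_pV2 ?posrE ?exprn_gt0//.
  by rewrite ler_eXn2l ?ltr1n.
Qed.

(** The two dilates forming the kernel both have scale at most 1/2, so each of them reproduces
    zeta. *)
Lemma convolution_LP_kernel j : (2 <= j)%N ->
  {ae mu, forall x, convolution zeta (LP_kernel j) x = 0}.
Proof.
case: j => [|[|j]]// _; rewrite LP_kernelS.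
have h k : 2 ^- k.+1 <= 2^-1 :> R.
  by rewrite lef_pV2 ?posrE ?exprn_gt0// exprS ler_peMr// exprn_ege1// ler1n.
apply: filterS3 (convolutionBr (lexx _) z1 (zd1 (pow0 j.+2)) (zd1 (pow0 j.+1)))
  (LP_absorb1 zetaP (pow0 j.+2) (h _)) (LP_absorb1 zetaP (pow0 j.+1) (h _)).
by move=> x -> -> ->; rewrite subrr.
Qed.

(** By [LP_kernelS] the kernels telescope to the dilate of zeta at scale 2^-J. *)
Lemma Lp_norm_LP_sum p h J : (1 <= p)%E -> in_Lp p h ->
  (Lp_norm p (convolution h (dilate (2 ^- J) zeta)) <=
   \sum_(0 <= j < J.+1) Lp_norm p (convolution h (LP_kernel j)))%E.
Proof.
move=> p1 hp; have mh := in_Lp_meas hp; elim: J => [|J IH].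
  by rewrite big_nat1 /= expr0 invr1 dilate1.
rewrite big_nat_recr//=; apply: le_trans (leeD IH (lexx _)).
rewrite -/(LP_kernel J.+1).
have mc J' : cmeasurable (convolution h (dilate (2 ^- J') zeta)).
  by apply: cmeasurable_convolution => //; exact: in_Lp_meas (zd1 _).
have mcK : cmeasurable (convolution h (LP_kernel J.+1)) by exact: cmeasurable_convolution.
apply: le_trans (Lp_norm_triangle p1 (mc J) mcK).
apply: eq_leW; apply: eq_Lp_norm => //.
  exact: cmeasurableD.
rewrite LP_kernelS.
apply: filterS (convolutionBr p1 hp (zd1 (pow0 J.+1)) (zd1 (pow0 J))) => x ->.
by rewrite addrC subrK.
Qed.

Lemma Lp_norm_le_LP p h : (1 <= p)%E -> in_Lp p h ->
  (Lp_norm p h <= \sum_(0 <= j <oo) Lp_norm p (convolution h (LP_kernel j)))%E.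
Proof.
move=> p1 hp; apply: (Lp_norm_le_convolution_dilate p1 hp z1 (cint_LP zetaP)) => J.
apply: le_trans (Lp_norm_LP_sum J p1 hp) _.
by apply: nneseries_lim_ge => j _ _; exact: Lp_norm_ge0.
Qed.

(** Its transform at xi is that of zeta at xi/4 minus that at 2 xi, hence 1 for 1 <= |xi| <= 4, a
    region that contains the support of the transform of [LP_phi]. *)
Definition LP_fat : V -> R[i] := fun x => dilate 4^-1 zeta x - dilate 2 zeta x.

Lemma in_L1_LP_fat : in_Lp 1 LP_fat.
Proof. by apply: in_LpB => //; exact: zd1. Qed.

Lemma cint_LP_fat : cint mu LP_fat = 0.
Proof.
rewrite cintB; [|exact/in_L1P/zd1|exact/in_L1P/zd1].
by rewrite !cint_dilate// subrr.
Qed.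

(** Scaling reduces to [LP_phi]. The dilate at scale 1/4 reproduces both terms of [LP_phi]; each of
    these reproduces the dilate at scale 2, so the two contributions of the latter cancel. *)
Lemma LP_kernel_fat j : {ae mu, forall x,
  convolution (LP_kernel j.+1) (dilate (2 ^- j) LP_fat) x = LP_kernel j.+1 x}.
Proof.
have m1 : cmeasurable (LP_phi zeta) by exact: cmeasurableB (in_Lp_meas (zd1 _)) mz.
rewrite convolution_dilate//; last exact: in_Lp_meas in_L1_LP_fat.
apply: ae_dilate => //.
have phi1 : in_Lp 1 (LP_phi zeta) by apply: in_LpB => //; exact: zd1.
have half0 : 0 < 2^-1 :> R by [].
have z21 : in_Lp 1 (dilate 2 zeta) by exact: zd1.
have z41 : in_Lp 1 (dilate 4^-1 zeta) by exact: zd1.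
have zh1 : in_Lp 1 (dilate 2^-1 zeta) by exact: zd1.
have e1 : 4^-1 <= 2^-1 / 2 :> R by lra.
have e2 : 4^-1 <= 2^-1 :> R by lra.
have e3 : 2^-1 <= 2 / 2 :> R by lra.
have e4 : 1 <= 2 / 2 :> R by lra.
have q0 : 0 < 4^-1 :> R by [].
have a1 := LP_absorb zetaP q0 e1.
have a2 := LP_absorb1 zetaP q0 e2.
have a3 := LP_absorb zetaP half0 e3.
have a4 := LP_absorb zetaP ltr01 e4.
rewrite dilate1 in a4.
have b0 := convolutionBr (lexx _) phi1 z41 z21.
have b1 := convolutionBl (lexx _) zh1 z1 z41.
have b2 := convolutionBl (lexx _) zh1 z1 z21.
apply: filterS2 (filterI a1 (filterI a2 (filterI a3 a4))) (filterI b0 (filterI b1 b2)).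
move=> x [h1 [h2 [h3 h4]]] [h5 [h6 h7]].
rewrite /LP_fat h5 (h6 : convolution (LP_phi zeta) _ x = _) h1 h2.
rewrite (h7 : convolution (LP_phi zeta) _ x = _).
rewrite (convolutionC (in_Lp_meas zh1) (in_Lp_meas z21)) h3.
by rewrite (convolutionC mz (in_Lp_meas z21)) h4 subrr subr0.
Qed.

Section rho.
Variable rho : V -> R[i].
Hypothesis rho1 : in_Lp 1 rho.
Variable p : \bar R.
Hypothesis p1 : (1 <= p)%E.

Let r1 (e : R) : 0 < e -> in_Lp 1 (dilate e rho).
Proof. by move=> e0; exact: in_L1_dilate. Qed.

Definition mollif_err (e : R) f : V -> R[i] := fun x => f x - convolution f (dilate e rho) x.

Lemma in_Lp_mollif_err (e : R) f : 0 < e -> in_Lp p f -> in_Lp p (mollif_err e f).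
Proof.
by move=> e0 fp; apply: in_LpB => //; apply: in_Lp_convolution => //; exact: r1.
Qed.

Lemma convolution_mollif_err (e : R) f g : 0 < e -> in_Lp p f -> in_Lp 1 g ->
  {ae mu, forall x, convolution (mollif_err e f) g x = mollif_err e (convolution f g) x}.
Proof.
move=> e0 fp g1; have fr := in_Lp_convolution p1 fp (r1 e0).
apply: filterS2 (convolutionBl p1 fp fr g1) (convolutionAC p1 fp (r1 e0) g1).
by move=> x -> ->.
Qed.

Lemma Lp_norm_convolution_mollif_err (e : R) f g : 0 < e -> in_Lp p f -> in_Lp 1 g ->
  Lp_norm p (convolution (mollif_err e f) g) = Lp_norm p (mollif_err e (convolution f g)).
Proof.
move=> e0 fp g1; have fg := in_Lp_convolution p1 fp g1.
have fe := in_Lp_mollif_err e0 fp.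
apply: eq_Lp_norm => //.
- exact: in_Lp_meas (in_Lp_convolution p1 fe g1).
- exact: in_Lp_meas (in_Lp_mollif_err e0 fg).
- exact: convolution_mollif_err.
Qed.

Lemma Lp_norm_mollif_err (e : R) f : 0 < e -> in_Lp p f ->
  (Lp_norm p (mollif_err e f) <= (1 + Lp_norm 1 rho) * Lp_norm p f)%E.
Proof.
move=> e0 fp; have mr := in_Lp_meas (r1 e0).
apply: le_trans (Lp_norm_triangleB p1 (in_Lp_meas fp) _) _.
  exact: in_Lp_meas (in_Lp_convolution p1 fp (r1 e0)).
rewrite ge0_muleDl ?Lp_norm_ge0// mul1e leeD2l// muleC.
rewrite -(Lp_norm1_dilate e0 (in_Lp_meas rho1)).
exact: Lp_norm_convolution (in_Lp_meas fp) _.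
Qed.

(** The factor 2 comes from [le_absorb_half], and the sum of norms of zeta from the kernel that
    turns the error of f into that of its block. *)
Lemma LP_block_lower : exists2 d : R, 0 < d & forall j (e : R) f, 0 < e ->
  2 ^- j <= d * e -> in_Lp p f ->
  (Lp_norm p (LP_block zeta f j.+1) <=
   2%:E * ((Lp_norm 1 zeta + Lp_norm 1 zeta) * Lp_norm p (mollif_err e f)))%E.
Proof.
have h0 : 0 < 2^-1 :> R by [].
(* Here rho is the function being mollified and [LP_fat] the mollifier: its integral is 0, so the
   mollifications of rho tend to 0. Rescaling by e reduces [th] and [dilate e rho] to this case,
   with d independent of j, e and f. *)
have [d d0 Hd] := approximate_identity h0 rho1 in_L1_LP_fat.
exists d => // j e f e0 jde fp; rewrite LP_blockE.
set K := LP_kernel j.+1; set fj := convolution f K.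
have fjp : in_Lp p fj by exact: (in_Lp_convolution p1 fp (K1 _)).
have mf := in_Lp_meas fp.
pose th : V -> R[i] := dilate (2 ^- j) LP_fat.
have th1 : in_Lp 1 th by exact: in_L1_dilate in_L1_LP_fat.
have fjth : {ae mu, forall x, convolution fj th x = fj x}.
  apply: filterS (convolutionA p1 fp (K1 j.+1) th1) => x ->.
  rewrite (ae_eq_convolutionr mf _ _ (LP_kernel_fat j))//.
  by exact: in_Lp_meas (in_Lp_convolution _ (K1 j.+1) th1).
have small : (Lp_norm p (convolution fj (dilate e rho)) <= 2^-1%:E * Lp_norm p fj)%E.
  have E1 := ae_eq_convolutionl (in_Lp_meas (in_Lp_convolution p1 fjp th1))
    (in_Lp_meas (r1 e0)) (in_Lp_meas fjp) fjth.
  rewrite -E1.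
  have tr1 := in_Lp_convolution (lexx _) th1 (r1 e0).
  rewrite (eq_Lp_norm p1 _ _ (convolutionA p1 fjp th1 (r1 e0))); last 2 first.
  - exact: in_Lp_meas (in_Lp_convolution p1 (in_Lp_convolution p1 fjp th1) (r1 e0)).
  - exact: in_Lp_meas (in_Lp_convolution p1 fjp tr1).
  apply: le_trans (Lp_norm_convolution p1 (in_Lp_meas fjp) (in_Lp_meas tr1)) _.
  rewrite muleC; apply: lee_wpmul2r; first exact: Lp_norm_ge0.
  have -> : th = dilate e (dilate (2 ^- j / e) LP_fat) by apply: dilate_div; rewrite gt_eqF.
  have je0 : 0 < 2 ^- j / e by rewrite divr_gt0.
  have mt : cmeasurable (dilate (2 ^- j / e) LP_fat).
    exact: in_Lp_meas (in_L1_dilate je0 in_L1_LP_fat).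
  have mr := in_Lp_meas rho1.
  rewrite (convolution_dilate e0 mt mr) (Lp_norm1_dilate e0 (cmeasurable_convolution mt mr)).
  rewrite (convolutionC mt mr).
  have je : 2 ^- j / e <= d by rewrite ler_pdivrMr.
  have := Hd _ je0 je; rewrite cint_LP_fat.
  by under [fun x => _]funext do rewrite mul0r subr0.
apply: le_absorb_half; first exact: Lp_norm_ge0.
  exact: Lp_norm_lty.
have efp := in_Lp_mollif_err e0 fp.
apply: le_trans (_ : _ <= Lp_norm p (mollif_err e fj) + Lp_norm p (convolution fj (dilate e rho)))%E _.
  have mfr := in_Lp_meas (in_Lp_convolution p1 fjp (r1 e0)).
  apply: le_trans (Lp_norm_triangle p1 (in_Lp_meas (in_Lp_mollif_err e0 fjp)) mfr).
  apply: eq_leW; congr Lp_norm.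
  by apply/funext => x; rewrite /mollif_err subrK.
apply: leeD => //; rewrite -(Lp_norm_convolution_mollif_err e0 fp (K1 j.+1)).
apply: le_trans (Lp_norm_convolution p1 (in_Lp_meas efp) (mK _)) _.
rewrite muleC; apply: lee_wpmul2r; first exact: Lp_norm_ge0.
exact: Lp_norm_LP_kernel.
Qed.

(** With es the dilate of eta at scale s, the error is moved from the block to eta: g * es = f_j *
    (es - es * rho_e). The time t is free above a threshold, which is what permits favourable values
    of t later. *)
Lemma LP_block_upper eta : in_Lp 1 eta -> cint mu eta = 1 ->
  exists2 d : R, 0 < d & forall j (e t : R) f, 0 < e -> 0 < t ->
  e * 2 ^+ j.+1 <= d * t -> in_Lp p f ->
  (Lp_norm p (convolution (mollif_err e f) (LP_kernel j)) <=
   2%:E * (Lp_norm p (LP_block zeta f j) *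
     Lp_norm 1 (fun x => eta x - convolution eta (dilate t rho) x)%R))%E.
Proof.
move=> eta1 etaint; have h0 : 0 < 2^-1 :> R by [].
have [d d0 Hd] := approximate_identity h0 z1 eta1.
exists d => // j e t f e0 t0 jdt fp; rewrite LP_blockE.
set K := LP_kernel j; set fj := convolution f K.
have fjp : in_Lp p fj by exact: (in_Lp_convolution p1 fp (K1 _)).
have mf := in_Lp_meas fp.
have efp := in_Lp_mollif_err e0 fp.
set g := convolution (mollif_err e f) K.
have gp : in_Lp p g by exact: (in_Lp_convolution p1 efp (K1 _)).
have mg := in_Lp_meas gp.
pose r : R := 2 ^- j.+1.
(* With this scale e/s = t, so the rescaled kernel has exactly the norm of eta - eta * rho_t; the
   assumption on t says that s <= d r. *)
pose s := e / t.
have s0 : 0 < s by rewrite divr_gt0.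
have r0 : 0 < r by exact: pow0.
have sr : s / r <= d.
  by rewrite /s /r invrK mulrAC ler_pdivrMr.
have sr0 : 0 < s / r by rewrite divr_gt0.
pose zr := dilate r zeta; pose es := dilate s eta.
have zr1 : in_Lp 1 zr by exact: zd1.
have es1 : in_Lp 1 es by exact: in_L1_dilate.
have gz : {ae mu, forall x, convolution g zr x = g x}.
  apply: filterS (convolutionA p1 efp (K1 j) zr1) => x ->.
  rewrite (ae_eq_convolutionr (in_Lp_meas efp) _ _ (LP_kernel_absorb (j := j) r0 (lexx _)))//.
  by exact: in_Lp_meas (in_Lp_convolution _ (K1 j) zr1).
have zes1 : in_Lp 1 (convolution zr es) by exact: in_Lp_convolution.
have D1 : in_Lp 1 (fun x => convolution zr es x - zr x) by exact: in_LpB.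
have small : (Lp_norm 1 (fun x => (convolution zr es x - zr x)%R) <= 2^-1%:E)%E.
  have esE : es = dilate r (dilate (s / r) eta).
    by apply: dilate_div; rewrite gt_eqF.
  have mE : cmeasurable (dilate (s / r) eta) by exact: in_Lp_meas (in_L1_dilate sr0 eta1).
  rewrite esE convolution_dilate//.
  have := @dilateB R n r (convolution zeta (dilate (s / r) eta)) zeta => <-.
  rewrite Lp_norm1_dilate//; last first.
    by apply: cmeasurableB => //; exact: cmeasurable_convolution.
  have := Hd _ sr0 sr; rewrite etaint.
  by under [fun x => _]funext do rewrite mul1r.
have geta : (Lp_norm p (convolution g es) <= Lp_norm p fj *
    Lp_norm 1 (fun x => eta x - convolution eta (dilate t rho) x)%R)%E.
  have E1 : {ae mu, forall x, convolution g es x =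
      convolution fj (fun x => es x - convolution es (dilate e rho) x) x}.
    have re1 := r1 e0; have fjr := in_Lp_convolution p1 fjp re1.
    have er1 : in_Lp 1 (convolution es (dilate e rho)) by exact: in_Lp_convolution.
    have mer := in_Lp_mollif_err e0 fjp.
    have E0 := ae_eq_convolutionl mg (in_Lp_meas es1) (in_Lp_meas mer)
      (convolution_mollif_err e0 fp (K1 j)).
    rewrite [convolution g es]E0.
    apply: filterS3 (convolutionBl p1 fjp fjr es1) (convolutionA p1 fjp re1 es1)
      (convolutionBr p1 fjp es1 er1).
    move=> x h1 h2 h3; rewrite h3 -(convolutionC (in_Lp_meas re1) (in_Lp_meas es1)) -h2.
    exact: h1.
  have er1 : in_Lp 1 (fun x => es x - convolution es (dilate e rho) x).
    by apply: in_LpB => //; apply: in_Lp_convolution => //; exact: r1.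
  rewrite (eq_Lp_norm p1 _ _ E1); last 2 first.
  - exact: in_Lp_meas (in_Lp_convolution p1 gp es1).
  - exact: in_Lp_meas (in_Lp_convolution p1 fjp er1).
  apply: le_trans (Lp_norm_convolution p1 (in_Lp_meas fjp) (in_Lp_meas er1)) _.
  rewrite (dilate_convolution_sub s0 e0 eta1 rho1).
  suff -> : e / s = t by [].
  by rewrite /s invf_div mulrCA divff ?mulr1// gt_eqF.
apply: le_absorb_half; first exact: Lp_norm_ge0.
  exact: Lp_norm_lty.
have gzp : in_Lp p (convolution g zr) by exact: in_Lp_convolution.
have gzep : in_Lp p (convolution g (convolution zr es)) by exact: in_Lp_convolution.
have gDp := in_Lp_convolution p1 gp D1.
rewrite -(eq_Lp_norm p1 (in_Lp_meas gzp) mg gz).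
apply: le_trans (_ : _ <= Lp_norm p (convolution g (convolution zr es)) +
  Lp_norm p (convolution g (fun x => convolution zr es x - zr x)%R))%E _.
  apply: le_trans (Lp_norm_triangleB p1 (in_Lp_meas gzep) (in_Lp_meas gDp)).
  apply: eq_leW; apply: eq_Lp_norm => //.
  - exact: in_Lp_meas gzp.
  - by apply: cmeasurableB; [exact: in_Lp_meas gzep|exact: in_Lp_meas gDp].
  by apply: filterS (convolutionBr p1 gp zes1 zr1) => x ->; rewrite subKr.
apply: leeD.
  rewrite -(eq_Lp_norm p1 _ _ (convolutionA p1 gp zr1 es1)); last 2 first.
  - exact: in_Lp_meas (in_Lp_convolution p1 gzp es1).
  - exact: in_Lp_meas gzep.
  by rewrite (ae_eq_convolutionl (in_Lp_meas gzp) (in_Lp_meas es1) mg gz).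
rewrite (eq_Lp_norm p1 (in_Lp_meas gzp) mg gz).
apply: le_trans (Lp_norm_convolution p1 mg (in_Lp_meas D1)) _.
by rewrite muleC lee_wpmul2r ?Lp_norm_ge0.
Qed.

End rho.

End LP_kernel.

(* [ge0_le_integral] without the measurability assumptions, which are not
   available for [fun e => Lp_norm p (f \- convolution f (dilate e rho))]. *)
Lemma ge0_le_integral_nonmeasurable d (T : measurableType d) (R : realType)
    (m : {measure set T -> \bar R}) (D : set T) (f g : T -> \bar R) :
  (forall x, D x -> 0 <= f x)%E -> (forall x, D x -> f x <= g x)%E ->
  (\int[m]_(x in D) f x <= \int[m]_(x in D) g x)%E.
Proof.
move=> f0 fg; rewrite !ge0_integralE//; last first.
  by move=> x Dx; exact: le_trans (f0 x Dx) (fg x Dx).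
apply: ge_ereal_sup => _ [h hf <-]; apply: ereal_sup_ubound; exists h => // x.
apply: le_trans (hf x) _; rewrite /patch; case: ifPn => // /set_mem; exact: fg.
Qed.

(** * Dyadic decomposition of ]0, 1[ and Schur's test *)

Section series.
Context {R : realType}.
Implicit Types (w u v b : nat -> \bar R) (k j : nat).
Local Open Scope ereal_scope.

Lemma ge0_nneseries_single (w : nat -> \bar R) k : (forall j, 0 <= w j) ->
  (forall j, j != k -> w j = 0) -> \sum_(j <oo) w j = w k.
Proof.
move=> w0 wk; rewrite (@nneseriesD1 _ _ k)// eseries0 ?adde0// => j _ /=; exact: wk.
Qed.

Lemma nneseries_convl w k : (forall j, 0 <= w j) ->
  \sum_(j <oo) (if (j <= k)%N then w (k - j)%N else 0) <= \sum_(j <oo) w j.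
Proof.
move=> w0; rewrite (nneseries_split 0 k.+1); last by move=> j _; case: ifP.
rewrite [X in _ + X]eseries0 ?adde0; last by move=> j jk _; rewrite leqNgt jk.
rewrite add0n big_nat_rev/= add0n.
rewrite (eq_big_nat _ _ (F2 := w)); last first.
  by move=> j /= jk; rewrite subSS leq_subr subKn.
exact: nneseries_lim_ge.
Qed.

Lemma nneseries_convr w k : (forall j, 0 <= w j) ->
  \sum_(j <oo) (if (k <= j)%N then w (j - k)%N else 0) = \sum_(j <oo) w j.
Proof.
move=> w0; rewrite (nneseries_split 0 k); last by move=> j _; case: ifP.
rewrite add0n big_nat big1 ?add0e; last by move=> j /= jk; rewrite leqNgt jk.
rewrite -nneseries_addn; last by move=> j; case: ifP.
by apply: eq_eseriesr => j _; rewrite leq_addl addnK.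
Qed.

(* A kernel which only depends on [k - j]: [w] for the nonnegative differences, [v]
   for the negative ones. *)
Definition toeplitz w v k j : \bar R :=
  if (j <= k)%N then w (k - j)%N else v (j - k)%N.

Lemma toeplitz_ge0 w v k j : (forall i, 0 <= w i) -> (forall i, 0 <= v i) ->
  0 <= toeplitz w v k j.
Proof. by move=> w0 v0; rewrite /toeplitz; case: ifP. Qed.

Lemma toeplitz_le w v k j : (forall i, 0 <= w i) -> (forall i, 0 <= v i) ->
  toeplitz w v k j <= (if (j <= k)%N then w (k - j)%N else 0) +
    (if (k <= j)%N then v (j - k)%N else 0).
Proof.
move=> w0 v0; rewrite /toeplitz; case: (leqP j k) => [jk|/ltnW ->]; last by rewrite add0e.
by rewrite leeDl//; case: ifP.
Qed.

Lemma toeplitz_row w v k : (forall i, 0 <= w i) -> (forall i, 0 <= v i) ->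
  \sum_(j <oo) toeplitz w v k j <= \sum_(i <oo) w i + \sum_(i <oo) v i.
Proof.
move=> w0 v0.
apply: le_trans (_ : _ <= \sum_(j <oo) ((if (j <= k)%N then w (k - j)%N else 0) +
    (if (k <= j)%N then v (j - k)%N else 0))) _.
  by apply: lee_nneseries => [j _ _|j _]; [exact: toeplitz_ge0|exact: toeplitz_le].
rewrite nneseriesD; [|by move=> j _ _; case: ifP|by move=> j _ _; case: ifP].
by apply: leeD; [exact: nneseries_convl|rewrite nneseries_convr].
Qed.

Lemma toeplitz_col w v j : (forall i, 0 <= w i) -> (forall i, 0 <= v i) ->
  \sum_(k <oo) toeplitz w v k j <= \sum_(i <oo) w i + \sum_(i <oo) v i.
Proof.
move=> w0 v0.
apply: le_trans (_ : _ <= \sum_(k <oo) ((if (j <= k)%N then w (k - j)%N else 0) +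
    (if (k <= j)%N then v (j - k)%N else 0))) _.
  by apply: lee_nneseries => [k _ _|k _]; [exact: toeplitz_ge0|exact: toeplitz_le].
rewrite nneseriesD; [|by move=> k _ _; case: ifP|by move=> k _ _; case: ifP].
by apply: leeD; [rewrite nneseries_convr|exact: nneseries_convl].
Qed.

Lemma ge0_hoelder_series (b d : nat -> R) (q : R) : (1 <= q)%R ->
  (forall j, 0 <= b j)%R -> (forall j, 0 <= d j)%R ->
  (\sum_(j <oo) (b j * d j)%:E) `^ q <=
  (\sum_(j <oo) (b j `^ q * d j)%:E) * (\sum_(j <oo) (d j)%:E) `^ (q - 1).
Proof.
move=> q1 b0 d0; have E (a : nat -> R) : (forall j, 0 <= a j)%R ->
    \int[@counting nat R]_j (a j)%:E = \sum_(j <oo) (a j)%:E.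
  by move=> a0; rewrite ge0_integral_count// => j; rewrite lee_fin.
have := @ge0_hoelder_weight _ _ _ (@counting nat R) b d q q1 (fun _ _ _ => I) (fun _ _ _ => I) b0 d0.
by rewrite !E// => j; rewrite mulr_ge0// powR_ge0.
Qed.

(** Hoelder's inequality in j with the weights [D k j], then an exchange of the sums. The rows give
    the factor S^(q-1), the columns the factor S. *)
Lemma schur_series (b : nat -> R) (D : nat -> nat -> R) (q S : R) : (1 <= q)%R ->
  (forall j, 0 <= b j)%R -> (forall k j, 0 <= D k j)%R -> (0 <= S)%R ->
  (forall k, \sum_(j <oo) (D k j)%:E <= S%:E) ->
  (forall j, \sum_(k <oo) (D k j)%:E <= S%:E) ->
  \sum_(k <oo) (\sum_(j <oo) (b j * D k j)%:E) `^ q <=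
  (S `^ (q - 1) * S)%:E * \sum_(j <oo) (b j `^ q)%:E.
Proof.
move=> q1 b0 D0 S0 Srow Scol.
have bD0 k j : 0 <= (b j `^ q * D k j)%:E by rewrite lee_fin mulr_ge0// powR_ge0.
apply: le_trans (_ : _ <= \sum_(k <oo)
    ((S `^ (q - 1))%:E * \sum_(j <oo) (b j `^ q * D k j)%:E)) _.
  apply: lee_nneseries => [k _ _|k _]; first exact: poweR_ge0.
  apply: le_trans (ge0_hoelder_series q1 b0 (D0 k)) _.
  rewrite muleC; apply: lee_wpmul2r; first by apply: nneseries_ge0.
  rewrite -poweR_EFin; apply: ge0_le_poweR; [by rewrite subr_ge0| |exact: Srow].
  by apply: nneseries_ge0 => j _ _; rewrite lee_fin.
rewrite nneseriesZl; last by move=> k _; apply: nneseries_ge0.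
rewrite EFinM -muleA; apply: lee_wpmul2l; first by rewrite lee_fin powR_ge0.
rewrite nneseries_interchange//.
rewrite -nneseriesZl; last by move=> j _; rewrite lee_fin powR_ge0.
apply: lee_nneseries => [j _ _|j _]; first exact: nneseries_ge0.
under eq_eseriesr do rewrite EFinM.
rewrite nneseriesZl; last by move=> k _; rewrite lee_fin.
by rewrite muleC; apply: lee_wpmul2r => //; rewrite lee_fin powR_ge0.
Qed.

End series.

Section dyadic.
Context {R : realType}.
Local Notation leb := (@lebesgue_measure R).
Implicit Types (k : nat) (t e : R).

Definition dyadic k : set R := `[2 ^- k.+1, 2 ^- k[%classic.

Lemma dyadicP k e : dyadic k e <-> 2 ^- k.+1 <= e < 2 ^- k.
Proof. by rewrite /dyadic /= in_itv. Qed.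

Let pow0 k : 0 < 2 ^- k :> R.
Proof. by rewrite invr_gt0 exprn_gt0. Qed.

Let pow_le k j : (k <= j)%N -> 2 ^- j <= 2 ^- k :> R.
Proof. by move=> kj; rewrite lef_pV2 ?posrE ?exprn_gt0// ler_eXn2l// ltr1n. Qed.

Let pow_lt k : 2 ^- k.+1 < 2 ^- k :> R.
Proof. by rewrite exprS invfM gtr_pMl// invf_lt1// ltr1n. Qed.

Lemma measurable_dyadic k : measurable (dyadic k).
Proof. exact: measurable_itv. Qed.

Lemma dyadic_sub k : dyadic k `<=` `]0, 1[%classic.
Proof.
move=> e /dyadicP /andP[a b]; rewrite /= in_itv/= (lt_le_trans _ a)//=.
by apply: lt_le_trans b _; have := pow_le (leq0n k); rewrite expr0 invr1.
Qed.

Lemma dyadic_inj k j e : dyadic k e -> dyadic j e -> k = j.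
Proof.
wlog kj : k j / (k < j)%N.
  move=> H ke je; case: (ltngtP k j) => // [lt|lt]; first exact: H.
  by apply/esym; exact: H.
move=> /dyadicP /andP[a _] /dyadicP /andP[_ b].
by have := lt_le_trans b (le_trans (pow_le kj) a); rewrite ltxx.
Qed.

Lemma ex_dyadic e : 0 < e -> e < 1 -> exists k, dyadic k e.
Proof.
move=> e0 e1; have ex : exists k, 2 ^- k.+1 <= e.
  by have [k _ /(_ k.+1 (leqnSn k))] := near_half_pow_le e0; exists k.
exists (ex_minn ex); case: ex_minnP => k ke kmin; apply/dyadicP; rewrite ke /=.
case: k ke kmin => [|k] ke kmin; first by rewrite expr0 invr1.
by rewrite ltNge; apply/negP => /kmin; rewrite ltnn.
Qed.

Lemma lebesgue_dyadic k : leb (dyadic k) = (2 ^- k.+1)%:E.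
Proof.
rewrite lebesgue_measure_itv/= lte_fin; case: ifPn => [_|].
  rewrite -EFinD; congr EFin; rewrite exprS invfM.
  set x := (2 ^+ k)^-1; lra.
by rewrite pow_lt.
Qed.

Local Open Scope ereal_scope.

Definition dyadic_step (a : nat -> \bar R) e : \bar R :=
  \sum_(k <oo) (a k * (\1_(dyadic k) e)%:E).

Lemma dyadic_stepE a k e : (forall j, 0 <= a j) -> dyadic k e -> dyadic_step a e = a k.
Proof.
move=> a0 ke; rewrite /dyadic_step (@ge0_nneseries_single _ _ k).
- by rewrite indicE mem_set ?mule1.
- by move=> j; rewrite mule_ge0// lee_fin.
- move=> j jk; rewrite indicE memNset ?mule0// => je.
  by move/eqP : jk; apply; exact: dyadic_inj je ke.
Qed.

Lemma integral_dyadic_step a : (forall j, 0 <= a j) ->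
  \int[leb]_(e in `]0%R, 1%R[) dyadic_step a e = \sum_(k <oo) (a k * (2 ^- k.+1)%:E).
Proof.
move=> a0; rewrite integral_nneseries//; last 2 first.
- move=> k; apply: measurable_funTS; apply: measurable_funeM.
  by apply/measurable_EFinP; apply: measurable_indic; exact: measurable_dyadic.
- by move=> k e _; rewrite mule_ge0// lee_fin.
apply: eq_eseriesr => k _; rewrite ge0_integralZl//.
- rewrite integral_indic//; last exact: measurable_dyadic.
  rewrite setIidl; last exact: dyadic_sub.
  by rewrite -lebesgue_dyadic.
- apply: measurable_funTS; apply/measurable_EFinP; apply: measurable_indic.
  exact: measurable_dyadic.
Qed.

Lemma powR_half_pow t k : ((2 ^- k)%R `^ t = 2 `^ (- (t * k%:R)))%R.
Proof. by rewrite mulrC -mulNr powRrM powR_invn. Qed.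

Lemma dyadic_weight_ge t k e : (0 <= t)%R -> dyadic k e ->
  (2 `^ (t * k%:R) * 2 ^+ k <= (e `^ (t + 1))^-1)%R.
Proof.
move=> t0 /dyadicP /andP[a b]; have e0 := lt_le_trans (pow0 _) a.
rewrite -[leLHS]invrK lef_pV2 ?posrE ?powR_gt0//.
apply: le_trans (_ : _ <= (2 ^- k)%R `^ (t + 1))%R _.
  by apply: ge0_ler_powR; rewrite ?addr_ge0 ?nnegrE ?(ltW e0) ?(ltW (pow0 _)) ?(ltW b).
rewrite powR_half_pow mulrDl mul1r opprD powR2D.
by rewrite powR_invn// invfM powRN lexx.
Qed.

Lemma dyadic_weight_le t k e : (0 <= t)%R -> dyadic k e ->
  ((e `^ (t + 1))^-1 <= 2 `^ t * 2 `^ (t * k%:R) * 2 ^+ k.+1)%R.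
Proof.
move=> t0 /dyadicP /andP[a b]; have e0 := lt_le_trans (pow0 _) a.
rewrite -[leRHS]invrK lef_pV2 ?posrE ?powR_gt0//.
apply: le_trans (_ : _ <= (2 ^- k.+1)%R `^ (t + 1))%R _; last first.
  by apply: ge0_ler_powR; rewrite ?addr_ge0 ?nnegrE ?(ltW e0) ?(ltW (pow0 _)).
rewrite powR_half_pow mulrDl mul1r opprD powR2D.
rewrite powR_invn// invfM ler_wpM2r ?(ltW (pow0 _))// -powR2D.
by rewrite (_ : t + t * k%:R = t * k.+1%:R)%R -?powRN ?lexx// -[k.+1%:R]natr1; ring.
Qed.

Lemma dyadic_integral_ge (G : R -> \bar R) (c : nat -> \bar R) t (K : R) :
  (0 <= t)%R -> (0 < K)%R -> (forall k, 0 <= c k) ->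
  (forall k e, dyadic k e -> c k <= K%:E * G e) ->
  \sum_(k <oo) (2 `^ (t * k%:R))%:E * c k <=
  (2 * K)%:E * \int[leb]_(e in `]0%R, 1%R[) (((e `^ (t + 1))^-1)%:E * G e).
Proof.
move=> t0 K0 c0 cG.
(* On [dyadic k] the weight is at least 2^(t k) 2^k. The interval has length 2^-(k+1), which leaves
   the factor 1/2 that the 2 in the constant compensates. *)
pose a k := (K^-1 * (2 `^ (t * k%:R) * 2 ^+ k))%:E * c k.
have a0 k : 0 <= a k.
  by rewrite mule_ge0// lee_fin !mulr_ge0 ?invr_ge0 ?powR_ge0 ?exprn_ge0// ltW.
apply: le_trans (_ : _ <= (2 * K)%:E * \int[leb]_(e in `]0%R, 1%R[) dyadic_step a e) _.
  rewrite integral_dyadic_step// -nneseriesZl; last first.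
    by move=> k _; rewrite mule_ge0// lee_fin.
  apply: eq_leW; apply: eq_eseriesr => k _.
  rewrite /a muleAC muleA -!EFinM; congr (_%:E * _).
  have e1 : (2 ^+ k != 0 :> R)%R by rewrite expf_neq0.
  by rewrite exprS; field; rewrite e1 gt_eqF.
apply: lee_wpmul2l; first by rewrite lee_fin mulr_ge0// ltW.
apply: ge0_le_integral_nonmeasurable => e.
  by move=> _; apply: nneseries_ge0 => k _ _; rewrite mule_ge0// lee_fin.
rewrite /= in_itv/= => /andP[e0 e1]; have [k ke] := ex_dyadic e0 e1.
rewrite (dyadic_stepE _ ke)// /a mulrC EFinM -muleA.
apply: lee_pmul => //.
- by rewrite mule_ge0// lee_fin invr_ge0 ltW.
- by rewrite lee_fin dyadic_weight_ge.
- by rewrite lee_pdivrMl//; exact: cG.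
Qed.

Lemma dyadic_integral_le (G : R -> \bar R) (c : nat -> \bar R) t :
  (0 <= t)%R -> (forall e, (0 < e)%R -> 0 <= G e) ->
  (forall k e, dyadic k e -> G e <= c k) ->
  \int[leb]_(e in `]0%R, 1%R[) (((e `^ (t + 1))^-1)%:E * G e) <=
  (2 `^ t)%:E * \sum_(k <oo) (2 `^ (t * k%:R))%:E * c k.
Proof.
move=> t0 G0 Gc.
have c0 k : 0 <= c k.
  have kk : dyadic k (2 ^- k.+1)%R.
    by apply/dyadicP; rewrite lexx pow_lt.
  exact: le_trans (G0 _ (pow0 _)) (Gc _ _ kk).
(* The upper bound of the weight is reached at the left endpoint 2^-(k+1), whence the extra 2^t; its
   factor 2^(k+1) cancels the length of the interval. *)
pose a k := (2 `^ t * 2 `^ (t * k%:R) * 2 ^+ k.+1)%:E * c k.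
have a0 k : 0 <= a k.
  by rewrite mule_ge0// lee_fin !mulr_ge0 ?powR_ge0 ?exprn_ge0.
apply: le_trans (_ : _ <= \int[leb]_(e in `]0%R, 1%R[) dyadic_step a e) _.
  apply: ge0_le_integral_nonmeasurable => e.
    rewrite /= in_itv/= => /andP[e0 e1].
    by rewrite mule_ge0 ?G0// lee_fin invr_ge0 powR_ge0.
  rewrite /= in_itv/= => /andP[e0 e1]; have [k ke] := ex_dyadic e0 e1.
  rewrite (dyadic_stepE _ ke)//; apply: lee_pmul => //.
  - by rewrite lee_fin invr_ge0 powR_ge0.
  - exact: G0.
  - by rewrite lee_fin dyadic_weight_le.
  - exact: Gc.
rewrite integral_dyadic_step// -nneseriesZl; last first.
  by move=> k _; rewrite mule_ge0// lee_fin powR_ge0.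
apply: eq_leW; apply: eq_eseriesr => k _.
rewrite /a muleAC muleA -!EFinM; congr (_%:E * _).
by rewrite mulfK// expf_neq0.
Qed.

(** The infima of w on the dyadic intervals have a weighted sum bounded by the integral. The infimum
    need not be attained, so [tau k] comes within 2^(-t k) 2^-(k+1) of it, and these errors add up
    to 1 after weighting. *)
Lemma ex_dyadic_points (w : R -> R) t : (0 <= t)%R -> (forall e, 0 <= w e)%R ->
  \int[leb]_(e in `]0%R, 1%R[) (((e `^ (t + 1))^-1)%:E * (w e)%:E) < +oo ->
  exists2 tau : nat -> R, forall k, dyadic k (tau k) &
    \sum_(k <oo) (2 `^ (t * k%:R) * w (tau k))%:E < +oo.
Proof.
move=> t0 w0 foo.
have W0 k : (0 < 2 `^ (t * k%:R) :> R)%R by rewrite powR_gt0.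
pose kap k := inf [set w e | e in dyadic k].
have hi k : has_inf [set w e | e in dyadic k].
  split; last by exists 0%R => _ [e _ <-].
  exists (w (2 ^- k.+1)%R), (2 ^- k.+1)%R => //.
  by apply/dyadicP; rewrite lexx pow_lt.
have kap0 k : (0 <= kap k)%R.
  by apply: lb_le_inf; [exact: (hi k).1|move=> _ [e _ <-]].
have /choice[tau Htau] k : exists e, dyadic k e /\
    (w e < kap k + (2 `^ (t * k%:R))^-1 * (1 / (2 ^ k.+1)%:R))%R.
  have d0 : (0 < (2 `^ (t * k%:R))^-1 * (1 / (2 ^ k.+1)%:R) :> R)%R.
    by rewrite mulr_gt0 ?invr_gt0// divr_gt0// ltr0n expn_gt0.
  by have [_ [e ke <-] we] := inf_adherent d0 (hi k); exists e.
exists tau => [k|]; first by have [] := Htau k.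
have S1 : \sum_(k <oo) (2 `^ (t * k%:R))%:E * (kap k)%:E < +oo.
  apply: le_lt_trans (_ : (2 * 1)%:E *
    \int[leb]_(e in `]0%R, 1%R[) (((e `^ (t + 1))^-1)%:E * (w e)%:E) < +oo).
    apply: dyadic_integral_ge => // k e ke.
    rewrite mul1e lee_fin; apply: inf_lbound; first exact: (hi k).2.
    by exists e.
  by apply: lte_mul_pinfty.
apply: le_lt_trans (_ : _ <= \sum_(k <oo) ((2 `^ (t * k%:R))%:E * (kap k)%:E +
    (1 / (2 ^ k.+1)%:R)%:E)) _.
  apply: lee_nneseries => [k _ _|k _]; first by rewrite lee_fin mulr_ge0// ltW.
  have [_ /ltW h] := Htau k; rewrite -EFinM -EFinD lee_fin.
  apply: le_trans (ler_wpM2l (ltW (W0 k)) h) _.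
  by rewrite mulrDr lerD2l mulVKf// gt_eqF.
apply: le_lt_trans (epsilon_trick xpredT _ ler01) _.
  by move=> k; rewrite -EFinM lee_fin mulr_ge0// ltW.
by rewrite lte_add_pinfty ?ltry.
Qed.

Lemma nneseries_powR_lty s (C : R) : (0 < s)%R -> (0 <= C)%R ->
  \sum_(k <oo) (C * 2 `^ (- (s * k%:R)))%:E < +oo.
Proof.
move=> s0 C0.
have z1 : (`|2 `^ (- s)| < 1 :> R)%R.
  rewrite ger0_norm ?powR_ge0// powRN invf_lt1 ?powR_gt0//.
  by rewrite -[X in (X < _)%R](powRr0 2) /powR pnatr_eq0/= ltr_expR ltr_pM2r ?ln_gt0 ?ltr1n.
have -> : \sum_(k <oo) (C * 2 `^ (- (s * k%:R)))%:E = (C * (1 - 2 `^ (- s))^-1)%:E.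
  apply/cvg_lim => //; under eq_fun do rewrite sumEFin.
  apply/fine_cvgP; split; first exact: nearW.
  rewrite (_ : _ \o _ = series (geometric C (2 `^ (- s)))).
    exact: cvg_geometric_series.
  apply/funext => m; rewrite /series /=; apply: eq_bigr => i _.
  by rewrite -powR_mulrn ?powR_ge0// -powRrM mulNr.
exact: ltry.
Qed.

End dyadic.

(** * The two inequalities between the norms *)

Section main.
Context {R : realType} {n : nat} (zeta : 'rV[R]_n -> R[i]) (zetaP : LP_cutoff zeta).
Context (rho : 'rV[R]_n -> R[i]) (rho1 : in_Lp 1 rho).
Local Notation V := 'rV[R]_n.
Local Notation mu := (@lebesgue_rV R n).
Implicit Types (f g h eta : V -> R[i]) (j k : nat).

Let z1 := LP_cutoff_in_L1 zetaP.

Variables (s q : R) (p : \bar R).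
Hypotheses (s0 : 0 < s) (q1 : 1 <= q) (p1 : (1 <= p)%E).

Let q0 : 0 < q. Proof. exact: lt_le_trans q1. Qed.
Let sq0 : 0 <= s * q. Proof. by rewrite mulr_ge0// ltW. Qed.

Let A := fine (Lp_norm 1 zeta).
Let AE : Lp_norm 1 zeta = A%:E.
Proof. by rewrite fineK// ge0_fin_numE ?Lp_norm_ge0// (Lp_norm_lty z1). Qed.
Let A0 : 0 <= A. Proof. by rewrite fine_ge0// Lp_norm_ge0. Qed.

Lemma Lp_norm_LP_block f j : in_Lp p f ->
  (Lp_norm p (LP_block zeta f j) <= (A + A)%:E * Lp_norm p f)%E.
Proof.
move=> fp; rewrite LP_blockE; have K1 := in_L1_LP_kernel zetaP j.
apply: le_trans (Lp_norm_convolution p1 (in_Lp_meas fp) (in_Lp_meas K1)) _.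
rewrite muleC; apply: lee_wpmul2r; first exact: Lp_norm_ge0.
by rewrite EFinD -AE; exact: Lp_norm_LP_kernel.
Qed.

Let term_ge0 f j : (0 <= (2 `^ (s * j%:R * q))%:E * Lp_norm p (LP_block zeta f j) `^ q)%E.
Proof. by rewrite mule_ge0 ?poweR_ge0// lee_fin powR_ge0. Qed.

Lemma besov_seminorm_le : exists C1 C2 : R, [/\ 0 <= C1, 0 <= C2 &
  forall f, in_Lp p f -> (besov_seminormXq zeta s p q f <=
    C1%:E * Lp_norm p f `^ q + C2%:E * mollif_integral rho s p q f)%E].
Proof.
have [d d0 Hd] := LP_block_lower zetaP rho1 p1.
(* Since 2^-a <= d, [Hd] controls the block k + a + 2 for every e in [dyadic k]; the blocks below a
   + 2 are bounded by the norm of f and make up [C1]. *)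
have [a ad] := ex_half_pow_le d0.
(* 4 A is the constant of [LP_block_lower]; the 1 makes it positive, as [dyadic_integral_ge]
   requires. *)
have K0 : 0 < 4 * A + 1 by rewrite ltr_wpDl// mulr_ge0.
exists (\sum_(0 <= j < a.+2) 2 `^ (s * j%:R * q) * (A + A) `^ q).
exists (2 `^ (s * a.+2%:R * q) * (2 * (4 * A + 1) `^ q)); split.
- by apply: sumr_ge0 => j _; rewrite mulr_ge0 ?powR_ge0.
- by rewrite !mulr_ge0 ?powR_ge0.
move=> f fp; rewrite /besov_seminormXq (nneseries_split 0 a.+2)//.
rewrite add0n; apply: leeD.
  rewrite -sumEFin ge0_sume_distrl; last by move=> j _; rewrite lee_fin mulr_ge0 ?powR_ge0.
  apply: lee_sum => j _; rewrite EFinM -muleA; apply: lee_wpmul2l.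
    by rewrite lee_fin powR_ge0.
  rewrite -poweR_EFin -poweRM ?Lp_norm_ge0//; last by rewrite lee_fin addr_ge0.
  by apply: ge0_le_poweR; [exact: ltW|exact: Lp_norm_ge0|exact: Lp_norm_LP_block].
rewrite -(nneseries_addn (f := fun j =>
  ((2 `^ (s * j%:R * q))%:E * Lp_norm p (LP_block zeta f j) `^ q)%E))//.
rewrite [leLHS](_ : _ = ((2 `^ (s * a.+2%:R * q))%:E *
    \sum_(k <oo) (2 `^ (s * q * k%:R))%:E * Lp_norm p (LP_block zeta f (k + a.+2)) `^ q)%E).
  rewrite [X in (_ <= X * _)%E]EFinM -[leRHS]muleA; apply: lee_wpmul2l.
    by rewrite lee_fin powR_ge0.
  apply: dyadic_integral_ge => //.
  - by rewrite powR_gt0.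
  - by move=> k; exact: poweR_ge0.
  move=> k e /dyadicP /andP[ke _].
  have e0 : 0 < e by apply: lt_le_trans ke; rewrite invr_gt0 exprn_gt0.
  have jde : 2 ^- (k + a.+1) <= d * e.
    rewrite addnS -addSn exprD invfM mulrC; exact: ler_pM.
  rewrite -poweR_EFin -poweRM ?Lp_norm_ge0//; last by rewrite lee_fin ltW.
  apply: ge0_le_poweR; [exact: ltW|exact: Lp_norm_ge0|rewrite addnS].
  apply: le_trans (Hd _ _ _ e0 jde fp) _.
  rewrite muleA; apply: lee_wpmul2r; first exact: Lp_norm_ge0.
  by rewrite AE -EFinD -EFinM lee_fin; lra.
rewrite -nneseriesZl; last by move=> k _; rewrite mule_ge0 ?poweR_ge0// lee_fin powR_ge0.
apply: eq_eseriesr => k _; rewrite muleA; congr (_ * _)%E.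
rewrite -EFinM; congr EFin; rewrite -powR2D.
by congr (_ `^ _); rewrite natrD; ring.
Qed.

(** Divide eta by its integral: the error is linear in eta, so only the constant changes. *)
Lemma LP_block_upperZ eta : in_Lp 1 eta -> cint mu eta != 0 ->
  exists2 d : R, 0 < d & exists2 M : R, 0 <= M & forall j (e t : R) f, 0 < e -> 0 < t ->
  e * 2 ^+ j.+1 <= d * t -> in_Lp p f ->
  (Lp_norm p (convolution (mollif_err rho e f) (LP_kernel zeta j)) <=
   M%:E * (Lp_norm p (LP_block zeta f j) * Lp_norm 1 (mollif_err rho t eta)))%E.
Proof.
move=> eta1 c0; set c := cint mu eta in c0.
pose eta' x := c^-1 * eta x.
have eta'1 : in_Lp 1 eta' by exact: in_L1Z.
have eta'int : cint mu eta' = 1.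
  by rewrite cintZ; [exact: mulVf|exact/in_L1P].
have [d d0 Hd] := LP_block_upper zetaP rho1 p1 eta'1 eta'int.
exists d => //; exists (2 * normc c^-1); first by rewrite mulr_ge0 ?normc_ge0.
move=> j e t f e0 t0 et fp; apply: le_trans (Hd j e t f e0 t0 et fp) _.
rewrite EFinM -muleA; apply: lee_wpmul2l => //.
rewrite muleCA; apply: lee_wpmul2l; first exact: Lp_norm_ge0.
have rt1 := in_L1_dilate t0 rho1.
have m1 := in_Lp_meas (in_Lp_mollif_err rho1 (lexx _) t0 eta1).
rewrite -Lp_norm1Z//; apply: eq_leW; apply: eq_Lp_norm => //.
- exact: in_Lp_meas (in_Lp_mollif_err rho1 (lexx _) t0 eta'1).
- by apply: cmeasurableM => //; exact: cmeasurable_cst.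
by apply: filterS (convolutionZl c^-1 eta1 rt1) => x hx; rewrite /mollif_err hx mulrBr.
Qed.

Lemma mollif_integral_le eta : in_Lp 1 eta -> cint mu eta != 0 ->
  (\int[lebesgue_measure]_(e in `]0%R, 1%R[)
     ((e `^ (s + 1))^-1%:E * Lp_norm 1%E (mollif_err rho e eta)) < +oo)%E ->
  exists2 C : R, 0 <= C & forall f, in_Lp p f ->
    (mollif_integral rho s p q f <= C%:E * besov_seminormXq zeta s p q f)%E.
Proof.
move=> eta1 etaint foo.
have [d d0 [M M0 Hd]] := LP_block_upperZ eta1 etaint.
have [a ad] := ex_half_pow_le d0.
pose w e := fine (Lp_norm 1 (mollif_err rho e eta)).
have w0 e : 0 <= w e by rewrite fine_ge0// Lp_norm_ge0.
have wE e : 0 < e -> Lp_norm 1 (mollif_err rho e eta) = (w e)%:E.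
  move=> e0; rewrite fineK// ge0_fin_numE ?Lp_norm_ge0//.
  exact: Lp_norm_lty (in_Lp_mollif_err rho1 (lexx _) e0 eta1).
have [|tau tauP tauoo] := ex_dyadic_points (ltW s0) w0.
  apply: le_lt_trans foo; apply: eq_leW.
  by apply: eq_integral => e; rewrite inE/= in_itv/= => /andP[e0 _]; rewrite wE.
pose C0 : R := 1 + fine (Lp_norm 1 rho).
have C00 : 0 <= C0 by rewrite addr_ge0// fine_ge0// Lp_norm_ge0.
have C0E : (1 + Lp_norm 1 rho)%E = C0%:E.
  by rewrite /C0 EFinD fineK// ge0_fin_numE ?Lp_norm_ge0// (Lp_norm_lty rho1).
(* With the sequence 2^(s j) |f_j|_p as unknown, [uu] is the kernel for i = k - j >= 0 and [vv] the
   one for i = j - k > 0. The first is summable by the choice of [tau], up to a + 2 terms for which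
   the trivial constant [C0] is used; the second decays geometrically because s > 0. *)
pose uu i : R := 2 `^ (s * i%:R) * (if (a.+2 <= i)%N then M * w (tau (i - a.+2)%N) else C0).
pose vv i : R := C0 * 2 `^ (- (s * i%:R)).
have uu0 i : 0 <= uu i by rewrite mulr_ge0 ?powR_ge0//; case: ifP => // _; rewrite mulr_ge0.
have vv0 i : 0 <= vv i by rewrite mulr_ge0 ?powR_ge0.
have uoo : (\sum_(i <oo) (uu i)%:E < +oo)%E.
  rewrite (nneseries_split 0 a.+2); last by move=> i _; rewrite lee_fin.
  apply: lte_add_pinfty; first by rewrite sumEFin ltry.
  rewrite add0n -(nneseries_addn (f := fun i => (uu i)%:E)); last first.
    by move=> i; rewrite lee_fin.
  rewrite [ltLHS](_ : _ = ((2 `^ (s * a.+2%:R) * M)%:E *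
    \sum_(i <oo) (2 `^ (s * i%:R) * w (tau i))%:E)%E).
    by apply: lte_mul_pinfty => //; rewrite lee_fin mulr_ge0 ?powR_ge0.
  rewrite -nneseriesZl; last by move=> i _; rewrite lee_fin mulr_ge0 ?powR_ge0.
  apply: eq_eseriesr => i _; rewrite -EFinM; congr EFin.
  rewrite /uu leq_addl addnK natrD mulrDr powR2D.
  ring.
have voo : (\sum_(i <oo) (vv i)%:E < +oo)%E by exact: nneseries_powR_lty.
have uv0 : (0 <= \sum_(i <oo) (uu i)%:E + \sum_(i <oo) (vv i)%:E)%E.
  by apply: adde_ge0; apply: nneseries_ge0 => i _ _; rewrite lee_fin.
pose S := fine (\sum_(i <oo) (uu i)%:E + \sum_(i <oo) (vv i)%:E)%E.
have S0 : 0 <= S by rewrite fine_ge0.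
have SE : (\sum_(i <oo) (uu i)%:E + \sum_(i <oo) (vv i)%:E)%E = S%:E.
  by rewrite fineK// ge0_fin_numE// lte_add_pinfty.
pose D k j : R := if (j <= k)%N then uu (k - j)%N else vv (j - k)%N.
have D0 k j : 0 <= D k j by rewrite /D; case: ifP.
have DE k j : (D k j)%:E = toeplitz (EFin \o uu) (EFin \o vv) k j.
  by rewrite /D /toeplitz; case: ifP.
have Drow k : (\sum_(j <oo) (D k j)%:E <= S%:E)%E.
  rewrite -SE; under eq_eseriesr do rewrite DE.
  by apply: toeplitz_row => i /=; rewrite lee_fin.
have Dcol j : (\sum_(k <oo) (D k j)%:E <= S%:E)%E.
  rewrite -SE; under eq_eseriesr do rewrite DE.
  by apply: toeplitz_col => i /=; rewrite lee_fin.
exists (2 `^ (s * q) * (S `^ (q - 1) * S)); first by rewrite !mulr_ge0 ?powR_ge0.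
move=> f fp.
pose N j := fine (Lp_norm p (LP_block zeta f j)).
have N0 j : 0 <= N j by rewrite fine_ge0// Lp_norm_ge0.
have NE j : Lp_norm p (LP_block zeta f j) = (N j)%:E.
  rewrite fineK// ge0_fin_numE ?Lp_norm_ge0//.
  apply: le_lt_trans (Lp_norm_LP_block j fp) _.
  by apply: lte_mul_pinfty; rewrite ?lee_fin ?addr_ge0//; exact: Lp_norm_lty.
pose b j := 2 `^ (s * j%:R) * N j.
have b0 j : 0 <= b j by rewrite mulr_ge0 ?powR_ge0.
have bD0 k j : 0 <= b j * D k j by rewrite mulr_ge0.
have main k e j : dyadic k e ->
    (Lp_norm p (convolution (mollif_err rho e f) (LP_kernel zeta j)) <=
     (2 `^ (- (s * k%:R)))%:E * (b j * D k j)%:E)%E.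
  move=> /dyadicP /andP[ke ek].
  have e0 : 0 < e by apply: lt_le_trans ke; rewrite invr_gt0 exprn_gt0.
  have triv : (Lp_norm p (convolution (mollif_err rho e f) (LP_kernel zeta j)) <=
      (C0 * N j)%:E)%E.
    have K1 := in_L1_LP_kernel zetaP j.
    rewrite (Lp_norm_convolution_mollif_err rho1 p1 e0 fp K1).
    rewrite EFinM -NE -C0E LP_blockE.
    by apply: Lp_norm_mollif_err => //; exact: in_Lp_convolution.
  rewrite -EFinM /b /D; case: (leqP j k) => [jk|kj]; last first.
    suff -> : 2 `^ (- (s * k%:R)) * (2 `^ (s * j%:R) * N j * vv (j - k)%N) = C0 * N j by [].
    rewrite /vv natrB ?(ltnW kj)//.
    transitivity (C0 * N j * (2 `^ (- (s * k%:R)) * 2 `^ (s * j%:R) *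
      2 `^ (- (s * (j%:R - k%:R))))); first ring.
    rewrite -!powR2D.
    have -> : - (s * k%:R) + s * j%:R - s * (j%:R - k%:R) = 0 by ring.
    by rewrite powRr0 mulr1.
  have E (x : R) : 2 `^ (- (s * k%:R)) * (2 `^ (s * j%:R) * N j *
      (2 `^ (s * (k - j)%N%:R) * x)) = N j * x.
    rewrite natrB//.
    transitivity (N j * x * (2 `^ (- (s * k%:R)) * 2 `^ (s * j%:R) *
      2 `^ (s * (k%:R - j%:R)))); first ring.
    rewrite -!powR2D.
    have -> : - (s * k%:R) + s * j%:R + s * (k%:R - j%:R) = 0 by ring.
    by rewrite powRr0 mulr1.
  rewrite /uu E; case: ifPn => [ai|_]; last by rewrite mulrC.
  set m := (k - j - a.+2)%N; have /dyadicP /andP[tm _] := tauP m.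
  have t0 : 0 < tau m by apply: lt_le_trans tm; rewrite invr_gt0 exprn_gt0.
  (* The origin of the shift a + 2: e < 2^-k, [tau m] >= 2^-(m+1) and d >= 2^-a give this as soon as
     (j + 1) + a + (m + 1) <= k, an equality for the chosen [m]. *)
  have cond : e * 2 ^+ j.+1 <= d * tau m.
    apply: le_trans (_ : 2 ^- a * 2 ^- m.+1 <= _); last first.
      by apply: ler_pM; rewrite ?invr_ge0 ?exprn_ge0.
    rewrite -invfM -exprD -[leRHS]mul1r ler_pdivlMr ?exprn_gt0// -mulrA -exprD.
    apply: le_trans (_ : 2 ^- k * 2 ^+ (j.+1 + (a + m.+1)) <= _).
      by rewrite ler_pM2r ?exprn_gt0// ltW.
    rewrite mulrC ler_pdivrMr ?exprn_gt0// mul1r ler_weXn2l ?ler1n//.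
    by rewrite /m; move: ai; clear; lia.
  apply: le_trans (Hd _ _ _ _ e0 t0 cond fp) _.
  rewrite wE// NE -!EFinM lee_fin.
  by rewrite mulrCA.
pose T k := (\sum_(j <oo) (b j * D k j)%:E)%E.
have T0 k : (0 <= T k)%E by apply: nneseries_ge0 => j _ _; rewrite lee_fin.
(* The weight 2^(s q k) of the k-th interval cancels the q-th power of 2^(-s k). What remains is the
   sum of the [T k] to the power q, and the q-th powers of the [b j] are the terms of the
   seminorm. *)
apply: le_trans (dyadic_integral_le (t := s * q)
  (c := fun k => ((2 `^ (- (s * k%:R)))%:E * T k) `^ q)%E sq0 _ _) _.
- by move=> e _; exact: poweR_ge0.
- move=> k e ke; apply: ge0_le_poweR; [exact: ltW|exact: Lp_norm_ge0|].
  have e0 : 0 < e.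
    by move/dyadicP : ke => /andP[ke _]; apply: lt_le_trans ke; rewrite invr_gt0 exprn_gt0.
  apply: le_trans (Lp_norm_le_LP zetaP p1 (in_Lp_mollif_err rho1 p1 e0 fp)) _.
  rewrite -nneseriesZl; last by move=> j _; rewrite lee_fin.
  by apply: lee_nneseries => [j _ _|j _]; [exact: Lp_norm_ge0|exact: main].
rewrite EFinM -muleA; apply: lee_wpmul2l; first by rewrite lee_fin powR_ge0.
rewrite (eq_eseriesr (g := fun k => (T k `^ q)%E)); last first.
  move=> k _; rewrite poweRM//.
  rewrite muleA poweR_EFin -EFinM -powRrM -powR2D.
  have -> : s * q * k%:R + - (s * k%:R) * q = 0 by ring.
  by rewrite powRr0 mul1e.
apply: le_trans (schur_series q1 b0 D0 S0 Drow Dcol) _.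
apply: lee_wpmul2l; first by rewrite lee_fin mulr_ge0 ?powR_ge0.
apply: eq_leW; apply: eq_eseriesr => j _.
by rewrite NE poweR_EFin -EFinM /b powRM ?powR_ge0// -powRrM.
Qed.

End main.

Theorem theorem1p3 (R : realType) (n : nat) (n_gt0 : (0 < n)%N)
    (zeta : 'rV[R]_n -> R[i]) (zetaP : LP_cutoff zeta)
    (rho : 'rV[R]_n -> R[i]) (rho_L1 : in_Lp 1%E rho)
    (rho_int1 : cintegral rho = 1)
    (s : R) (s_gt0 : 0 < s) :
  (exists eta : 'rV[R]_n -> R[i],
     [/\ schwartz eta, cintegral eta <> 0 &
         (\int[lebesgue_measure]_(e in `]0%R, 1%R[)
            ((e `^ (s + 1))^-1%R%:E * Lp_norm 1%E (eta \- convolution eta (dilate e rho))%R)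
          < +oo)%E])
  <->
  (forall (p : \bar R) (q : R), (1 <= p)%E -> 1 <= q ->
     exists C : R, 1 <= C /\
       forall f : 'rV[R]_n -> R[i], in_Lp p f ->
         let besov := besov_normXq zeta s p q f in
         let mollif := (Lp_norm p f `^ q + mollif_integral rho s p q f)%E in
         (besov <= C%:E * mollif)%E /\ (mollif <= C%:E * besov)%E).
Proof.
have z1 := LP_cutoff_in_L1 zetaP.
split=> [[eta [/schwartz_in_L1 eta1 etaint etaoo]] p q p1 q1|H].
  have etaint0 : cint (lebesgue_rV n) eta != 0 by exact/eqP.
  have [C1 [C2 [C10 C20 HC]]] := besov_seminorm_le zetaP rho_L1 s_gt0 q1 p1.
  have [C3 C30 HC3] := mollif_integral_le zetaP rho_L1 s_gt0 q1 p1 eta1 etaint0 etaoo.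
  (* The sum dominates each of the constants 1 + C1, C2, 1 and C3 that the two inequalities
     require. *)
  exists (1 + C1 + C2 + C3); split; first by rewrite -!addrA lerDl !addr_ge0.
  move=> f fp /=; rewrite /besov_normXq.
  set X := (Lp_norm p f `^ q)%E.
  have X0 : (0 <= X)%E by exact: poweR_ge0.
  have I0 : (0 <= mollif_integral rho s p q f)%E.
    apply: integral_ge0 => e _; rewrite mule_ge0 ?poweR_ge0//.
    by rewrite lee_fin invr_ge0 powR_ge0.
  have B0 : (0 <= besov_seminormXq zeta s p q f)%E.
    by apply: nneseries_ge0 => j _ _; rewrite mule_ge0 ?poweR_ge0.
  move: (HC f fp) (HC3 f fp); rewrite -/X.
  move: (mollif_integral rho s p q f) I0 (besov_seminormXq zeta s p q f) B0 => I I0 B B0 HI HB.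
  rewrite !ge0_muleDr//; split.
    apply: le_trans (leeD (lexx _) HI) _.
    rewrite addeA -{1}(mul1e X) -ge0_muleDl ?lee_fin//.
    apply: leeD; apply: lee_wpmul2r => //; rewrite -?EFinD lee_fin; lra.
  apply: leeD.
    by rewrite -{1}(mul1e X); apply: lee_wpmul2r => //; rewrite lee_fin; lra.
  apply: le_trans HB _; apply: lee_wpmul2r => //; rewrite lee_fin; lra.
exists zeta; split.
- by case: zetaP.
- by rewrite -[cintegral zeta]/(cint _ zeta) cint_LP//; apply/eqP; exact: oner_neq0.
have [C [C1 /(_ zeta z1)[_ /=]]] := H 1%E 1 (lexx _) (lexx _).
have foo : (besov_normXq zeta s 1 1 zeta < +oo)%E.
  apply: lte_add_pinfty; first exact: poweR_lty (Lp_norm_lty z1).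
  rewrite /besov_seminormXq (nneseries_split 0 2); last first.
    by move=> j _; rewrite mule_ge0 ?poweR_ge0// lee_fin powR_ge0.
  rewrite add0n [X in (_ + X)%E]eseries0 ?adde0; last first.
    move=> j j2 _; rewrite LP_blockE.
    rewrite (eq_Lp_norm (lexx _) _ (cmeasurable_cst 0) (convolution_LP_kernel zetaP j2)).
      rewrite Lp_norm1; under eq_integral do rewrite Normc.normc0.
      by rewrite integral0 poweRe1// mule0.
    exact: in_Lp_meas (in_Lp_convolution (lexx _) z1 (in_L1_LP_kernel zetaP j)).
  apply: lte_sum_pinfty => j _; apply: lte_mul_pinfty => //.
  apply: poweR_lty; rewrite LP_blockE.
  exact: Lp_norm_lty (in_Lp_convolution (lexx _) z1 (in_L1_LP_kernel zetaP j)).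
move=> Hle; have : (mollif_integral rho s 1 1 zeta < +oo)%E.
  apply: le_lt_trans (_ : C%:E * besov_normXq zeta s 1 1 zeta < +oo)%E; last first.
    by apply: lte_mul_pinfty => //; rewrite lee_fin (le_trans ler01).
  by apply: le_trans Hle; rewrite leeDr// poweR_ge0.
rewrite /mollif_integral mulr1.
by under eq_integral do rewrite (poweRe1 (Lp_norm_ge0 _ _)).
Qed.
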